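(* For every $h\in(0,\infty]$ there exist a noncompact Riemannian manifold $M$, a $C^{\infty}$-diffeomorphism $f:M\to M$ and an $f$-invariant probability measure $\mu$ on $M$ whose measure-theoretic entropy satisfies $h_{\mu}(f)=h$ and such that, $\mu$-almost everywhere, the Lyapunov exponents of $f$ are equal to zero. In other words, $$0=\int \chi^{+}\,d\mu < h_{\mu}(f)\leq \infty .$$
   Context: The measure-theoretic (Kolmogorov–Sinai) entropy is $h_\mu(f)=\sup_{\mathcal P}\lim_{n\to\infty}\frac1n H_\mu(\mathcal P^n)$, where the supremum is over finite measurable partitions $\mathcal P$, $\mathcal P^n$ is the common refinement of $f^{-i}\mathcal P$ for $0\le i\le n-1$, and $H_\mu(\mathcal P)=-\sum_{P\in\mathcal P}\mu(P)\log\mu(P)$. Let $(M,g)$ be a Riemannian manifold (completeness of $g$ is not required), let $\|\cdot\|_x$ be the norm on $T_xM$ induced by $g$, and let $f:M\to M$ be a $C^1$-diffeomorphism. A point $x\in M$ is (Lyapunov–Perron) regular if there exist numbers $\lambda_1(x),\dots,\lambda_{s(x)}(x)$, called the Lyapunov exponents at $x$, and a decomposition $T_xM=\bigoplus_{i=1}^{s(x)}E_i(x)$ such that for every $i$ and every $v\in E_i(x)\setminus\{0\}$, $$\lim_{n\to\pm\infty}\frac1n\log\|d_xf^n v\|_{f^n x}=\lambda_i(x).$$ The statement that the Lyapunov exponents are zero $\mu$-almost everywhere means that $\mu$-almost every point is regular and that all its Lyapunov exponents are $0$. $\chi^+(x)$ denotes the sum of the positive Lyapunov exponents at the regular point $x$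 (so $\chi^+(x)=0$ if there are none). *)

(* Defs.v *)
From mathcomp Require Import all_boot all_order all_algebra.
From mathcomp Require Import all_classical all_reals all_analysis.
Set Implicit Arguments.
Unset Strict Implicit.
Unset Printing Implicit Defensive.
Import Order.TTheory GRing.Theory Num.Theory.
Import numFieldNormedType.Exports.
Local Open Scope classical_set_scope.
Local Open Scope ring_scope.

(* Only meant for an open set A of a finite-dimensional space V: there, f is
   C^(k+1) iff it is differentiable and x |-> 'd f x v is C^k for every v. *)
Fixpoint Ck_on (R : realType) (V W : normedModType R) (k : nat) (A : set V)
    (f : V -> W) : Prop :=
  if k is k'.+1 then
    (forall x, A x -> differentiable f x) /\
    (forall v, Ck_on k' A (fun x => 'd f x v))
  else forall x, A x -> {for x, continuous f}.

Definition smooth_on (R : realType) (V W : normedModType R) (A : set V)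
    (f : V -> W) : Prop :=
  forall k, Ck_on k A f.

Record chart (R : realType) (n : nat) (M : topologicalType) := Chart {
  cdom : set M ;
  cmap : M -> 'rV[R]_n ;
  cinv : 'rV[R]_n -> M ;
  _ : open cdom ;
  _ : open (cmap @` cdom) ;
  _ : forall x, cdom x -> cinv (cmap x) = x ;
  _ : forall x, cdom x -> {for x, continuous cmap} ;
  _ : forall y, (cmap @` cdom) y -> {for y, continuous cinv} }.

(* The chosen chart chart_at x only serves to identify T_x M with R^n, see
   tangent; M need not be connected. *)
Record smooth_manifold (R : realType) (n : nat) := SmoothManifold {
  carrier :> ptopologicalType ;
  atlas : set (chart R n carrier) ;
  chart_at : carrier -> chart R n carrier ;
  _ : hausdorff_space carrier ;
  _ : @second_countable carrier ;
  _ : forall x, atlas (chart_at x) ;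
  _ : forall x, cdom (chart_at x) x ;
  _ : forall c d, atlas c -> atlas d ->
      smooth_on (cmap c @` (cdom c `&` cdom d)) (cmap d \o cinv c) }.

Definition smooth_map (R : realType) (n : nat) (M N : smooth_manifold R n)
    (f : M -> N) : Prop :=
  continuous f /\
  forall c d, atlas c -> atlas d ->
    smooth_on (cmap c @` (cdom c `&` f @^-1` cdom d))
              (cmap d \o f \o cinv c).

Record diffeomorphism (R : realType) (n : nat) (M : smooth_manifold R n) :=
  Diffeomorphism {
    diffeo :> M -> M ;
    diffeo_inv : M -> M ;
    _ : cancel diffeo diffeo_inv ;
    _ : cancel diffeo_inv diffeo ;
    _ : smooth_map diffeo ;
    _ : smooth_map diffeo_inv }.

(* T_x M, a vector being given by its coordinates in the chart chart_at x *)
Definition tangent (R : realType) (n : nat) (M : smooth_manifold R n) (x : M)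
  : vectType R := 'rV[R]_n.

Definition tdiff (R : realType) (n : nat) (M : smooth_manifold R n)
    (f : M -> M) (x : M) (v : tangent x) : tangent (f x) :=
  'd (cmap (chart_at (f x)) \o f \o cinv (chart_at x))
     (cmap (chart_at x) x) v.

(* coordinate vector v at the point y of the image of c, seen in T_(c^-1 y) M *)
Definition of_coord (R : realType) (n : nat) (M : smooth_manifold R n)
    (c : chart R n M) (y : 'rV[R]_n) (v : 'rV[R]_n) : tangent (cinv c y) :=
  'd (cmap (chart_at (cinv c y)) \o cinv c) y v.

(* rm_inner x is the scalar product g_x; the last axiom says that its
   components in every chart of the atlas are smooth. *)
Record riemannian_metric (R : realType) (n : nat) (M : smooth_manifold R n) :=
  RiemannianMetric {
    rm_inner : forall x : M, tangent x -> tangent x -> R ;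
    _ : forall (x : M) (a : R) (u v w : tangent x),
        rm_inner (a *: u + v) w = a * rm_inner u w + rm_inner v w ;
    _ : forall (x : M) (v w : tangent x), rm_inner v w = rm_inner w v ;
    _ : forall (x : M) (v : tangent x), v != 0 -> 0 < rm_inner v v ;
    _ : forall (c : chart R n M), atlas c -> forall v w : 'rV[R]_n,
        smooth_on (W := R^o) (cmap c @` cdom c)
          (fun y => rm_inner (of_coord c y v) (of_coord c y w)) }.

Definition rm_norm (R : realType) (n : nat) (M : smooth_manifold R n)
    (g : riemannian_metric M) (x : M) (v : tangent x) : R :=
  Num.sqrt (rm_inner g v v).

(* Lyapunov exponents lam i (pairwise distinct) at x, with the nonzero
   subspaces E i of the corresponding decomposition of T_x M *)
Definition lyapunov_splitting (R : realType) (n : nat)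
    (M : smooth_manifold R n) (g : riemannian_metric M)
    (f : diffeomorphism M) (x : M) (s : nat) (lam : 'I_s -> R)
    (E : 'I_s -> {vspace tangent x}) : Prop :=
  [/\ injective lam,
      forall i, E i != 0%VS,
      (\sum_(i < s) E i)%VS = fullv,
      directv (\sum_(i < s) E i)%VS &
      forall (i : 'I_s) (v : tangent x), v \in E i -> v != 0 ->
        ((fun k : nat => ln (rm_norm g (tdiff (iter k f) v)) / k%:R)
           @ \oo --> lam i) /\
        ((fun k : nat =>
            ln (rm_norm g (tdiff (iter k (diffeo_inv f)) v)) / (- k%:R))
           @ \oo --> lam i)].

Definition regular (R : realType) (n : nat) (M : smooth_manifold R n)
    (g : riemannian_metric M) (f : diffeomorphism M) (x : M) : Prop :=
  exists (s : nat) (lam : 'I_s -> R) (E : 'I_s -> {vspace tangent x}),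
    lyapunov_splitting g f lam E.

Definition lyapunov_exponent (R : realType) (n : nat)
    (M : smooth_manifold R n) (g : riemannian_metric M)
    (f : diffeomorphism M) (x : M) (l : R) : Prop :=
  exists (s : nat) (lam : 'I_s -> R) (E : 'I_s -> {vspace tangent x}),
    lyapunov_splitting g f lam E /\ exists i, lam i = l.

(* The splitting at a regular point is unique up to reindexing. Exponents are
   counted with multiplicity, and chi_plus is 0 at the points that are not
   regular. *)
Definition chi_plus (R : realType) (n : nat) (M : smooth_manifold R n)
    (g : riemannian_metric M) (f : diffeomorphism M) (x : M) : R :=
  xget 0 [set c | exists (s : nat) (lam : 'I_s -> R)
                    (E : 'I_s -> {vspace tangent x}),
                    lyapunov_splitting g f lam E /\
                    c = \sum_(i < s | 0 < lam i) lam i *+ \dim (E i)].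

Definition partition_entropy (d : measure_display) (T : measurableType d)
    (R : realType) (mu : probability T R) (I : finType) (P : I -> set T) : R :=
  - \sum_(i : I) fine (mu (P i)) * ln (fine (mu (P i))).

(* The common refinement of the f^(-i) P for i < m; some of the sets of this
   family may be empty, which does not affect the entropy (ln 0 = 0). *)
Definition refinement (T : Type) (f : T -> T) (k m : nat) (P : 'I_k -> set T)
    (w : {ffun 'I_m -> 'I_k}) : set T :=
  \bigcap_(i in [set: 'I_m]) (iter i f @^-1` P (w i)).

(* When mu is f-invariant the limit exists, by subadditivity. *)
Definition ks_entropy (d : measure_display) (T : measurableType d)
    (R : realType) (mu : probability T R) (f : T -> T) : \bar R :=
  ereal_sup [set e | exists (k : nat) (P : 'I_k -> set T),
    [/\ classical_sets.partition [set: 'I_k] P [set: T],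
        forall i, measurable (P i) &
        e = (limn (fun m : nat =>
               partition_entropy mu (@refinement T f k m P) / m%:R))%:E]].

Notation borel M := (g_sigma_algebraType (@open M)).

Definition invariant_measure (d : measure_display) (T : measurableType d)
    (R : realType) (mu : probability T R) (f : T -> T) : Prop :=
  forall A : set T, measurable A -> mu (f @^-1` A) = mu A.

(* Main.v *)
Require Import Defs.
From HB Require Import structures.
From mathcomp Require Import all_boot all_order all_algebra.
From mathcomp Require Import all_classical all_reals all_analysis.
From mathcomp Require Import zify ring lra.
Set Implicit Arguments.
Unset Strict Implicit.
Unset Printing Implicit Defensive.
Import Order.TTheory GRing.Theory Num.Theory.
Import numFieldNormedType.Exports.

(** [M] is the plane with its flat metric and [f] a standard map
    [(x, d) |-> (x + d, d + phi (x + d))], whose orbits are the sequences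
    [(x_n, x_(n+1) - x_n)] with [x_(n+2) - 2 x_(n+1) + x_n = phi x_(n+1)].
    Along an orbit that only meets points where [phi] is locally constant, the
    differential of [f] is the unipotent matrix [[1, 1], [0, 1]], so vectors
    grow at most linearly and the Lyapunov exponents vanish.  It remains to find
    a transformation [T] of [[0, 1)] of entropy [h] and a map [place] from
    [[0, 1)] to the line such that a smooth [phi] is equal to
    [place (T y) - 2 place y + place (T^-1 y)] near each [place y].

    [T] is obtained by cutting and stacking: stage [j] consists of [N_j] columns
    of height [3 * 2^j - 2], and each column of stage [j + 1] is made of a
    spacer, two columns of stage [j] (every pair occurs) and a spacer.  [place]
    has a jump at each end point of a cell of each stage, so that
    [place (T y) - place y] is constant on cells, and sends the points that
    first belong to a column at stage [j] into [[j, j + 1]]: on this interval,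
    [phi] only has to take finitely many values, on disjoint intervals; the
    unboundedness of the plane makes room for all the stages.

    When the bottom of a stage [j] column is entered, all the columns are equally
    likely given the past, and this happens with probability [1 / (3 * 2^j)], so
    the entropy is at least [ln N_j / (3 * 2^j)] for each [j].  Conversely it is
    at most the supremum of these numbers, because they bound asymptotically the
    one-step conditional entropy of the partition into levels of stage [j].
    With [N_j = 2^(a_j)], the only constraint is [2 a_j <= a_(j+1)], which
    leaves every value of the supremum in [(0, +oo]] available. *)

(** * Entropy of finite-valued random variables *)

(** By Ruelle's inequality no such example exists on a compact manifold. Here [phi] has to change
    its value across gaps that shrink as the stage grows, which is harmless because the orbits only
    visit the places, around which it is locally constant.

    The spacers put every cell of a column strictly inside a column of the next stage. Thus the
    transformation and its inverse are defined at every point, and the value required of [phi] at a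
    place depends only on the cell of one further stage: this is why finitely many values are enough
    on each unit interval.

    Each pair of columns is repeated [m j] times. With [m j = 1] the ratio of [ln (N j)] to [2^j]
    would stay constant; the copies let it increase, so that its supremum can be prescribed.

    The jumps of [place] do not disturb the second differences: on a cell, the transformation is a
    translation by a whole number of cells of every later stage, so it crosses the same number of
    end points of each stage wherever it starts in the cell. *)

Section FiniteEntropy.
Local Open Scope classical_set_scope.
Local Open Scope ring_scope.
Context {R : realType} {d : measure_display} {T : measurableType d}.
Variable P : probability T R.

Definition pr (A : set T) : R := fine (P A).

Lemma prE A : measurable A -> (pr A)%:E = P A.
Proof. by move=> mA; rewrite fineK // fin_num_measure. Qed.

Lemma pr_ge0 A : 0 <= pr A.
Proof. exact/fine_ge0/measure_ge0. Qed.

Lemma prU A B : measurable A -> measurable B -> A `&` B = set0 ->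
  pr (A `|` B) = pr A + pr B.
Proof.
move=> mA mB AB0; rewrite /pr measureU// fineD// fin_num_measure//.
Qed.

Lemma pr_le A B : measurable A -> measurable B -> A `<=` B -> pr A <= pr B.
Proof.
move=> mA mB AB; rewrite /pr fine_le ?fin_num_measure// le_measure ?inE//.
Qed.

Lemma prT : pr setT = 1.
Proof. by rewrite /pr probability_setT. Qed.

Lemma pr0 : pr set0 = 0.
Proof. by rewrite /pr measure0. Qed.

Lemma pr_le1 A : measurable A -> pr A <= 1.
Proof. by move=> mA; rewrite -prT; apply: pr_le. Qed.

Lemma prC A : measurable A -> pr (~` A) = 1 - pr A.
Proof.
move=> mA; apply/eqP; rewrite eq_sym subr_eq -prT -(setvU A) prU//.
- exact: measurableC.
- by rewrite setICl.
Qed.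

Definition rvar (I : finType) (xi : T -> I) :=
  forall i, measurable (xi @^-1` [set i]).

Lemma sum_pair (I J : finType) (F : I * J -> R) :
  \sum_p F p = \sum_i \sum_j F (i, j).
Proof. by rewrite pair_bigA /=; apply: eq_bigr => -[]. Qed.

Definition law (I : finType) (xi : T -> I) (i : I) : R := pr (xi @^-1` [set i]).

Lemma rvar_preimage (I : finType) (xi : T -> I) (B : set I) :
  rvar xi -> measurable (xi @^-1` B).
Proof.
move=> mxi; have -> : xi @^-1` B = \bigcup_(i in B) (xi @^-1` [set i]).
  apply/seteqP; split => [x Bx|x [i Bi /= xii]]; first by exists (xi x).
  by rewrite /= xii.
by apply: fin_bigcup_measurable => //; apply: finite_finset.
Qed.

Lemma rvar_comp (I J : finType) (xi : T -> I) (g : I -> J) :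
  rvar xi -> rvar (g \o xi).
Proof. by move=> mxi j; rewrite comp_preimage; apply: rvar_preimage. Qed.

Lemma rvar_pair (I J : finType) (xi : T -> I) (zeta : T -> J) :
  rvar xi -> rvar zeta -> rvar (fun x => (xi x, zeta x)).
Proof.
move=> mxi mzeta [i j].
have -> : (fun x => (xi x, zeta x)) @^-1` [set (i, j)] =
    xi @^-1` [set i] `&` zeta @^-1` [set j].
  by apply/seteqP; split => x /=; [case=> -> -> | case=> -> ->].
exact: measurableI.
Qed.

Lemma pr_partition (I : finType) (xi : T -> I) (A : set T) (Q : pred I) :
  rvar xi -> measurable A ->
  \sum_(i | Q i) pr (A `&` xi @^-1` [set i]) = pr (A `&` xi @^-1` [set i | Q i]).
Proof.
move=> mxi mA.
have H (s : seq I) : uniq s -> \sum_(i <- s) pr (A `&` xi @^-1` [set i]) =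
    pr (A `&` xi @^-1` [set i | i \in s]).
  elim: s => [_|a s IH /= /andP[as_ us]].
    rewrite big_nil -pr0; congr pr.
    by apply/esym/seteqP; split => x //= [].
  rewrite big_cons IH // -prU //.
  - congr pr; rewrite -setIUr; congr (_ `&` _); apply/seteqP.
    split=> x /=; rewrite inE; first by case=> ->; rewrite ?eqxx ?orbT.
    by move=> /orP[/eqP|]; [left|right].
  - by apply: measurableI => //; apply: mxi.
  - by apply: measurableI => //; apply: rvar_preimage.
  - apply/seteqP; split => x //= -[[_ /= xa] [_ /=]].
    by rewrite xa; apply/negP.
rewrite -big_filter H ?filter_uniq ?index_enum_uniq //; congr pr.
by apply/seteqP; split => x /=; rewrite mem_filter mem_index_enum andbT.
Qed.

Lemma law_ge0 (I : finType) (xi : T -> I) i : 0 <= law xi i.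
Proof. exact: pr_ge0. Qed.

Lemma law_pair_sumr (I J : finType) (xi : T -> I) (zeta : T -> J) i :
  rvar xi -> rvar zeta ->
  \sum_j law (fun x => (xi x, zeta x)) (i, j) = law xi i.
Proof.
move=> mxi mzeta; have := pr_partition xpredT mzeta (mxi i).
rewrite (_ : [set _ | _] = setT) ?preimage_setT ?setIT; last first.
  by apply/seteqP; split.
rewrite -/(law xi i) => H; rewrite -H; apply: eq_bigr => j _; congr pr.
by apply/seteqP; split => x /=; [case=> -> -> | case=> -> ->].
Qed.

Lemma law_sum1 (I : finType) (xi : T -> I) : rvar xi -> \sum_i law xi i = 1.
Proof.
move=> mxi; have := pr_partition xpredT mxi measurableT.
rewrite (_ : [set _ | _] = setT) ?preimage_setT ?setIT ?prT; last first.
  by apply/seteqP; split.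
by move=> <-; apply: eq_bigr => j _; rewrite setTI.
Qed.

Definition ent (I : finType) (xi : T -> I) : R :=
  - \sum_i law xi i * ln (law xi i).

Lemma law_le1 (I : finType) (xi : T -> I) i : rvar xi -> law xi i <= 1.
Proof. by move=> mxi; apply: pr_le1. Qed.

Lemma ent_ge0 (I : finType) (xi : T -> I) : rvar xi -> 0 <= ent xi.
Proof.
move=> mxi; rewrite /ent -sumrN sumr_ge0 // => i _.
by rewrite -mulrN mulr_ge0 ?law_ge0 // oppr_ge0 ln_le0 // law_le1.
Qed.

(** The inequality [ln x <= x - 1] at [x = q / p]. Summed over two distributions it is Gibbs'
    inequality; the last hypothesis is absolute continuity. *)
Lemma mul_ln_le (p q : R) : 0 <= p -> 0 <= q -> (0 < p -> 0 < q) ->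
  p * ln q - p * ln p <= q - p.
Proof.
move=> p0 q0 pq; have [->|pN0] := eqVneq p 0; first by rewrite !mul0r !subr0.
have pp : 0 < p by rewrite lt_neqAle eq_sym pN0.
have qp := pq pp.
rewrite -mulrBr -ln_div ?posrE // -ler_pdivlMl //.
apply: (le_trans (y := q / p - 1)); last first.
  by rewrite mulrBr mulVf // mulrC.
have := @le_ln1Dx R (q / p - 1); rewrite [1 + _]addrC subrK; apply.
by rewrite ltrBrDr addrC subrr divr_gt0.
Qed.

Lemma law_pair_suml (I J : finType) (xi : T -> I) (zeta : T -> J) j :
  rvar xi -> rvar zeta ->
  \sum_i law (fun x => (xi x, zeta x)) (i, j) = law zeta j.
Proof.
move=> mxi mzeta; rewrite -(law_pair_sumr j mzeta mxi); apply: eq_bigr => i _.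
congr pr; apply/seteqP; split => x /=; first by case=> -> ->.
by case=> -> ->.
Qed.

Lemma law_pair_gt0l (I J : finType) (xi : T -> I) (zeta : T -> J) i j :
  rvar xi -> rvar zeta -> 0 < law (fun x => (xi x, zeta x)) (i, j) ->
  0 < law xi i.
Proof.
move=> mxi mzeta /lt_le_trans; apply; rewrite -(law_pair_sumr i mxi mzeta).
by rewrite (bigD1 j) //= lerDl sumr_ge0 // => *; apply: law_ge0.
Qed.

Lemma law_pair_gt0r (I J : finType) (xi : T -> I) (zeta : T -> J) i j :
  rvar xi -> rvar zeta -> 0 < law (fun x => (xi x, zeta x)) (i, j) ->
  0 < law zeta j.
Proof.
move=> mxi mzeta /lt_le_trans; apply; rewrite -(law_pair_suml j mxi mzeta).
by rewrite (bigD1 i) //= lerDl sumr_ge0 // => *; apply: law_ge0.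
Qed.

(** The conditional entropy of [xi] given [zeta], defined through the chain rule. *)
Definition cent (I J : finType) (xi : T -> I) (zeta : T -> J) : R :=
  ent (fun x => (xi x, zeta x)) - ent zeta.

(* Gibbs' inequality for conditional laws *)
Lemma cent_le_kernel (I J : finType) (xi : T -> I) (zeta : T -> J)
    (k : J -> I -> R) :
  rvar xi -> rvar zeta -> (forall j i, 0 <= k j i) ->
  (forall j, \sum_i k j i <= 1) ->
  (forall i j, 0 < law (fun x => (xi x, zeta x)) (i, j) -> 0 < k j i) ->
  cent xi zeta <=
    - \sum_i \sum_j law (fun x => (xi x, zeta x)) (i, j) * ln (k j i).
Proof.
move=> mxi mzeta k0 k1 kp; rewrite /cent /ent opprK.
rewrite sum_pair.
set p := law (fun x => (xi x, zeta x)).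
have -> : \sum_j law zeta j * ln (law zeta j) =
    \sum_i \sum_j p (i, j) * ln (law zeta j).
  rewrite exchange_big /=; apply: eq_bigr => j _; rewrite -mulr_suml.
  by rewrite law_pair_suml.
suff : \sum_i \sum_j p (i, j) * ln (k j i) + \sum_i \sum_j p (i, j) *
  ln (law zeta j) - \sum_i \sum_j p (i, j) * ln (p (i, j)) <= 0 by lra.
rewrite -big_split -sumrB /=.
apply: (le_trans (y := \sum_i \sum_j (k j i * law zeta j - p (i, j)))).
  apply: ler_sum => i _; rewrite -big_split -sumrB; apply: ler_sum => j _ /=.
  have pge0 : 0 <= p (i, j) by exact: law_ge0.
  have [p0|pN0] := eqVneq (p (i, j)) 0.
    by rewrite p0 !(mul0r, subr0, addr0) mulr_ge0 ?law_ge0.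
  have pp : 0 < p (i, j) by rewrite lt_neqAle eq_sym pN0.
  rewrite -mulrDr -lnM ?posrE ?kp //; last exact: law_pair_gt0r pp.
  apply: mul_ln_le => //; first by rewrite mulr_ge0 ?law_ge0.
  by move=> _; rewrite mulr_gt0 ?kp //; exact: law_pair_gt0r pp.
rewrite exchange_big /=.
under eq_bigr do rewrite sumrB -mulr_suml law_pair_suml //.
rewrite sumrB subr_le0; apply: ler_sum => j _.
by rewrite ler_piMl ?law_ge0.
Qed.

(** When [(i, j)] has positive probability, the event [zeta = j] is contained in [xi = i], so its
    probability is at most [law xi i]. Determination is stated on pairs of points, so that no factor
    map has to be produced. *)
Lemma ent_determined (I J : finType) (xi : T -> I) (zeta : T -> J) :
  rvar xi -> rvar zeta -> (forall x y, zeta x = zeta y -> xi x = xi y) ->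
  ent xi <= ent zeta.
Proof.
move=> mxi mzeta det; rewrite /ent lerN2.
have -> : \sum_i law xi i * ln (law xi i) =
    \sum_i \sum_j law (fun x => (xi x, zeta x)) (i, j) * ln (law xi i).
  by apply: eq_bigr => i _; rewrite -mulr_suml law_pair_sumr.
rewrite exchange_big /=; apply: ler_sum => j _.
rewrite -(law_pair_suml j mxi mzeta) mulr_suml; apply: ler_sum => i _.
have [p0|pN0] := eqVneq (law (fun x => (xi x, zeta x)) (i, j)) 0.
  by rewrite p0 !mul0r.
have pp : 0 < law (fun x => (xi x, zeta x)) (i, j).
  by rewrite lt_neqAle eq_sym pN0 law_ge0.
rewrite ler_pM2l // (law_pair_suml j mxi mzeta).
rewrite ler_ln ?posrE; last 2 first.
- exact: law_pair_gt0r pp.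
- exact: law_pair_gt0l pp.
apply: pr_le => // x /= zx.
have [y [/= xy zy]] : exists y, xi y = i /\ zeta y = j.
  apply: contrapT => H; move: pN0; rewrite /law (_ : _ @^-1` _ = set0).
    by rewrite pr0 eqxx.
  by apply/seteqP; split => y //= -[? ?]; apply: H; exists y.
by rewrite -xy; apply: det; rewrite zx.
Qed.

Lemma ent_equiv (I J : finType) (xi : T -> I) (zeta : T -> J) :
  rvar xi -> rvar zeta -> (forall x y, zeta x = zeta y <-> xi x = xi y) ->
  ent xi = ent zeta.
Proof.
move=> mxi mzeta det; apply/eqP; rewrite eq_le; apply/andP; split;
  by apply: ent_determined => // x y; rewrite det.
Qed.

(** Conditioning on more decreases entropy: the conditional law of [xi] given [eta] is a kernel that
    ignores [zeta], and its cost in Gibbs' inequality is exactly [cent xi eta]. *)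
Lemma cent_submod (I J K : finType) (xi : T -> I) (zeta : T -> J)
    (eta : T -> K) : rvar xi -> rvar zeta -> rvar eta ->
  cent xi (fun x => (zeta x, eta x)) <= cent xi eta.
Proof.
move=> mxi mzeta meta.
have mze := rvar_pair mzeta meta; have mxe := rvar_pair mxi meta.
pose k (jl : J * K) i := law (fun x => (xi x, eta x)) (i, jl.2) / law eta jl.2.
have pe i jl : 0 < law (fun x => (xi x, (zeta x, eta x))) (i, jl) ->
    0 < law (fun x => (xi x, eta x)) (i, jl.2).
  move=> /lt_le_trans; apply; apply: pr_le.
  - exact: (rvar_pair mxi mze).
  - exact: mxe.
  - by move=> x /=; case: jl => j l; case=> -> _ ->.
apply: (le_trans (cent_le_kernel mxi mze (k := k) _ _ _)).
- by move=> [j l] i; rewrite divr_ge0 ?law_ge0.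
- move=> [j l]; rewrite /k /= -mulr_suml law_pair_suml //.
  have [->|e0] := eqVneq (law eta l) 0; first by rewrite mul0r ler01.
  by rewrite mulfV.
- move=> i jl /pe H; rewrite /k divr_gt0 //.
  exact: law_pair_gt0r H.
rewrite le_eqVlt; apply/orP; left; apply/eqP.
rewrite /cent /ent opprK.
have -> : \sum_i \sum_j law (fun x => (xi x, (zeta x, eta x))) (i, j) * ln (k j i)
  = \sum_i \sum_j law (fun x => (xi x, (zeta x, eta x))) (i, j)
       * ln (law (fun x => (xi x, eta x)) (i, j.2))
   - \sum_i \sum_j law (fun x => (xi x, (zeta x, eta x))) (i, j)
       * ln (law eta j.2).
  rewrite -sumrB; apply: eq_bigr => i _; rewrite -sumrB; apply: eq_bigr => j _.
  rewrite -mulrBr.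
  have [->|pN0] := eqVneq (law (fun x => (xi x, (zeta x, eta x))) (i, j)) 0.
    by rewrite !mul0r.
  have pp : 0 < law (fun x => (xi x, (zeta x, eta x))) (i, j).
    by rewrite lt_neqAle eq_sym pN0 law_ge0.
  have pxe := pe _ _ pp.
  rewrite ln_div ?posrE //.
  exact: law_pair_gt0r pxe.
rewrite opprB addrC; congr (_ + _).
- congr (- _); rewrite sum_pair.
  apply: eq_bigr => i _.
  rewrite sum_pair exchange_big /=.
  apply: eq_bigr => l _; rewrite -mulr_suml; congr (_ * _).
  rewrite -(law_pair_suml (i, l) mzeta mxe); apply: eq_bigr => j _.
  by congr pr; apply/seteqP; split => x /= -[-> -> ->].
- rewrite exchange_big sum_pair exchange_big /=; apply: eq_bigr => l _.
  under eq_bigr do rewrite -mulr_suml law_pair_suml //.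
  by rewrite -mulr_suml law_pair_suml.
Qed.

(** Gibbs' inequality with the constant kernel [law xi]. *)
Lemma cent_le_ent (I J : finType) (xi : T -> I) (zeta : T -> J) :
  rvar xi -> rvar zeta -> cent xi zeta <= ent xi.
Proof.
move=> mxi mzeta.
apply: (le_trans (cent_le_kernel mxi mzeta (k := fun _ => law xi) _ _ _)).
- by move=> *; apply: law_ge0.
- by move=> _; rewrite law_sum1.
- by move=> i j /law_pair_gt0l; apply.
rewrite lerN2; apply: ler_sum => i _.
by rewrite -mulr_suml law_pair_sumr.
Qed.

Lemma cent_equivl (I J K : finType) (xi : T -> I) (xi' : T -> K)
    (zeta : T -> J) : rvar xi -> rvar xi' -> rvar zeta ->
  (forall x y, xi x = xi y <-> xi' x = xi' y) -> cent xi zeta = cent xi' zeta.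
Proof.
move=> mxi mxi' mzeta e; rewrite /cent; congr (_ - _); apply: ent_equiv.
- exact: rvar_pair.
- exact: rvar_pair.
- by move=> x y; split=> -[/e -> ->].
Qed.

Lemma cent_determinedr (I J K : finType) (xi : T -> I) (zeta : T -> J)
    (eta : T -> K) : rvar xi -> rvar zeta -> rvar eta ->
  (forall x y, zeta x = zeta y -> eta x = eta y) ->
  cent xi zeta <= cent xi eta.
Proof.
move=> mxi mzeta meta det; apply: (le_trans _ (cent_submod mxi mzeta meta)).
rewrite /cent; apply: lerB; apply: ent_determined;
  do ?[exact: rvar_pair | apply: rvar_pair => //].
- by move=> x y [-> -> _].
- exact: mzeta.
- by move=> x y zxy; rewrite (det _ _ zxy) zxy.
Qed.

Lemma cent_chain (I J K : finType) (xi : T -> I) (zeta : T -> J)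
    (eta : T -> K) : rvar xi -> rvar zeta -> rvar eta ->
  cent (fun x => (xi x, zeta x)) eta =
  cent xi (fun x => (zeta x, eta x)) + cent zeta eta.
Proof.
move=> mxi mzeta meta; rewrite /cent addrA subrK; congr (_ - _).
apply: ent_equiv.
- exact: (rvar_pair (rvar_pair mxi mzeta) meta).
- exact: (rvar_pair mxi (rvar_pair mzeta meta)).
by move=> x y; split=> -[-> -> ->].
Qed.

(* If the values in [W] are equally likely given the value of [zeta], each of
   them has conditional probability at most [1 / #|W|]. *)
Lemma cent_ge_uniform (I J : finType) (xi : T -> I) (zeta : T -> J)
    (W : {set I}) : rvar xi -> rvar zeta ->
  (forall w w' j, w \in W -> w' \in W ->
    law (fun x => (xi x, zeta x)) (w, j) = law (fun x => (xi x, zeta x)) (w', j)) ->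
  (\sum_(w in W) law xi w) * ln (#|W|%:R) <= cent xi zeta.
Proof.
move=> mxi mzeta unif; set p := law (fun x => (xi x, zeta x)).
have -> : cent xi zeta = \sum_i \sum_j (p (i, j) * (ln (law zeta j) - ln (p (i, j)))).
  rewrite /cent /ent opprK addrC sum_pair -/p.
  have -> : \sum_j law zeta j * ln (law zeta j) =
      \sum_i \sum_j p (i, j) * ln (law zeta j).
    rewrite exchange_big /=; apply: eq_bigr => j _; rewrite -mulr_suml.
    by rewrite law_pair_suml.
  rewrite -sumrB; apply: eq_bigr => i _; rewrite -sumrB.
  by apply: eq_bigr => j _; rewrite mulrBr.
have term0 i j : 0 <= p (i, j) * (ln (law zeta j) - ln (p (i, j))).
  have [->|pN0] := eqVneq (p (i, j)) 0; first by rewrite mul0r.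
  have pp : 0 < p (i, j) by rewrite lt_neqAle eq_sym pN0 law_ge0.
  rewrite mulr_ge0 ?law_ge0 // subr_ge0 ler_ln ?posrE //.
    rewrite -(law_pair_suml j mxi mzeta) (bigD1 i) //= lerDl sumr_ge0 // => *.
    exact: law_ge0.
  exact: law_pair_gt0r pp.
rewrite [leRHS](bigID [pred i | i \in W]) /=.
apply: ler_wpDr; first by apply: sumr_ge0 => i _; apply: sumr_ge0.
rewrite mulr_suml; apply: ler_sum => w wW.
rewrite -(law_pair_sumr w mxi mzeta) -/p mulr_suml; apply: ler_sum => j _.
have [->|pN0] := eqVneq (p (w, j)) 0; first by rewrite !mul0r.
have pp : 0 < p (w, j) by rewrite lt_neqAle eq_sym pN0 law_ge0.
have W0 : (0 < #|W|)%N by apply/card_gt0P; exists w.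
rewrite ler_wpM2l ?law_ge0 // lerBrDr -lnM ?posrE ?ltr0n //.
rewrite ler_ln ?posrE; first last.
- exact: law_pair_gt0r pp.
- by rewrite mulr_gt0 ?ltr0n.
rewrite -(law_pair_suml j mxi mzeta) [leRHS](bigID [pred i | i \in W]) /=.
apply: ler_wpDr; first by apply: sumr_ge0 => i _; apply: law_ge0.
rewrite (eq_bigr (fun=> p (w, j))) => [|w' w'W]; last exact: unif.
by rewrite sumr_const mulr_natl.
Qed.

(** * Itineraries under a measure-preserving map *)

Section Invariant.
Variable S : T -> T.
Hypothesis mS : measurable_fun setT S.
Hypothesis PS : forall A, measurable A -> P (S @^-1` A) = P A.

Lemma rvar_iter (I : finType) (xi : T -> I) n :
  rvar xi -> rvar (fun x => xi (iter n S x)).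
Proof.
move=> mxi; elim: n => // n IH i.
rewrite (_ : _ @^-1` _ = S @^-1` ((fun x => xi (iter n S x)) @^-1` [set i])).
  by rewrite -[X in measurable X]setTI; apply: mS => //; apply: IH.
by apply/seteqP; split => x /=; rewrite -iterSr iterS.
Qed.

Lemma law_iter (I : finType) (xi : T -> I) n : rvar xi ->
  law (fun x => xi (iter n S x)) = law xi.
Proof.
move=> mxi; apply/funext => i; elim: n => // n IH.
rewrite -IH /law /pr -(PS (rvar_iter n mxi i)); congr (fine (P _)).
by apply/seteqP; split => x /=; rewrite -iterSr iterS.
Qed.

Lemma ent_iter (I : finType) (xi : T -> I) n : rvar xi ->
  ent (fun x => xi (iter n S x)) = ent xi.
Proof. by move=> mxi; rewrite /ent law_iter. Qed.

Lemma cent_iter (I J : finType) (xi : T -> I) (zeta : T -> J) n :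
  rvar xi -> rvar zeta ->
  cent (fun x => xi (iter n S x)) (fun x => zeta (iter n S x)) = cent xi zeta.
Proof.
move=> mxi mzeta; rewrite /cent (ent_iter n mzeta).
by rewrite -(ent_iter n (rvar_pair mxi mzeta)).
Qed.

(** The level sets of [name xi n] are the members of the refinement of the partition defined by
    [xi], so that [rate] is the sequence whose limit enters the entropy. *)
Definition name (I : finType) (xi : T -> I) n (x : T) : {ffun 'I_n -> I} :=
  [ffun i : 'I_n => xi (iter i S x)].

Lemma nameP (I : finType) (xi : T -> I) n x y :
  name xi n x = name xi n y <->
  forall i, (i < n)%N -> xi (iter i S x) = xi (iter i S y).
Proof.
split=> [e i ilt | e]; last by apply/ffunP => i; rewrite !ffunE; apply: e.
by move/ffunP/(_ (Ordinal ilt)) : e; rewrite !ffunE.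
Qed.

Lemma rvar_name (I : finType) (xi : T -> I) n : rvar xi -> rvar (name xi n).
Proof.
move=> mxi w.
rewrite (_ : _ @^-1` _ = \bigcap_(i in [set: 'I_n])
    ((fun x => xi (iter i S x)) @^-1` [set w i])).
  apply: fin_bigcap_measurable => [|i _]; last exact: rvar_iter.
  exact: finite_finset.
apply/seteqP; split => x /=; first by move=> <- i _ /=; rewrite ffunE.
by move=> H; apply/ffunP => i; rewrite ffunE; apply: H.
Qed.

Arguments rvar_name {I xi} n.

(** The word of length [n + m] is read off from the word of length [n] at [x] and the word of length
    [m] at [iter n S x], whose entropy is that of the word at [x] by invariance. *)
Lemma ent_nameD (I : finType) (xi : T -> I) n m : rvar xi ->
  ent (name xi (n + m)) <= ent (name xi n) + ent (name xi m).
Proof.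
move=> mxi; have mn := rvar_name n mxi; have mm := rvar_name m mxi.
have mmn := rvar_iter n mm.
apply: (le_trans (y := ent (fun x => (name xi m (iter n S x), name xi n x)))).
  apply: ent_determined; [exact: rvar_name | exact: rvar_pair |].
  move=> x y [/nameP em /nameP en]; apply/nameP => i ilt.
  have [/en //|ni] := ltnP i n.
  have := em (i - n)%N; rewrite -!iterD subnK //; apply.
  by rewrite ltn_subLR.
have := cent_le_ent mmn mn; rewrite ent_iter // /cent; lra.
Qed.

(** By the chain rule, each new symbol of [xi] is conditioned on at least the simultaneous symbol of
    [zeta]. This will compare an arbitrary partition with a partition into levels. *)
Lemma cent_name (I J : finType) (xi : T -> I) (zeta : T -> J) n :
  rvar xi -> rvar zeta ->
  cent (name xi n) (name zeta n) <= n%:R * cent xi zeta.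
Proof.
move=> mxi mzeta; elim: n => [|n IH].
  rewrite mul0r /cent subr_le0; apply: ent_determined.
  - by apply: rvar_pair; apply: rvar_name.
  - exact: rvar_name.
  - by move=> x y e; congr (_, _) => //; apply/nameP.
rewrite (@cent_equivl _ _ _ _ (fun x => (xi (iter n S x), name xi n x))); first last.
- move=> x y; split=> [/nameP e | [en /nameP e]].
    congr (_, _); first exact: e.
    by apply/nameP => i ilt; apply: e; apply: ltnW.
  apply/nameP => i; rewrite ltnS leq_eqVlt => /orP[/eqP -> //|]; exact: e.
- exact: rvar_name.
- by apply: rvar_pair; [apply: rvar_iter | apply: rvar_name].
- exact: rvar_name.
rewrite cent_chain; [|exact: rvar_iter|exact: rvar_name|exact: rvar_name].
rewrite -natr1 mulrDl mul1r addrC; apply: lerD.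
  apply: le_trans IH; apply: cent_determinedr; try exact: rvar_name.
  by move=> x y /nameP e; apply/nameP => i ilt; apply: e; apply: ltnW.
rewrite -(cent_iter n mxi mzeta); apply: cent_determinedr.
- exact: rvar_iter.
- by apply: rvar_pair; apply: rvar_name.
- exact: rvar_iter.
- by move=> x y [_ /nameP]; apply.
Qed.

Lemma ent_nameS (I : finType) (xi : T -> I) n : rvar xi ->
  ent (name xi n.+1) =
  cent (fun x => xi (iter n S x)) (name xi n) + ent (name xi n).
Proof.
move=> mxi; rewrite /cent subrK; apply: ent_equiv.
- exact: rvar_name.
- by apply: rvar_pair; [apply: rvar_iter | apply: rvar_name].
move=> x y; split=> [[en /nameP e] | /nameP e].
  apply/nameP => i; rewrite ltnS leq_eqVlt => /orP[/eqP -> //|]; exact: e.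
congr (_, _); first exact: e.
by apply/nameP => i ilt; apply: e; apply: ltnW.
Qed.

(** Each new symbol is conditioned on the whole past; keeping only the previous symbol can only
    increase the entropy. *)
Lemma ent_name_le (I : finType) (xi : T -> I) n : rvar xi ->
  ent (name xi n.+1) <= ent (name xi 1) + n%:R * cent (xi \o S) xi.
Proof.
move=> mxi; elim: n => [|n IH]; first by rewrite mul0r addr0.
rewrite ent_nameS // -natr1 mulrDl mul1r addrA addrC; apply: lerD => //.
rewrite -[leRHS](cent_iter n) //; last exact: (rvar_iter 1).
apply: cent_determinedr.
- exact: rvar_iter.
- exact: rvar_name.
- exact: rvar_iter.
- by move=> x y /nameP; apply.
Qed.

Definition rate (I : finType) (xi : T -> I) (n : nat) : R :=
  ent (name xi n) / n%:R.

End Invariant.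
End FiniteEntropy.

(** * Fekete's lemma on subadditive sequences *)

Section Fekete.
Local Open Scope classical_set_scope.
Local Open Scope ring_scope.
Context {R : realType}.
Variable u : nat -> R.
Hypothesis u0 : forall n, 0 <= u n.
Hypothesis uD : forall n m, u (n + m)%N <= u n + u m.

(** The index is shifted because [u 0 / 0] would be the value [0]. *)
Let L : R := inf [set u n.+1 / n.+1%:R | n in setT].

Let L_le n : L <= u n.+1 / n.+1%:R.
Proof.
apply: ge_inf; last by exists n.
by exists 0 => _ [k _ <-]; rewrite divr_ge0.
Qed.

Lemma subadditive_lin N q r : u (q * N + r)%N <= q%:R * u N + u r.
Proof.
elim: q => [|q IH]; first by rewrite mul0n mul0r add0n add0r.
rewrite mulSn -addnA; apply: (le_trans (uD _ _)).
by rewrite -natr1 mulrDl mul1r addrAC addrC lerD2l.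
Qed.

Lemma fekete_cvg : (fun n => u n / n%:R) @ \oo --> L.
Proof.
have infs : has_inf [set u n.+1 / n.+1%:R | n in setT].
  split; first by exists (u 1%N / 1); exists 0%N.
  by exists 0 => _ [k _ <-]; rewrite divr_ge0.
apply/cvgrPdist_le => e e0.
have [_ [N _ <-] NL] := inf_adherent (divr_gt0 e0 (ltr0n R 2)) infs.
(* [C] bounds [u] at every remainder modulo [N.+1]. *)
pose C := \sum_(r < N.+1) u r.
have C0 : 0 <= C by apply: sumr_ge0.
near=> n.
have n0 : 0 < n%:R :> R.
  by rewrite ltr0n; near: n; exists 1%N.
have Ln : L <= u n / n%:R.
  by rewrite -(prednK (n := n)) ?L_le // -(ltr0n R).
rewrite ler0_norm ?subr_le0 // opprB lerBlDl ler_pdivrMr //.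
rewrite {1}(divn_eq n N.+1); apply: (le_trans (subadditive_lin _ _ _)).
have -> : (L + e) * n%:R = (L + e / 2) * n%:R + e / 2 * n%:R.
  by rewrite -mulrDl -addrA -splitr.
apply: lerD.
  apply: (le_trans (y := u N.+1 / N.+1%:R * n%:R)); last first.
    by rewrite ler_wpM2r // ltW.
  rewrite mulrC -mulrA ler_wpM2l // mulrC ler_pdivlMr ?ltr0n //.
  by rewrite -natrM ler_nat leq_divM.
apply: (le_trans (y := C)).
  have rlt : (n %% N.+1 < N.+1)%N by rewrite ltn_mod.
  by rewrite /C (bigD1 (Ordinal rlt)) //= lerDl sumr_ge0.
rewrite mulrC -ler_pdivrMr ?divr_gt0 //.
by near: n; apply: nbhs_infty_ger.
Unshelve. all: by end_near.
Qed.

End Fekete.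

(** * Cutting and stacking *)

Section CuttingStacking.
Variables N m : nat -> nat.
Hypothesis N0 : forall j, 0 < N j.
Hypothesis m0 : forall j, 0 < m j.
Hypothesis NS : forall j, N j.+1 = N j * N j * m j.

Fixpoint ht (j : nat) : nat := if j is j'.+1 then (ht j').*2.+2 else 1.
(** At stage [j] the interval is divided into [ncell j] equal cells: the first [nlev j] are the
    levels of the columns, the last [2 * N j] are a reserve. Each cell is divided into [cuts j]
    cells of the next stage, because a column is used [N j * m j] times as a lower block and as many
    times as an upper one. Half of the reserve then becomes spacers. *)
Definition nlev j := N j * ht j.
Definition ncell j := N j * (ht j + 2).
Definition cuts j := 2 * (N j * m j).

(** A column of stage [j.+1] is coded by its lower block, its upper block and a label [l < m j] that
    separates the copies of a pair. *)
Definition enc j u1 u2 l := (u1 * N j + u2) * m j + l.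
Definition dec1 j u := u %/ m j %/ N j.
Definition dec2 j u := (u %/ m j) %% N j.
Definition dec3 j u := u %% m j.

Lemma enc_dec j u : enc j (dec1 j u) (dec2 j u) (dec3 j u) = u.
Proof. by rewrite /enc -divn_eq -divn_eq. Qed.

Lemma dec1_enc j u1 u2 l : u2 < N j -> l < m j -> dec1 j (enc j u1 u2 l) = u1.
Proof.
by move=> ? ?; rewrite /dec1 /enc divnMDl // (divn_small (d := m j)) // addn0
  divnMDl // (divn_small (d := N j)) // addn0.
Qed.

Lemma dec2_enc j u1 u2 l : u2 < N j -> l < m j -> dec2 j (enc j u1 u2 l) = u2.
Proof.
by move=> ? ?; rewrite /dec2 /enc divnMDl // (divn_small (d := m j)) // addn0
  modnMDl modn_small.
Qed.

Lemma dec3_enc j u1 u2 l : l < m j -> dec3 j (enc j u1 u2 l) = l.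
Proof. by move=> ?; rewrite /dec3 /enc modnMDl modn_small. Qed.

Lemma dec1_lt j u : u < N j.+1 -> dec1 j u < N j.
Proof. by rewrite NS /dec1 !ltn_divLR // mulnA. Qed.

Lemma dec2_lt j u : dec2 j u < N j.
Proof. by rewrite ltn_mod. Qed.

Lemma dec3_lt j u : dec3 j u < m j.
Proof. by rewrite ltn_mod. Qed.

Lemma ht_gt0 j : 0 < ht j. Proof. by case: j. Qed.

Lemma ht2 j : ht j + 2 = 3 * 2 ^ j.
Proof. by elim: j => //= j IH; rewrite expnS; lia. Qed.

Lemma cuts_gt0 j : 0 < cuts j.
Proof. by rewrite /cuts !muln_gt0 N0 m0. Qed.

Lemma ncell_gt0 j : 0 < ncell j.
Proof. by rewrite /ncell muln_gt0 N0 addn2. Qed.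

Lemma ncellS j : ncell j.+1 = ncell j * cuts j.
Proof. by rewrite /ncell /cuts NS /=; nia. Qed.

Lemma nlevS j : nlev j.+1 = nlev j * cuts j + 2 * N j.+1.
Proof. by rewrite /nlev /cuts NS /=; nia. Qed.

Lemma nlev_ncell j : nlev j + 2 * N j = ncell j.
Proof. by rewrite /nlev /ncell; nia. Qed.

(* A column [u] of stage [j.+1] is a spacer, column [dec1 u] of stage [j],
   column [dec2 u] of stage [j] and a spacer, from bottom to top. *)
Fixpoint cell (j u t : nat) : nat :=
  if j is j'.+1 then
    if t == 0 then nlev j' * cuts j' + u
    else if t <= ht j' then
      cell j' (dec1 j' u) t.-1 * cuts j' + (dec2 j' u * m j' + dec3 j' u)
    else if t <= (ht j').*2 then
      cell j' (dec2 j' u) (t.-1 - ht j') * cuts j'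
        + (N j' * m j' + (dec1 j' u * m j' + dec3 j' u))
    else nlev j' * cuts j' + N j + u
  else u.

(** The inverse of [cell]. Among the [cuts j'] pieces of a level, the first [N j' * m j'] go to
    lower blocks, and their index codes the upper block and the label; the others go to upper
    blocks, and their index codes the lower block and the label. *)
Fixpoint adr (j b : nat) : nat * nat :=
  if j is j'.+1 then
    if b < nlev j' * cuts j' then
      let: (u, t) := adr j' (b %/ cuts j') in
      let s := b %% cuts j' in
      if s < N j' * m j' then (enc j' u (s %/ m j') (s %% m j'), t.+1)
      else let s' := s - N j' * m j' in
        (enc j' (s' %/ m j') u (s' %% m j'), t.+1 + ht j')
    else let b' := b - nlev j' * cuts j' in
      if b' < N j then (b', 0) else (b' - N j, (ht j').*2.+1)
  else (b, 0).

Lemma lab_lt j u2 l : u2 < N j -> l < m j -> u2 * m j + l < N j * m j.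
Proof. by move=> ? ?; nia. Qed.

Lemma cell_lt j u t : u < N j -> t < ht j -> cell j u t < nlev j.
Proof.
elim: j u t => [|j IH] u t uN tL; first by rewrite /nlev /= muln1.
rewrite nlevS /=; have u1 := dec1_lt uN; have u2 := dec2_lt j u.
have u3 := dec3_lt j u; move: tL; rewrite /= => tL.
case: eqP => [_|/eqP t0]; first by lia.
have l1 := lab_lt u1 u3; have l2 := lab_lt u2 u3.
have [tle|tgt] := leqP t (ht j).
  have : cell j (dec1 j u) t.-1 < nlev j by apply: IH => //; lia.
  by move=> H; rewrite ltn_addr // /cuts; nia.
have [tle|tgt'] := leqP t (ht j).*2; last by lia.
have : cell j (dec2 j u) (t.-1 - ht j) < nlev j by apply: IH => //; lia.
by move=> H; rewrite ltn_addr // /cuts; nia.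
Qed.

Lemma adr_child j b s : b < nlev j -> s < cuts j ->
  adr j.+1 (b * cuts j + s) = let: (u, t) := adr j b in
    if s < N j * m j then (enc j u (s %/ m j) (s %% m j), t.+1)
    else let s' := s - N j * m j in
        (enc j (s' %/ m j) u (s' %% m j), t.+1 + ht j).
Proof.
move=> bK sr /=; rewrite ifT; last by nia.
by rewrite divnMDl ?cuts_gt0 // (divn_small sr) addn0 modnMDl (modn_small sr).
Qed.

Lemma cellK j u t : u < N j -> t < ht j -> adr j (cell j u t) = (u, t).
Proof.
elim: j u t => [|j IH] u t uN tL; first by case: t tL.
have u1 := dec1_lt uN; have u2 := dec2_lt j u.
have u3 := dec3_lt j u; move: tL => /= tL.
have l1 := lab_lt u1 u3; have l2 := lab_lt u2 u3.
case: eqP => [->|/eqP t0].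
  by rewrite ltnNge leq_addr /= addKn uN.
have [tle|tgt] := leqP t (ht j).
  have H : cell j (dec1 j u) t.-1 < nlev j by apply: cell_lt => //; lia.
  have := @adr_child j _ (dec2 j u * m j + dec3 j u) H; move=> /= -> //.
    rewrite IH // ?l2 //; last by lia.
    rewrite divnMDl // (divn_small u3) addn0 modnMDl (modn_small u3) enc_dec.
    by congr (_, _); lia.
  by rewrite /cuts; nia.
have [tle|tgt'] := leqP t (ht j).*2.
  have H : cell j (dec2 j u) (t.-1 - ht j) < nlev j by apply: cell_lt => //; lia.
  have := @adr_child j _ (N j * m j + (dec1 j u * m j + dec3 j u)) H.
  move=> /= -> //.
    rewrite IH // ?[_ + _ < _]ltnNge ?leq_addr /= ?addKn //; last by lia.
    rewrite divnMDl // (divn_small u3) addn0 modnMDl (modn_small u3) enc_dec.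
    by congr (_, _); lia.
  by rewrite /cuts; nia.
rewrite ltnNge -addnA leq_addr /= addKn ltnNge leq_addr /= addKn.
by congr (_, _); lia.
Qed.

(** [cell] is injective by [cellK], and there are as many levels as pairs [(u, t)]. *)
Lemma cell_onto j b : b < nlev j ->
  exists u t, [/\ u < N j, t < ht j & b = cell j u t].
Proof.
move=> bK.
pose f (p : 'I_(N j) * 'I_(ht j)) : 'I_(nlev j) :=
  Ordinal (cell_lt (ltn_ord p.1) (ltn_ord p.2)).
have fi : injective f.
  move=> [u t] [u' t'] /(congr1 val) /= /(congr1 (adr j)).
  rewrite !cellK ?ltn_ord // => -[/val_inj -> /val_inj ->] //.
have [|g _ gK] := inj_card_bij fi; first by rewrite card_prod !card_ord.
have /(congr1 val) /= bE := gK (Ordinal bK).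
by exists (g (Ordinal bK)).1, (g (Ordinal bK)).2; split; rewrite ?ltn_ord.
Qed.

Lemma adrK j b : b < nlev j ->
  [/\ (adr j b).1 < N j, (adr j b).2 < ht j & cell j (adr j b).1 (adr j b).2 = b].
Proof. by move=> /cell_onto[u [t [uN tL ->]]]; rewrite cellK. Qed.

(** The boolean is a direction: [true] climbs the column, [false] descends. [inner] says that the
    step remains in the column. *)
Definition step (e : bool) (t : nat) := if e then t.+1 else t.-1.
Definition inner (e : bool) j t := if e then t.+1 < ht j else 0 < t.
Definition next (e : bool) (j b : nat) := cell j (adr j b).1 (step e (adr j b).2).

(** The piece number [s] tells which column of stage [j.+1] receives the piece, and it is the same
    all along a column of stage [j]. This makes the translations of successive stages agree. *)
Lemma next_child e j b s : b < nlev j -> s < cuts j -> inner e j (adr j b).2 ->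
  next e j.+1 (b * cuts j + s) = next e j b * cuts j + s.
Proof.
move=> bK sr; rewrite /next adr_child //.
have [uN tL bE] := adrK bK; case: (adr j b) uN tL bE => u t /= uN tL bE ti.
have [sl|sg] := ltnP s (N j * m j).
  have s1 : s %/ m j < N j by rewrite ltn_divLR.
  have s2 : s %% m j < m j by rewrite ltn_mod.
  rewrite /= dec1_enc // dec2_enc // dec3_enc // -divn_eq.
  rewrite ifF; last by case: e ti => /=; lia.
  rewrite ifT; last by case: e ti => /=; lia.
  by congr (cell _ _ _ * _ + _); case: e ti => /=; lia.
set s' := s - _.
have s'lt : s' < N j * m j by move: sr; rewrite /cuts /s'; lia.
have s1 : s' %/ m j < N j by rewrite ltn_divLR.
have s2 : s' %% m j < m j by rewrite ltn_mod.
rewrite /= dec1_enc // dec2_enc // dec3_enc // -divn_eq.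
rewrite ifF; last by case: e ti => /=; lia.
rewrite ifF; last by case: e ti => /=; lia.
rewrite ifT; last by case: e ti => /=; lia.
rewrite /s' subnKC //.
by congr (cell _ _ _ * _ + _); case: e ti => /=; lia.
Qed.

(** This is what the spacers are for: they occupy both ends of the columns of stage [j.+1], so that
    pieces of older levels have neighbours in both directions. *)
Lemma inner_child e j b : b < nlev j * cuts j -> inner e j.+1 (adr j.+1 b).2.
Proof.
move=> bK; have [q0 s0] : b %/ cuts j < nlev j /\ b %% cuts j < cuts j.
  by rewrite ltn_divLR ?cuts_gt0 // ltn_mod cuts_gt0.
rewrite {1}(divn_eq b (cuts j)) adr_child //.
have [_ tL _] := adrK q0; case: (adr j _) tL => u t /= tL.
by case: ifP => _; case: e => /=; lia.
Qed.

Lemma adr_next e j b : b < nlev j -> inner e j (adr j b).2 ->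
  adr j (next e j b) = ((adr j b).1, step e (adr j b).2).
Proof.
move=> bK ti; have [uN tL _] := adrK bK.
by rewrite /next cellK //; case: e ti => /=; lia.
Qed.

Lemma next_lt e j b : b < nlev j -> inner e j (adr j b).2 -> next e j b < nlev j.
Proof.
move=> bK ti; have [uN tL _] := adrK bK.
by rewrite /next cell_lt //; case: e ti => /=; lia.
Qed.

Lemma nextK e j b : b < nlev j -> inner e j (adr j b).2 ->
  next (~~ e) j (next e j b) = b.
Proof.
move=> bK ti; rewrite {1}/next adr_next //=.
have [uN tL {3}<-] := adrK bK.
by congr cell; case: e ti => /=; lia.
Qed.

Lemma sum_mul a b (F : nat -> nat) :
  \sum_(i < a * b) F i = \sum_(i < a) \sum_(k < b) F (i * b + k).
Proof.
elim: a => [|a IH]; first by rewrite !big_ord0.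
rewrite big_ord_recr /= -IH -!(big_mkord xpredT) mulSnr.
rewrite (@big_cat_nat _ _ _ (a * b)) ?leq_addr //=; congr (_ + _).
rewrite -{1}[a * b]addn0 [a * b + b]addnC [a * b + 0]addnC big_addn addnK.
by rewrite big_mkord; apply: eq_bigr => i _; rewrite addnC.
Qed.

(* The stage [k] cell containing the level [t] of the column [u] of stage
   [i + k], all cells that are not levels being replaced by [nlev k]. *)
Fixpoint code (k i u t : nat) : nat :=
  if i is i'.+1 then
    if t == 0 then nlev k
    else if t <= ht (i' + k) then code k i' (dec1 (i' + k) u) t.-1
    else if t <= (ht (i' + k)).*2 then
      code k i' (dec2 (i' + k) u) (t.-1 - ht (i' + k))
    else nlev k
  else cell k u t.

Lemma code_desc k i b : b < nlev (i + k) -> forall s, s < cuts (i + k) ->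
  code k i.+1 (adr (i + k).+1 (b * cuts (i + k) + s)).1
    (adr (i + k).+1 (b * cuts (i + k) + s)).2 =
  code k i (adr (i + k) b).1 (adr (i + k) b).2.
Proof.
move=> bK s sr; rewrite adr_child //; set j := i + k.
have [uN tL _] := adrK bK; rewrite -/j in uN tL *.
case: (adr j b) uN tL => u t /= uN tL.
have [sl|sg] := ltnP s (N j * m j).
  have s1 : s %/ m j < N j by rewrite ltn_divLR.
  have s2 : s %% m j < m j by rewrite ltn_mod.
  by rewrite /= -/j dec1_enc // tL.
set s' := s - _.
have s'lt : s' < N j * m j by move: sr; rewrite /cuts /s' /j; lia.
have s1 : s' %/ m j < N j by rewrite ltn_divLR.
have s2 : s' %% m j < m j by rewrite ltn_mod.
rewrite /= -/j dec2_enc // ifF; last by lia.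
by rewrite ifT ?addnK //; lia.
Qed.

Lemma codeS0 k i u : code k i.+1 u 0 = nlev k.
Proof. by []. Qed.

Lemma codeS1 k i u s : s < ht (i + k) ->
  code k i.+1 u s.+1 = code k i (dec1 (i + k) u) s.
Proof. by move=> /= ->. Qed.

Lemma codeS2 k i u s : s < ht (i + k) ->
  code k i.+1 u (s.+1 + ht (i + k)) = code k i (dec2 (i + k) u) s.
Proof.
move=> sL; rewrite /= addSn /= ifF; last by lia.
by rewrite ifT ?addnK //; lia.
Qed.

Lemma codeS3 k i u : code k i.+1 u (ht (i + k)).*2.+1 = nlev k.
Proof. by rewrite /= ifF ?ifF //; lia. Qed.

Lemma code_spacer k i b : nlev (i + k) * cuts (i + k) <= b ->
  code k i.+1 (adr (i + k).+1 b).1 (adr (i + k).+1 b).2 = nlev k.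
Proof.
move=> b1; have -> : adr (i + k).+1 b =
    if b - nlev (i + k) * cuts (i + k) < N (i + k).+1
    then (b - nlev (i + k) * cuts (i + k), 0)
    else (b - nlev (i + k) * cuts (i + k) - N (i + k).+1, (ht (i + k)).*2.+1).
  by rewrite /= ltnNge b1.
by case: ifP => _; [exact: codeS0 | exact: codeS3].
Qed.

Lemma sum_columns j (F : nat -> nat) : \sum_(u < N j.+1) F u =
  \sum_(u1 < N j) \sum_(u2 < N j) \sum_(l < m j) F (enc j u1 u2 l).
Proof.
rewrite NS sum_mul (sum_mul _ _ (fun v => \sum_(l < m j) F (v * m j + l))).
by [].
Qed.

(** By induction on [i]. If the level [t] is in the lower block, that block is summed over and the
    upper one is a parameter. If it is in the upper block, the whole lower block belongs to the past
    and is absorbed in the test, while the upper block, chosen independently, is summed over. This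
    is why [Q] is an arbitrary test. *)
Lemma code_uniform k i t (Q : seq nat -> bool) w w' :
  t < ht (i + k) -> w < N k -> w' < N k ->
  \sum_(u < N (i + k)) (Q [seq code k i u s | s <- iota 0 t]
      && (code k i u t == cell k w 0)) =
  \sum_(u < N (i + k)) (Q [seq code k i u s | s <- iota 0 t]
      && (code k i u t == cell k w' 0)).
Proof.
move=> tL wN w'N; elim: i t Q tL => [|i IH] t Q tL.
  (* At stage [k] itself a bottom is met only at [t = 0], after an empty past, and by a single
     column. *)
  have H v : v < N k -> \sum_(u < N k) (Q [seq cell k u s | s <- iota 0 t]
      && (cell k u t == cell k v 0)) = (Q [::] && (t == 0)).
    move=> vN; rewrite (bigD1 (Ordinal vN)) //= big1 ?addn0 => [|u uv].
      have [->|t0] := eqVneq t 0; first by rewrite eqxx.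
      rewrite [X in _ && X](_ : _ = false) ?andbF //.
      apply/eqP => /(congr1 (adr k)); rewrite !cellK ?ht_gt0 // => -[t00].
      by rewrite t00 in t0.
    rewrite [X in _ && X](_ : _ = false) ?andbF //.
    apply/eqP => /(congr1 (adr k)); rewrite !cellK ?ht_gt0 // => -[uv' _].
    by move/eqP: uv; apply; apply: val_inj.
  by rewrite !H.
have nc v : v < N k -> (nlev k == cell k v 0) = false.
  by move=> vN; apply/eqP => e; have := cell_lt vN (ht_gt0 k); rewrite -e ltnn.
have dec1E u1 u2 l : u2 < N (i + k) -> l < m (i + k) ->
    dec1 (i + k) (enc (i + k) u1 u2 l) = u1 by exact: dec1_enc.
case: t tL => [_|t tL].
  by rewrite !big1 // => u _; rewrite codeS0 nc // andbF.
have [tle|tgt] := ltnP t (ht (i + k)).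
  have E v : \sum_(u < N (i.+1 + k))
      (Q [seq code k i.+1 u s | s <- iota 0 t.+1]
      && (code k i.+1 u t.+1 == cell k v 0)) =
    \sum_(u2 < N (i + k)) \sum_(l < m (i + k)) \sum_(u1 < N (i + k))
      (Q (nlev k :: [seq code k i u1 s | s <- iota 0 t])
      && (code k i u1 t == cell k v 0)).
    rewrite (sum_columns (i + k) (fun u =>
      (Q [seq code k i.+1 u s | s <- iota 0 t.+1]
      && (code k i.+1 u t.+1 == cell k v 0)))).
    rewrite exchange_big; apply: eq_bigr => u2 _; rewrite exchange_big.
    apply: eq_bigr => l _; apply: eq_bigr => u1 _.
    rewrite codeS1 // dec1_enc //; congr (nat_of_bool (Q _ && _)).
    rewrite [iota 0 t.+1]/= map_cons codeS0 (iotaDl 1) -map_comp.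
    congr (_ :: _); apply/eq_in_map => s; rewrite mem_iota => /andP[_ st].
    by rewrite /comp add1n codeS1 ?dec1_enc //; lia.
  rewrite !E; apply: eq_bigr => u2 _; apply: eq_bigr => l _.
  exact: (IH _ (fun p => Q (nlev k :: p))).
have [->|t1] := eqVneq t (ht (i + k)).*2.
  by rewrite !big1 // => u _; rewrite codeS3 nc // andbF.
have t2 : t - ht (i + k) < ht (i + k).
  by move: tL; rewrite addSn /=; lia.
have -> : t = (t - ht (i + k)) + ht (i + k) by rewrite subnK.
move: (t - _) t2 => {tL tgt t1} {}t tL.
have E v : \sum_(u < N (i.+1 + k))
    (Q [seq code k i.+1 u s | s <- iota 0 (t + ht (i + k)).+1]
    && (code k i.+1 u (t + ht (i + k)).+1 == cell k v 0)) =
  \sum_(u1 < N (i + k)) \sum_(l < m (i + k)) \sum_(u2 < N (i + k))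
    (Q (nlev k :: [seq code k i u1 s | s <- iota 0 (ht (i + k))]
        ++ [seq code k i u2 s | s <- iota 0 t])
    && (code k i u2 t == cell k v 0)).
  rewrite (sum_columns (i + k) (fun u =>
    (Q [seq code k i.+1 u s | s <- iota 0 (t + ht (i + k)).+1]
    && (code k i.+1 u (t + ht (i + k)).+1 == cell k v 0)))).
  apply: eq_bigr => u1 _; rewrite exchange_big.
  apply: eq_bigr => l _; apply: eq_bigr => u2 _.
  rewrite -addSn codeS2 // dec2_enc //; congr (nat_of_bool (Q _ && _)).
  rewrite addSn [iota 0 _.+1]/= map_cons codeS0 [t + _]addnC iotaD map_cat.
  congr (_ :: _ ++ _).
    rewrite (iotaDl 1) -map_comp; apply/eq_in_map => s.
    rewrite mem_iota => /andP[_ st]; rewrite /comp add1n codeS1 ?dec1_enc //.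
  rewrite [1 + _]addnC -[_ + 1]addn0 (iotaDl (_ + 1)) -map_comp; apply/eq_in_map => s.
  rewrite mem_iota => /andP[_ st].
  rewrite /comp [_ + 1 + s](_ : _ = s.+1 + ht (i + k)); last by lia.
  by rewrite codeS2 ?dec2_enc //; lia.
rewrite !E; apply: eq_bigr => u1 _; apply: eq_bigr => l _.
exact: (IH _ (fun p => Q (nlev k :: _ ++ p))).
Qed.

Lemma sum_levels j (F : nat -> nat -> nat) :
  \sum_(b < nlev j) F (adr j b).1 (adr j b).2 =
  \sum_(u < N j) \sum_(t < ht j) F u t.
Proof.
pose f (p : 'I_(N j) * 'I_(ht j)) : 'I_(nlev j) :=
  Ordinal (cell_lt (ltn_ord p.1) (ltn_ord p.2)).
have fi : injective f.
  move=> [u t] [u' t'] /(congr1 val) /= /(congr1 (adr j)).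
  by rewrite !cellK ?ltn_ord // => -[/val_inj -> /val_inj ->].
rewrite (reindex f) /=; last first.
  by apply: onW_bij; apply: (inj_card_bij fi); rewrite card_prod !card_ord.
rewrite pair_bigA /=; apply: eq_bigr => -[u t] _.
by rewrite cellK ?ltn_ord.
Qed.

End CuttingStacking.

(** * The transformation of the line *)

Section LimitBounds.
Local Open Scope classical_set_scope.
Local Open Scope ring_scope.
Context {R : realType}.

Lemma cvg_ge_near k (u : nat -> R) l x : u @ \oo --> l ->
  (forall n, (k <= n)%N -> x <= u n) -> x <= l.
Proof.
move=> c h; rewrite -(cvg_lim _ c) //; apply: limr_ge; last by exists k.
by apply/cvg_ex; exists l.
Qed.

Lemma cvg_le_near k (u : nat -> R) l x : u @ \oo --> l ->
  (forall n, (k <= n)%N -> u n <= x) -> l <= x.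
Proof.
move=> c h; rewrite -(cvg_lim _ c) //; apply: limr_le; last by exists k.
by apply/cvg_ex; exists l.
Qed.

End LimitBounds.

Section LineDynamics.
Local Open Scope classical_set_scope.
Local Open Scope ring_scope.
Context {R : realType}.
Variables N m : nat -> nat.
Hypothesis N0 : forall j, (0 < N j)%N.
Hypothesis m0 : forall j, (0 < m j)%N.
Hypothesis NS : forall j, (N j.+1 = N j * N j * m j)%N.
Local Notation nlev := (nlev N).
Local Notation ncell := (ncell N).
Local Notation cuts := (cuts N m).
Local Notation adr := (adr N m).
Local Notation next := (next N m).

(** The number of cells as a real number, hence the inverse of the length of a cell. *)
Definition width j : R := (ncell j)%:R.

Lemma width_gt0 j : 0 < width j.
Proof. by rewrite ltr0n ncell_gt0. Qed.

(** Makes the functions below total on the line: a point outside [[0, 1)] behaves as [0]. *)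
Definition clip (y : R) : R := if 0 <= y < 1 then y else 0.

Lemma clip_itv y : 0 <= clip y < 1.
Proof. by rewrite /clip; case: ifP => // _; rewrite lexx ltr01. Qed.

Lemma clip_ge0 y : 0 <= clip y. Proof. by case/andP: (clip_itv y). Qed.

Lemma clip_id y : 0 <= y < 1 -> clip y = y.
Proof. by rewrite /clip => ->. Qed.

Lemma clipK y : clip (clip y) = clip y.
Proof. exact/clip_id/clip_itv. Qed.

Definition idx j (y : R) : nat := Num.truncn (width j * clip y).

Lemma idx_itv j y : (idx j y)%:R <= width j * clip y < (idx j y).+1%:R.
Proof. by apply: truncn_itv; rewrite mulr_ge0 ?clip_ge0 // ltW ?width_gt0. Qed.

Lemma idx_def j y b : (b%:R <= width j * clip y < b.+1%:R) -> idx j y = b.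
Proof. exact: truncn_def. Qed.

Lemma idx_clip j y : idx j (clip y) = idx j y.
Proof. by rewrite /idx clipK. Qed.

Lemma idx_lt j y : (idx j y < ncell j)%N.
Proof.
have /andP[h _] := idx_itv j y; rewrite -(ltr_nat R); apply: (le_lt_trans h).
by rewrite gtr_pMr ?width_gt0 //; case/andP: (clip_itv y).
Qed.

Lemma idxS j y : idx j y = (idx j.+1 y %/ cuts j)%N.
Proof.
apply: idx_def; have /andP[h1 h2] := idx_itv j.+1 y.
have c0 : 0 < (cuts j)%:R :> R by rewrite ltr0n cuts_gt0.
have wE : width j.+1 = width j * (cuts j)%:R by rewrite /width (ncellS NS) // natrM.
rewrite wE mulrAC in h1 h2; set q := (_ %/ _)%N; apply/andP; split.
  rewrite -(ler_pM2r c0) -natrM; apply: le_trans h1.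
  by rewrite ler_nat leq_divM.
rewrite -(ltr_pM2r c0) -natrM; apply: (lt_le_trans h2).
by rewrite ler_nat ltn_ceil // cuts_gt0.
Qed.

Lemma idx_eq_le i j y z : (i <= j)%N -> idx j y = idx j z -> idx i y = idx i z.
Proof.
move=> /subnK <-; elim: (j - i)%N => // k IH; rewrite addSn => e; apply: IH.
by rewrite (idxS (k + i) y) (idxS (k + i) z) e.
Qed.

Lemma lvlS j y : (idx j y < nlev j)%N -> (idx j.+1 y < nlev j * cuts j)%N.
Proof. by rewrite idxS ltn_divLR // cuts_gt0. Qed.

Lemma lvl_le i j y : (i <= j)%N -> (idx i y < nlev i)%N -> (idx j y < nlev j)%N.
Proof.
move=> /subnK <-; elim: (j - i)%N => // k IH /IH /lvlS; rewrite addSn.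
by move=> /leq_trans; apply; rewrite (nlevS NS) leq_addr.
Qed.

Lemma cvg_ht : (fun j => 2 / (ht j + 2)%:R : R) @ \oo --> 0.
Proof.
apply/cvgrPdist_le => e e0; near=> n.
rewrite sub0r normrN ger0_norm ?divr_ge0 // ler_pdivrMr; last first.
  by rewrite ltr0n addn2.
rewrite mulrC -ler_pdivrMr //; apply: (le_trans (y := n%:R)).
  by near: n; apply: nbhs_infty_ger.
by rewrite ler_nat ht2; have := ltn_expl n (isT : (1 < 2)%N); lia.
Unshelve. all: by end_near.
Qed.

(** The levels are numbered before the reserve, so those of stage [j] fill
    [[0, 1 - 2 / (ht j + 2))]. Hence every point, and not only almost every one, enters a column. *)
Lemma lvl_ex y : exists j, (idx j y < nlev j)%N.
Proof.
have e0 : 0 < 1 - clip y by rewrite subr_gt0; case/andP: (clip_itv y).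
have [j _ /(_ _ (leqnn j))] := (cvgrPdist_lt _ _).1 cvg_ht _ e0.
rewrite /= sub0r normrN ger0_norm ?divr_ge0 // => h; exists j.
have /andP[h1 _] := idx_itv j y.
rewrite -(ltr_nat R); apply: (le_lt_trans h1).
have -> : (nlev j)%:R = width j * (1 - 2 / (ht j + 2)%:R) :> R.
  rewrite /width /ncell /nlev mulrBr mulr1 !natrM natrD.
  have : ((ht j)%:R + 2 : R) != 0 by rewrite -natrD pnatr_eq0 addn2.
  by move=> ?; field.
by rewrite ltr_pM2l ?width_gt0 // ltrBrDl -ltrBrDr.
Qed.

Definition stage y : nat := ex_minn (lvl_ex y).

Lemma stageP y : (idx (stage y) y < nlev (stage y))%N.
Proof. by rewrite /stage; case: ex_minnP. Qed.

Lemma stage_min j y : (idx j y < nlev j)%N -> (stage y <= j)%N.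
Proof. by rewrite /stage; case: ex_minnP => k _; apply. Qed.

Lemma lvl_stage j y : (stage y <= j)%N -> (idx j y < nlev j)%N.
Proof. by move=> /lvl_le; apply; apply: stageP. Qed.

Lemma stage_eq j y z : (idx j y < nlev j)%N -> idx j y = idx j z ->
  stage y = stage z.
Proof.
move=> ly e; have lz : (idx j z < nlev j)%N by rewrite -e.
apply/eqP; rewrite eqn_leq; apply/andP; split; apply: stage_min.
  rewrite (idx_eq_le (stage_min lz) e); exact: stageP.
rewrite -(idx_eq_le (stage_min ly) e); exact: stageP.
Qed.

Definition disp (e : bool) j b : R := ((next e j b)%:R - b%:R) / width j.

(** [mv true] is the transformation and [mv false] its inverse. The translation is read one stage
    after [stage y], where [inner_child] provides both neighbours of the cell. *)
Definition mv (e : bool) (y : R) : R :=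
  clip y + disp e (stage y).+1 (idx (stage y).+1 y).

Definition free (e : bool) j y :=
  (idx j y < nlev j)%N && inner e j (adr j (idx j y)).2.

Lemma free_stage e y : free e (stage y).+1 y.
Proof.
rewrite /free inner_child // ?andbT; last exact/lvlS/stageP.
exact/lvl_stage/leqnSn.
Qed.

Lemma freeS e j y : free e j y -> free e j.+1 y /\
  disp e j.+1 (idx j.+1 y) = disp e j (idx j y).
Proof.
move=> /andP[l i]; split.
  by rewrite /free (lvl_le (leqnSn j)) //= inner_child // lvlS.
have [s sc E] : exists2 s, (s < cuts j)%N & idx j.+1 y = (idx j y * cuts j + s)%N.
  exists (idx j.+1 y %% cuts j)%N; first by rewrite ltn_mod cuts_gt0.
  by rewrite (idxS j) -divn_eq.
rewrite /disp E next_child // !natrD (natrM _ (next _ _ _)) (natrM _ (idx _ _)).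
rewrite opprD addrACA subrr addr0 -mulrBl.
have -> : width j.+1 = width j * (cuts j)%:R by rewrite /width (ncellS NS) natrM.
have c0 : (cuts j)%:R != 0 :> R by rewrite pnatr_eq0 -lt0n cuts_gt0.
have w0 := lt0r_neq0 (width_gt0 j).
by rewrite -mulrA; congr (_ * _); rewrite invfM mulrCA mulfV // mulr1.
Qed.

Lemma free_le e i j y : (i <= j)%N -> free e i y -> free e j y /\
  disp e j (idx j y) = disp e i (idx i y).
Proof.
move=> /subnK <-; elim: (j - i)%N => // k IH /IH[f d]; rewrite addSn.
by have [f' d'] := freeS f; rewrite d'.
Qed.

Lemma mvE e j y : free e j y -> mv e y = clip y + disp e j (idx j y).
Proof.
move=> f; rewrite /mv; congr (_ + _).
have [_ <-] := free_le (leq_maxl (stage y).+1 j) (free_stage e y).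
by have [_ <-] := free_le (leq_maxr (stage y).+1 j) f.
Qed.

Lemma mv_width e j y : free e j y ->
  (next e j (idx j y))%:R <= width j * mv e y < (next e j (idx j y)).+1%:R.
Proof.
move=> f; rewrite (mvE f) /disp; have /andP[h1 h2] := idx_itv j y.
have w0 := lt0r_neq0 (width_gt0 j).
rewrite mulrDr mulrCA mulfV // mulr1 -!natr1 in h2 *; lra.
Qed.

Lemma mv_itv e y : 0 <= mv e y < 1.
Proof.
have f := free_stage e y; have /andP[h1 h2] := mv_width f.
have w0 := width_gt0 (stage y).+1; case/andP: f => l i.
rewrite -(pmulr_rge0 _ w0) (le_trans _ h1) //=.
rewrite -(ltr_pM2l w0) mulr1; apply: (lt_le_trans h2).
rewrite ler_nat; apply: (leq_trans (next_lt N0 m0 NS l i)).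
by rewrite -nlev_ncell leq_addr.
Qed.

Lemma idx_mv e j y : free e j y -> idx j (mv e y) = next e j (idx j y).
Proof.
by move=> f; apply: idx_def; rewrite clip_id ?mv_itv // mv_width.
Qed.

Lemma free_mv e j y : free e j y -> free (~~ e) j (mv e y).
Proof.
move=> f; rewrite /free idx_mv //; case/andP: f => l i.
rewrite next_lt //= adr_next //=; have [_ tL _] := adrK N0 m0 NS l.
by case: e i => /=; lia.
Qed.

Lemma mvK e y : mv (~~ e) (mv e y) = clip y.
Proof.
have f := free_stage e y.
rewrite (mvE (free_mv f)) clip_id ?mv_itv // idx_mv // (mvE f) /disp.
by case/andP: (f) => l i; rewrite nextK //; lra.
Qed.

Lemma mv_clip e y : mv e (clip y) = mv e y.
Proof.
have es : stage (clip y) = stage y.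
  by rewrite (stage_eq (stageP y) (esym (idx_clip _ _))).
by rewrite /mv clipK es idx_clip.
Qed.


(** The jump of [spread] at each end point of a cell of stage [i]. [width i] such jumps add up to
    [2^-1 ^+ (i + 3)], and the sum of these numbers over [i] is [4^-1]. *)
Definition gap i : R := (width i * 2 ^+ (i + 3))^-1.

Lemma gap_gt0 i : 0 < gap i.
Proof. by rewrite invr_gt0 mulr_gt0 ?width_gt0 // exprn_gt0. Qed.

Lemma gap_ge0 i : 0 <= gap i.
Proof. exact/ltW/gap_gt0. Qed.

Definition spread_sum n y : R := \sum_(i < n) gap i * (idx i y)%:R.

Definition spread y : R := limn (spread_sum ^~ y).

Lemma gap_idx_le i y : gap i * (idx i y)%:R <= 2^-1 ^+ (i + 3).
Proof.
have /andP[h _] := idx_itv i y.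
rewrite /gap invfM mulrAC exprVn ler_piMl ?invr_ge0 ?exprn_ge0 //.
rewrite mulrC ler_pdivrMr ?width_gt0 // mul1r; apply: (le_trans h).
by rewrite ler_piMr // ?ltW ?width_gt0 //; case/andP: (clip_itv y).
Qed.

Lemma geom_half_sum j n : \sum_(i < n) 2^-1 ^+ (j + i + 1) <= 2^-1 ^+ j :> R.
Proof.
suff -> : \sum_(i < n) 2^-1 ^+ (j + i + 1) = 2^-1 ^+ j - 2^-1 ^+ (j + n) :> R.
  by rewrite gerBl exprn_ge0.
elim: n => [|n IH]; first by rewrite big_ord0 addn0 subrr.
by rewrite big_ord_recr /= IH addn1 addnS !exprS; lra.
Qed.

Lemma spread_sum_le n y : spread_sum n y <= 4^-1.
Proof.
have -> : 4^-1 = 2^-1 ^+ 2 :> R by field.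
apply: le_trans (geom_half_sum 2 n); apply: ler_sum => i _.
by apply: (le_trans (gap_idx_le _ _)); rewrite addnC addnAC.
Qed.

Lemma cvg_spread y : spread_sum ^~ y @ \oo --> spread y.
Proof.
apply: nondecreasing_is_cvgn.
  apply/nondecreasing_seqP => n; rewrite /spread_sum big_ord_recr /= lerDl.
  by rewrite mulr_ge0 ?gap_ge0.
by exists 4^-1 => _ [n _ <-]; apply: spread_sum_le.
Qed.

Lemma spread_ge0 y : 0 <= spread y.
Proof.
apply: (cvg_ge_near (k := 0) (@cvg_spread y)) => n _.
by apply: sumr_ge0 => i _; rewrite mulr_ge0 ?gap_ge0.
Qed.

Lemma spread_le y : spread y <= 4^-1.
Proof.
by apply: (cvg_le_near (k := 0) (@cvg_spread y)) => n _; apply: spread_sum_le.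
Qed.

Lemma idx_mono i j y z : (idx i y < idx i z)%N -> (idx j y <= idx j z)%N.
Proof.
move=> h; have yz : clip y < clip z.
  have /andP[_ h1] := idx_itv i y; have /andP[h2 _] := idx_itv i z.
  rewrite -(ltr_pM2l (width_gt0 i)); apply: (lt_le_trans h1).
  by apply: le_trans h2; rewrite ler_nat.
by rewrite le_truncn // ler_pM2l ?width_gt0 // ltW.
Qed.

Lemma spread_sep j y z : (idx j y < idx j z)%N -> spread y + gap j <= spread z.
Proof.
move=> h; rewrite addrC -lerBrDr.
apply: (cvg_ge_near (k := j.+1) (cvgB (@cvg_spread z) (@cvg_spread y))) => n jn.
rewrite !fctE /spread_sum -sumrB (bigD1 (Ordinal jn)) //= ler_wpDr //.
  apply: sumr_ge0 => i _; rewrite -mulrBr mulr_ge0 ?gap_ge0 //.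
  by rewrite subr_ge0 ler_nat (idx_mono (i := j)).
by rewrite -mulrBr ler_peMr ?gap_ge0 // lerBrDr addrC natr1 ler_nat.
Qed.

Lemma spread_close j y z : idx j y = idx j z -> `|spread y - spread z| <= 2^-1 ^+ j.
Proof.
move=> e; apply: (cvg_le_near (k := j)
  (cvg_norm (cvgB (@cvg_spread y) (@cvg_spread z)))) => n jn.
rewrite !fctE /spread_sum -sumrB -(subnKC jn).
rewrite big_split_ord /= big1 ?add0r => [|i _]; last first.
  by rewrite (idx_eq_le (ltnW (ltn_ord i)) e) subrr.
apply: (le_trans (ler_norm_sum _ _ _)).
apply: le_trans (geom_half_sum j (n - j)); apply: ler_sum => i _.
have a0 x : 0 <= gap (j + i) * (idx (j + i) x)%:R :> R.
  by rewrite mulr_ge0 ?gap_ge0.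
have ale x : gap (j + i) * (idx (j + i) x)%:R <= 2^-1 ^+ (j + i + 1) :> R.
  apply: (le_trans (gap_idx_le _ _)).
  by rewrite ler_wiXn2l ?invr_ge0 ?invf_le1 ?ler1n // leq_add2l.
by rewrite ler_norml; have := a0 y; have := a0 z; have := ale y; have := ale z; lra.
Qed.

(** Up to stage [j], [y] and [z] have the same indices, and so do their images. Beyond it, their
    indices are shifted by the same amount, since [mv e] is the same translation on the whole cell.
    So all the partial sums agree. *)
Lemma spread_mv e j y z : free e j y -> idx j y = idx j z ->
  spread (mv e y) - spread y = spread (mv e z) - spread z.
Proof.
move=> fy eyz; have fz : free e j z by rewrite /free -eyz.
apply/eqP; rewrite -subr_eq0; apply/eqP.
have c : (fun n => (spread_sum n (mv e y) - spread_sum n y) -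
    (spread_sum n (mv e z) - spread_sum n z)) @ \oo -->
    (spread (mv e y) - spread y - (spread (mv e z) - spread z)).
  by apply: cvgB; apply: cvgB; apply: cvg_spread.
rewrite -(cvg_lim _ c) //; apply: lim_near_cst => //.
apply: nearW => n; rewrite /spread_sum -!sumrB big1 // => i _.
rewrite -3!mulrBr; apply/eqP; rewrite mulf_eq0 subr_eq0; apply/orP; right.
have [ij|ji] := leqP i j.
  rewrite (idx_eq_le ij eyz); apply/eqP; congr (_%:R - _).
  by apply: (idx_eq_le ij); rewrite !idx_mv // eyz.
have H x : free e j x ->
    (idx i (mv e x))%:R - (idx i x)%:R = width i * disp e j (idx j x) :> R.
  move=> f; have [f' <-] := free_le (ltnW ji) f.
  by rewrite idx_mv // /disp mulrCA mulfV ?mulr1 // lt0r_neq0 ?width_gt0.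
by rewrite !H // eyz.
Qed.

(** With [4^-1] and the bound on [spread], the places of stage [j] lie in [[j + 1/4, j + 1/2]]; this
    leaves room for [phi] to return to [0] before the integers on both sides. *)
Definition place y : R := (stage y)%:R + 4^-1 + spread y.

Lemma stage_mv e j y z : free e j y -> idx j y = idx j z ->
  stage (mv e y) = stage (mv e z).
Proof.
move=> fy eyz; have fz : free e j z by rewrite /free -eyz.
apply: (@stage_eq j); last by rewrite !idx_mv // eyz.
by rewrite idx_mv //; case/andP: fy => ? ?; apply: next_lt.
Qed.

Lemma place_mv e j y z : free e j y -> idx j y = idx j z ->
  place (mv e y) - place y = place (mv e z) - place z.
Proof.
move=> fy eyz; have := spread_mv fy eyz; rewrite /place (stage_mv fy eyz).
by case/andP: fy => l _; rewrite (stage_eq l eyz); lra.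
Qed.

Lemma place_clip y : place (clip y) = place y.
Proof.
rewrite /place (stage_eq (stageP y) (esym (idx_clip _ _))); congr (_ + _).
by rewrite /spread; congr (limn _); apply/funext => n; apply: eq_bigr => i _;
  rewrite idx_clip.
Qed.

End LineDynamics.

Lemma pushforward_probability d d' (T : measurableType d) (T' : measurableType d')
    (R : realType) (P : probability T R) (f : T -> T') :
  measurable_fun [set: T]%classic f ->
  exists Q : probability T' R, forall A, Q A = P (f @^-1` A)%classic.
Proof.
move=> mf; pose fm : {mfun T >-> T'} := HB.pack f (isMeasurableFun.Build _ _ _ _ f mf).
by exists (distribution P fm).
Qed.

(** * The invariant probability measure *)

Section LineMeasure.
Local Open Scope classical_set_scope.
Local Open Scope ring_scope.
Context {R : realType}.
Variables N m : nat -> nat.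
Hypothesis N0 : forall j, (0 < N j)%N.
Hypothesis m0 : forall j, (0 < m j)%N.
Hypothesis NS : forall j, (N j.+1 = N j * N j * m j)%N.
Local Notation nlev := (nlev N).
Local Notation ncell := (ncell N).
Local Notation adr := (adr N m).
Local Notation next := (next N m).
Local Notation width := (@width R N).
Local Notation idx := (@idx R N).
Local Notation stage := (stage N0).
Local Notation free := (@free R N m).
Local Notation mv := (@mv R N m N0).

Definition gcell j b : set R := idx j @^-1` [set b].

(** The levels that are not at the bottom of their column. The preimage of such a cell by [mv true]
    is the cell below it, so measurability and invariance are immediate on this class, which is
    stable under intersection. *)
Definition good_cells : set (set R) := [set A | A = set0 \/
  exists j b, [/\ (b < nlev j)%N, (0 < (adr j b).2)%N & A = gcell j b]].

Lemma good_free j y : (idx j y < nlev j)%N -> (0 < (adr j (idx j y)).2)%N ->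
  free false j y.
Proof. by move=> l i; rewrite /free l. Qed.

Lemma good_cellsI : setI_closed good_cells.
Proof.
have H i b j c : (i <= j)%N -> (b < nlev i)%N -> (0 < (adr i b).2)%N ->
    (c < nlev j)%N -> (0 < (adr j c).2)%N -> good_cells (gcell i b `&` gcell j c).
  move=> ij bl b0 cl c0.
  have [|e] := eqVneq (gcell i b `&` gcell j c) set0; first by left.
  have /set0P[x [/= xb xc]] := e; right; exists j, c; split => //.
  apply/seteqP; split => z /=; first by case.
  move=> zc; split=> //; rewrite /gcell /= -xb.
  by apply: (idx_eq_le N0 m0 NS ij); rewrite zc xc.
move=> A B [->|[i [b [b1 b2 ->]]]] [->|[j [c [c1 c2 ->]]]];
  rewrite ?set0I ?setI0; try by left.
have [ij|ji] := leqP i j; first exact: H.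
by rewrite setIC; apply: H => //; apply: ltnW.
Qed.

Local Notation Omega := (g_sigma_algebraType good_cells).

Lemma good_gcell_measurable j b : (b < nlev j)%N -> (0 < (adr j b).2)%N ->
  measurable (gcell j b : set Omega).
Proof. by move=> l i; apply: sub_sigma_algebra; right; exists j, b. Qed.

(** A cell is the union of the good cells that it contains, because each point lies in a good cell
    of every large stage. *)
Lemma gcell_measurable j b : measurable (gcell j b : set Omega).
Proof.
pose D (p : nat * nat) := [&& (j <= p.1)%N, (p.2 < nlev p.1)%N,
  (0 < (adr p.1 p.2).2)%N & `[< gcell p.1 p.2 `<=` gcell j b >]].
have -> : gcell j b = \bigcup_p (if D p then gcell p.1 p.2 else set0).
  apply/seteqP; split=> [x xb | x [p _]]; last first.
    by case: ifP => // /and4P[_ _ _ /asboolP]; apply.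
  pose i := maxn j (stage x).+1.
  exists (i, idx i x) => //=.
  have := free_stage N0 m0 NS false x.
  case/(free_le N0 m0 NS (leq_maxr j _)) => + _; rewrite -/i /free /= => /andP[l s].
  rewrite /D /= leq_maxl l s /= ifT //; apply/asboolP => z /= zi.
  by rewrite /gcell /= -xb; apply: (idx_eq_le N0 m0 NS (leq_maxl _ _) zi).
apply: countable_bigcupT_measurable; first exact: countableP.
move=> p; case: ifP => // /and4P[_ l i _]; exact: good_gcell_measurable.
Qed.

Lemma clip_measurable : measurable_fun setT (@clip R).
Proof.
rewrite /clip; apply: measurable_fun_if => //=.
apply: measurable_and; first exact: measurable_realfun.measurable_fun_ler.
exact: measurable_realfun.measurable_fun_ltr.
Qed.

Lemma gcell_clip j b : gcell j b = @clip R @^-1` `[b%:R / width j, b.+1%:R / width j[.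
Proof.
have w0 := @width_gt0 R N N0 j; apply/seteqP; split=> y /=.
  move=> <-; rewrite in_itv /= ler_pdivrMr // ltr_pdivlMr // mulrC.
  by apply: idx_itv.
rewrite in_itv /= ler_pdivrMr // ltr_pdivlMr // mulrC => h.
exact: idx_def.
Qed.

Lemma gcell_borel j b : measurable (gcell j b).
Proof.
rewrite gcell_clip -[X in measurable X]setTI.
by apply: clip_measurable => //; exact: measurable_itv.
Qed.

Lemma uniform_gcell j b : (b < ncell j)%N ->
  uniform_prob (@ltr01 R) (gcell j b) = ((ncell j)%:R^-1)%:E.
Proof.
move=> bn; have w0 := @width_gt0 R N N0 j.
pose I := [set` `[b%:R / width j, b.+1%:R / width j[ : interval R].
have mI : measurable I by exact: measurable_itv.
have uE A : measurable A ->
    uniform_prob (@ltr01 R) A = lebesgue_measure (A `&` `[0, 1]).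
  move=> mA; rewrite /uniform_prob integral_uniform_pdf.
  rewrite (eq_integral (cst 1%E)).
    by rewrite integral_cst ?mul1e //; apply: measurableI => //; exact: measurable_itv.
  by move=> x; rewrite inE /= in_itv /= /uniform_pdf => -[_ ->]; rewrite subr0 invr1.
have lI : lebesgue_measure I = ((ncell j)%:R^-1)%:E.
  rewrite lebesgue_measure_itv /= lte_fin ltr_pM2r ?invr_gt0 // ltr_nat ltnSn.
  by rewrite -EFinB -mulrBl -natr1 addrAC subrr add0r mul1r.
have I01 y : I y -> 0 <= y < 1.
  rewrite /I /= in_itv /= => /andP[h1 h2]; apply/andP; split.
    by apply: le_trans h1; rewrite divr_ge0 // ltW.
  by apply: (lt_le_trans h2); rewrite ler_pdivrMr // mul1r ler_nat.
rewrite uE; last exact: gcell_borel.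
apply/eqP; rewrite eq_le; apply/andP; split.
  (* The point [1] belongs to the support [[0, 1]] of the uniform law but is sent to [0] by [clip];
     it is the only possible difference with [I]. *)
  have -> : ((ncell j)%:R^-1)%:E = (lebesgue_measure I + lebesgue_measure [set 1%R])%E.
    by rewrite lebesgue_measure_set1 adde0 lI.
  apply: le_trans (measureU2 _ _ _) => //; apply: le_measure.
  - rewrite inE; apply: measurableI; first exact: gcell_borel.
    exact: measurable_itv.
  - by rewrite inE; apply: measurableU.
  - move=> y [/=]; rewrite gcell_clip /= in_itv /= => yb /andP[y0]; rewrite bnd_simp in y0.
    rewrite bnd_simp le_eqVlt => /orP[/eqP|] y1; [by right | left].
    by move: yb; rewrite clip_id ?y0.
rewrite -lI; apply: le_measure.
- by rewrite inE.
- rewrite inE; apply: measurableI; first exact: gcell_borel.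
  exact: measurable_itv.
- move=> y Iy; split; last first.
    by rewrite /= in_itv /=; case/andP: (I01 _ Iy) => -> /ltW ->.
  by rewrite gcell_clip /= clip_id // I01.
Qed.

Lemma line_probability : exists P : probability Omega R,
  forall j b, (b < ncell j)%N -> P (gcell j b) = ((ncell j)%:R^-1)%:E.
Proof.
pose f (x : measurableTypeR R) : Omega := x.
have mf : measurable_fun setT f.
  apply: (@measurability _ _ _ Omega _ _ good_cells) => //.
  move=> _ [A [->|[j [b [_ _ ->]]]] <-]; first by rewrite preimage_set0 setI0.
  by rewrite setTI; apply: gcell_borel.
have [Q QE] := pushforward_probability (uniform_prob (@ltr01 R)) mf.
exists Q => j b bn; rewrite QE; exact: uniform_gcell.
Qed.

Lemma mv_preimage j c : (c < nlev j)%N -> (0 < (adr j c).2)%N ->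
  mv true @^-1` (gcell j c) = gcell j (next false j c).
Proof.
move=> cl c0; have tc : inner false j (adr j c).2 by [].
have [_ tL _] := adrK N0 m0 NS cl.
apply/seteqP; split=> y /= yc; rewrite /gcell /= in yc *.
  have f : free false j (mv true y) by apply: good_free; rewrite yc.
  by rewrite -(idx_clip N j y) -(mvK N0 m0 NS true y) /= idx_mv // yc.
have f : free true j y.
  by rewrite /free yc next_lt //= adr_next //=; lia.
by rewrite idx_mv // yc -[true]/(~~ false) nextK.
Qed.

Lemma mv_measurable : measurable_fun setT (mv true : Omega -> Omega).
Proof.
apply: (@measurability _ _ _ Omega _ _ good_cells) => //.
move=> _ [A [->|[j [b [b1 b2 ->]]]] <-]; first by rewrite preimage_set0 setI0.
by rewrite setTI mv_preimage //; apply: gcell_measurable.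
Qed.

(** A good cell and its preimage are cells of the same stage, hence of the same mass; uniqueness of
    measures on a class stable under intersection concludes. [g] enumerates this class in order to
    cover the space. *)
Lemma mv_invariant (P : probability Omega R) :
  (forall j b, (b < ncell j)%N -> P (gcell j b) = ((ncell j)%:R^-1)%:E) ->
  forall A : set Omega, measurable A -> P (mv true @^-1` A) = P A.
Proof.
move=> PE; have [Q QE] := pushforward_probability P mv_measurable.
suff H A : measurable A -> Q A = P A by move=> A mA; rewrite -QE H.
pose g n : set Omega := if unpickle n is Some p then
   if ((p.2 < nlev p.1) && (0 < (adr p.1 p.2).2))%N then gcell p.1 p.2 else set0
   else set0.
apply: (@measure_unique _ R Omega good_cells g) => //.
- exact: good_cellsI.
- move=> n; rewrite /g; case: unpickle => [p|]; last by left.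
  by case: ifP => [/andP[? ?]|]; [right; exists p.1, p.2 | left].
- apply/seteqP; split=> // x _.
  have := free_stage N0 m0 NS false x; rewrite /free /= => /andP[l s].
  exists (pickle ((stage x).+1, idx (stage x).+1 x)) => //.
  by rewrite /g pickleK /= l s.
- move=> _ [->|[j [b [b1 b2 ->]]]]; first by rewrite !measure0.
  apply: (eq_trans (QE _)); rewrite mv_preimage //.
  have lc c : (c < nlev j)%N -> (c < ncell j)%N.
    by move=> /leq_trans; apply; rewrite -nlev_ncell leq_addr.
  transitivity ((ncell j)%:R^-1%:E : \bar R); last by apply/esym/PE/lc.
  by apply/PE/lc/(next_lt N0 m0 NS b1).
- by move=> k; rewrite (le_lt_trans (probability_le1 _ _)) ?ltry // /g;
    case: unpickle => [p|] //; case: ifP => // _; apply: gcell_measurable.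
Qed.

End LineMeasure.

(** * Entropy of the cutting and stacking system *)

Section SystemEntropy.
Local Open Scope classical_set_scope.
Local Open Scope ring_scope.
Variables N m : nat -> nat.
Hypothesis N0 : forall j, (0 < N j)%N.
Hypothesis m0 : forall j, (0 < m j)%N.
Hypothesis NS : forall j, (N j.+1 = N j * N j * m j)%N.
Local Notation nlev := (nlev N).
Local Notation ncell := (ncell N).
Local Notation cuts := (cuts N m).
Local Notation adr := (adr N m).
Local Notation next := (next N m).
Local Notation cell := (cell N m).
Local Notation code := (code N m).

Context {R : realType} {d : measure_display} {T : measurableType d}.
Variables (P : probability T R) (S : T -> T) (idx : nat -> T -> nat).
Local Notation pr := (pr P).
Local Notation law := (law P).
Local Notation ent := (ent P).
Local Notation cent := (cent P).

Hypothesis mS : measurable_fun setT S.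
Hypothesis PS : forall A, measurable A -> P (S @^-1` A) = P A.
Hypothesis idx_lt : forall j y, (idx j y < ncell j)%N.
Hypothesis idxS : forall j y, idx j y = (idx j.+1 y %/ cuts j)%N.
Hypothesis midx : forall j b, measurable (idx j @^-1` [set b]).
Hypothesis Pidx : forall j b, (b < ncell j)%N ->
  P (idx j @^-1` [set b]) = ((ncell j)%:R^-1)%:E.
Hypothesis idx_fwd : forall j y, (idx j y < nlev j)%N ->
  inner true j (adr j (idx j y)).2 -> idx j (S y) = next true j (idx j y).
Hypothesis idx_bwd : forall j y, (idx j (S y) < nlev j)%N ->
  inner false j (adr j (idx j (S y))).2 -> idx j y = next false j (idx j (S y)).
Hypothesis idx_gen : (@measurable _ T) `<=`
  <<s [set A | exists j b, A = idx j @^-1` [set b]] >>.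

Lemma nlev_lt j b : (b < nlev j)%N -> (b < ncell j)%N.
Proof. by move=> /leq_trans; apply; rewrite -nlev_ncell leq_addr. Qed.

(** The partition into levels of stage [k], where the value [nlev k] stands for the complement of
    the columns, as in [code]. *)
Definition lev k (y : T) : 'I_(nlev k).+1 := inord (minn (idx k y) (nlev k)).

Lemma val_lev k y : lev k y = minn (idx k y) (nlev k) :> nat.
Proof. by rewrite inordK // ltnS geq_minr. Qed.

Lemma lev_in k y (b : 'I_(nlev k).+1) : (b < nlev k)%N ->
  lev k y = b <-> idx k y = b.
Proof.
move=> bn; split=> [/(congr1 val) /= | e]; first by rewrite val_lev; lia.
by apply: val_inj; rewrite /= val_lev e; lia.
Qed.

Lemma lev_preimage k (b : 'I_(nlev k).+1) : (b < nlev k)%N ->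
  lev k @^-1` [set b] = idx k @^-1` [set (b : nat)].
Proof. by move=> bn; apply/seteqP; split => y /=; rewrite lev_in. Qed.

Lemma rvar_lev k : rvar (lev k).
Proof.
move=> b; have [bn|bn] := ltnP b (nlev k).
  by rewrite lev_preimage.
rewrite (_ : _ @^-1` _ = ~` \bigcup_(c in [set c | (c < nlev k)%N]) idx k @^-1` [set c]).
  by apply: measurableC; apply: bigcup_measurable.
have bE : b = nlev k :> nat by apply/eqP; rewrite eqn_leq bn andbT -ltnS.
apply/seteqP; split => y /=.
  by move=> e [c /= cn yc]; move: (congr1 val e); rewrite /= val_lev yc; lia.
move=> h; apply: val_inj; rewrite /= val_lev bE; apply/minn_idPr.
by rewrite leqNgt; apply/negP => hh; apply: h; exists (idx k y).
Qed.

Lemma law_lev k (b : 'I_(nlev k).+1) : (b < nlev k)%N ->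
  law (lev k) b = (ncell k)%:R^-1.
Proof.
by move=> bn; rewrite /law lev_preimage // /pr Pidx ?nlev_lt.
Qed.

Lemma law_rest k : law (lev k) ord_max = 2 / (ht k + 2)%:R.
Proof.
have := law_sum1 P (@rvar_lev k); rewrite big_ord_recr /=.
rewrite (eq_bigr (fun=> (ncell k)%:R^-1)) => [|i _]; last by rewrite law_lev /=.
rewrite sumr_const card_ord -[_^-1 *+ _]mulr_natr addrC => e.
have -> : law (lev k) ord_max = 1 - (ncell k)%:R^-1 * (nlev k)%:R by lra.
rewrite /ncell /nlev !natrM natrD.
have ? : (N k)%:R != 0 :> R by rewrite pnatr_eq0 -lt0n.
have ? : ((ht k)%:R + 2 : R) != 0 by rewrite -natrD pnatr_eq0 addn2.
by field; apply/andP.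
Qed.

Definition bot k (w : 'I_(N k)) : 'I_(nlev k).+1 := inord (cell k w 0).

Lemma val_bot k (w : 'I_(N k)) : bot w = cell k w 0 :> nat.
Proof. by rewrite inordK // ltnS ltnW // cell_lt // ht_gt0. Qed.

Lemma bot_inj k : injective (@bot k).
Proof.
move=> w w' /(congr1 val) /=; rewrite !val_bot => /(congr1 (adr k)).
by rewrite !cellK ?ht_gt0 // => -[/val_inj].
Qed.

Definition bots k := [set bot w | w : 'I_(N k)]%SET.

Lemma card_bots k : #|bots k| = N k.
Proof. by rewrite card_imset ?card_ord //; apply: bot_inj. Qed.

Lemma bots_lt k b : b \in bots k -> (b < nlev k)%N.
Proof. by case/imsetP => w _ ->; rewrite val_bot cell_lt // ht_gt0. Qed.

Lemma law_bots k : \sum_(b in bots k) law (lev k) b = (ht k + 2)%:R^-1.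
Proof.
rewrite (eq_bigr (fun=> (ncell k)%:R^-1)) => [|b /bots_lt bn]; last by rewrite law_lev.
rewrite sumr_const card_bots -[_^-1 *+ _]mulr_natr /ncell natrM invfM mulrAC mulVf ?mul1r //.
by rewrite pnatr_eq0 -lt0n.
Qed.

Lemma in_bots k (b : 'I_(nlev k).+1) : (b < nlev k)%N -> (adr k b).2 = 0%N ->
  b \in bots k.
Proof.
move=> bn b0; have [uN _ bE] := adrK N0 m0 NS bn.
apply/imsetP; exists (Ordinal uN) => //.
by apply: val_inj; rewrite /= val_bot /= -b0.
Qed.

(** A level that is not a bottom is entered only from the level below it, by [idx_bwd]. *)
Lemma lev_jump k y : ~~ ((lev k y < nlev k)%N && inner true k (adr k (lev k y)).2) ->
  lev k (S y) = ord_max \/ lev k (S y) \in bots k.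
Proof.
move=> ny; have [h|h] := ltnP (idx k (S y)) (nlev k); last first.
  by left; apply: val_inj; rewrite /= val_lev; lia.
right; have e : lev k (S y) = idx k (S y) :> nat by rewrite val_lev; lia.
apply: in_bots; first by rewrite e.
rewrite e; apply/eqP; apply: contraNT ny; rewrite -lt0n => t0.
have ti : inner false k (adr k (idx k (S y))).2 by [].
have [_ tL _] := adrK N0 m0 NS h.
have yE := idx_bwd h ti; have yl := next_lt N0 m0 NS h ti.
have -> : lev k y = idx k y :> nat by rewrite val_lev yE; lia.
by rewrite yE yl /= adr_next //=; lia.
Qed.

(** Gibbs' inequality with the kernel [kap]: inside a column the next level is certain; elsewhere
    half of the mass goes to the complement of the columns and half is shared equally by the [N k]
    bottoms. The costs are [ln 2] and [ln 2 + ln (N k)], for target sets of mass [2 / (ht k + 2)]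
    and [1 / (ht k + 2)]. *)
Lemma cent_lev k : cent (lev k \o S) (lev k) <=
  3 / (ht k + 2)%:R * ln 2 + (ht k + 2)%:R^-1 * ln (N k)%:R.
Proof.
have mk := @rvar_lev k; have mSk : rvar (lev k \o S) := rvar_iter mS 1 mk.
have Nk : 0 < (N k)%:R :> R by rewrite ltr0n.
pose stay (q : 'I_(nlev k).+1) := (q < nlev k)%N && inner true k (adr k q).2.
pose kap (q i : 'I_(nlev k).+1) : R :=
  if stay q then (i == next true k q :> nat)%:R
  else if i == ord_max then 2^-1 else if i \in bots k then (2 * (N k)%:R)^-1 else 0.
have stayE y : stay (lev k y) -> lev k (S y) = next true k (lev k y) :> nat.
  move=> /andP[l i]; have e : lev k y = idx k y :> nat.
    by move: l; rewrite val_lev; lia.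
  rewrite e in l i *; rewrite val_lev idx_fwd //.
  by have := next_lt N0 m0 NS l i; lia.
have maxNbots : (ord_max \in bots k) = false.
  by apply/negP => /bots_lt /=; rewrite ltnn.
have nonempty i q : 0 < law (fun x => ((lev k \o S) x, lev k x)) (i, q) ->
    exists2 y, lev k (S y) = i & lev k y = q.
  move=> p0; apply: contrapT => h; move: p0; rewrite /law (_ : _ @^-1` _ = set0).
    by rewrite pr0 ltxx.
  by apply/seteqP; split => y //= -[? ?]; apply: h; exists y.
apply: (le_trans (cent_le_kernel mSk mk (k := kap) _ _ _)).
- by move=> q i; rewrite /kap; do ?case: ifP => _ //; rewrite invr_ge0 // mulr_ge0.
- move=> q; rewrite /kap; case sq: (stay q).
    move/andP: sq => [l t].
    have nl := next_lt N0 m0 NS l t.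
    rewrite (bigD1 (inord (next true k q))) //= inordK ?eqxx; last by apply: ltnW.
    rewrite big1 ?addr0 // => i; rewrite -val_eqE /= inordK; last by apply: ltnW.
    by move=> /negbTE ->.
  rewrite (bigD1 ord_max) //= eqxx (bigID [pred i | i \in bots k]) /=.
  rewrite [X in _ + (_ + X)]big1 ?addr0; last first.
    by move=> i /andP[/negbTE -> /negbTE ->].
  rewrite (eq_bigl (fun i => i \in bots k)); last first.
    by move=> i; rewrite /= andb_idl // => ib; apply: contraTneq ib => ->; rewrite maxNbots.
  rewrite (eq_bigr (fun=> (2 * (N k)%:R)^-1)); last first.
    move=> i ib; rewrite ib ifF //.
    by apply: contraTF ib => /eqP ->; rewrite maxNbots.
  rewrite sumr_const card_bots -[_^-1 *+ _]mulr_natr invfM -mulrA mulVf ?gt_eqF // mulr1.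
  by rewrite -div1r -splitr.
- move=> i q /nonempty[y <- <-]; rewrite /kap; case: ifP => [sq|/negbT sq].
    by rewrite stayE // eqxx.
  case: (lev_jump sq) => [->|yb]; first by rewrite eqxx invr_gt0.
  by rewrite yb; case: ifP => _; rewrite invr_gt0 // mulr_gt0.
rewrite -sumrN; apply: (le_trans (y := \sum_i law (lev k \o S) i *
   (((i == ord_max) || (i \in bots k))%:R * ln 2 + (i \in bots k)%:R * ln (N k)%:R))).
  apply: ler_sum => i _; rewrite -(law_pair_sumr _ i mSk mk) mulr_suml -sumrN.
  apply: ler_sum => q _; set p := law _ _.
  have [->|pN0] := eqVneq p 0; first by rewrite !mul0r oppr0.
  have pp : 0 < p by rewrite lt_neqAle eq_sym pN0 law_ge0.
  rewrite -mulrN ler_pM2l //; have [y yi yq] := nonempty _ _ pp.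
  have ln2 : 0 <= ln 2 :> R by rewrite ln_ge0 ?ler1n.
  have lnN : 0 <= ln (N k)%:R :> R by rewrite ln_ge0 // ler1n.
  rewrite /kap; case: ifP => [sq|/negbT sq].
    rewrite -yi -yq stayE ?yq // eqxx ln1 oppr0 addr_ge0 // mulr_ge0 //.
  rewrite -yq in sq; have := lev_jump sq; rewrite yi => -[->|ib].
    by rewrite eqxx maxNbots /= mul1r mul0r addr0 lnV ?posrE // opprK.
  rewrite ib orbT !mul1r; case: ifP => [/eqP ie|_].
    by rewrite ie maxNbots in ib.
  rewrite lnV ?posrE ?mulr_gt0 // opprK lnM ?posrE //.
rewrite (law_iter mS PS 1 mk).
under eq_bigr do rewrite mulrDr !mulrA.
rewrite big_split /= -!mulr_suml.
have -> : \sum_i law (lev k) i * (i \in bots k)%:R = (ht k + 2)%:R^-1.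
  rewrite -law_bots [RHS]big_mkcond /=; apply: eq_bigr => i _.
  by case: ifP; rewrite ?mulr1 ?mulr0.
have -> // : \sum_i law (lev k) i * ((i == ord_max) || (i \in bots k))%:R =
    3 / (ht k + 2)%:R.
rewrite (bigD1 ord_max) //= eqxx mulr1 law_rest.
have -> : 3 / (ht k + 2)%:R = 2 / (ht k + 2)%:R + (ht k + 2)%:R^-1 :> R by lra.
congr (_ + _); rewrite -law_bots [LHS]big_mkcond [RHS]big_mkcond /=.
apply: eq_bigr => i _; case: eqVneq => [->|_] /=; first by rewrite maxNbots.
by case: ifP; rewrite ?mulr1 ?mulr0.
Qed.

Lemma lev_code k i y : (idx (i + k) y < nlev (i + k))%N ->
  lev k y = code k i (adr (i + k) (idx (i + k) y)).1
    (adr (i + k) (idx (i + k) y)).2 :> nat.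
Proof.
elim: i => [|i IH] h; rewrite val_lev.
  have [_ _ e] := adrK N0 m0 NS h; rewrite /= e.
  by apply/minn_idPl/ltnW.
rewrite addSn in h *; have [l|l] := ltnP (idx (i + k) y) (nlev (i + k)).
  rewrite (_ : idx (i + k).+1 y = idx (i + k) y * cuts (i + k) +
    idx (i + k).+1 y %% cuts (i + k))%N; last by rewrite (idxS (i + k)) -divn_eq.
  by rewrite code_desc // ?ltn_mod ?cuts_gt0 // -IH // val_lev.
rewrite code_spacer; last by move: l; rewrite idxS leq_divRL // cuts_gt0.
have le_k j : (idx (j + k) y >= nlev (j + k))%N -> (idx k y >= nlev k)%N.
  elim: j => // j IHj; rewrite addSn => hj; apply: IHj.
  rewrite idxS leq_divRL ?cuts_gt0 //; apply: leq_trans hj.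
  by rewrite (nlevS NS) leq_addr.
by apply/minn_idPr; apply: le_k l.
Qed.

Lemma idx_iter j y s : (idx j y < nlev j)%N ->
  ((adr j (idx j y)).2 + s < ht j)%N ->
  idx j (iter s S y) = cell j (adr j (idx j y)).1 ((adr j (idx j y)).2 + s).
Proof.
move=> l; have [uN tL e] := adrK N0 m0 NS l; elim: s => [|s IH] h.
  by rewrite addn0.
rewrite addnS in h; have {}IH := IH (ltnW h).
rewrite iterS; have cl : (idx j (iter s S y) < nlev j)%N.
  by rewrite IH cell_lt //; lia.
rewrite idx_fwd //; last by rewrite IH cellK //=; lia.
by rewrite IH /next cellK //=; [rewrite addnS | lia].
Qed.

Definition cix j (y : T) : 'I_(ncell j) := Ordinal (idx_lt j y).

Lemma cix_preimage j (b : 'I_(ncell j)) :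
  cix j @^-1` [set b] = idx j @^-1` [set (b : nat)].
Proof.
apply/seteqP; split => y /=; first by move=> <-.
by move=> e; apply: val_inj.
Qed.

Lemma rvar_cix j : rvar (cix j).
Proof. by move=> b; rewrite cix_preimage. Qed.

Lemma pr_cix j b : pr (cix j @^-1` [set b]) = (ncell j)%:R^-1.
Proof. by rewrite cix_preimage /pr Pidx. Qed.

(* The event that the column of stage [j] containing [y] contains also the
   next [n] points of the orbit of [y]. *)
Definition runs n j (b : 'I_(ncell j)) : bool :=
  (b < nlev j)%N && ((adr j b).2 + n < ht j)%N.

Lemma card_runs n j : (n <= ht j)%N -> #|[pred b | runs n (j := j) b]| = (N j * (ht j - n))%N.
Proof.
move=> nh; rewrite -sum1_card big_mkcond /=.
rewrite -(big_mkord xpredT (fun b => if (b < nlev j)%N &&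
  ((adr j b).2 + n < ht j)%N then 1%N else 0%N)).
rewrite (@big_cat_nat _ _ _ (nlev j)) ?leq0n //=; last first.
  by rewrite -nlev_ncell leq_addr.
rewrite [X in (_ + X)%N]big_nat_cond [X in (_ + X)%N]big1 ?addn0; last first.
  by move=> b /andP[/andP[h _] _]; rewrite ltnNge h.
rewrite big_mkord (eq_bigr (fun b : 'I_(nlev j) =>
    (fun u t => (t + n < ht j)%N : nat) (adr j b).1 (adr j b).2)); last first.
  by move=> b _; rewrite ltn_ord /=; case: ifP.
rewrite (sum_levels N0 m0 NS j (fun u t => (t + n < ht j)%N : nat)).
rewrite sum_nat_const card_ord; congr (_ * _)%N.
rewrite -(big_mkord xpredT (fun t => (t + n < ht j)%N : nat)).
rewrite (@big_cat_nat _ _ _ (ht j - n)) ?leq0n ?leq_subr //=.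
rewrite [X in (_ + X)%N]big_nat_cond [X in (_ + X)%N]big1 ?addn0; last first.
  by move=> t /andP[/andP[h _] _]; rewrite (_ : (t + n < ht j)%N = false) //; lia.
rewrite big_nat_cond (eq_bigr (fun=> 1%N)) => [|t /andP[/andP[_ h] _]]; last first.
  by rewrite (_ : (t + n < ht j)%N = true) //; lia.
by rewrite -big_nat_cond sum_nat_const_nat subn0 muln1.
Qed.

Lemma pr_not_runs n j : (n <= ht j)%N ->
  pr (cix j @^-1` [set b | ~~ runs n b]) = (n + 2)%:R / (ht j + 2)%:R.
Proof.
move=> nh; have mr : measurable (cix j @^-1` [set b | runs n b]).
  exact: (rvar_preimage _ (@rvar_cix j)).
have -> : cix j @^-1` [set b | ~~ runs n b] = ~` (cix j @^-1` [set b | runs n b]).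
  by apply/seteqP; split => y /=; move/negP.
rewrite prC //; have := pr_partition P (@runs n j) (@rvar_cix j) measurableT.
rewrite setTI => <-; under eq_bigr do rewrite setTI pr_cix.
rewrite sumr_const card_runs // -[_^-1 *+ _]mulr_natr /ncell !natrM natrB // !natrD.
have ? : (N j)%:R != 0 :> R by rewrite pnatr_eq0 -lt0n.
have ? : ((ht j)%:R + 2 : R) != 0 by rewrite -natrD pnatr_eq0 addn2.
by field; apply/andP.
Qed.

(** For each large stage [j], the points whose next [n] iterates stay in the same column of stage
    [j] are counted column by column, and [code_uniform] applies. The other points have mass
    [(n + 2) / (ht j + 2)], which tends to [0]. *)
Lemma law_bottom_uniform k n (a : {ffun 'I_n -> 'I_(nlev k).+1}) (w w' : 'I_(N k)) :
  law (fun y => (lev k (iter n S y), name S (lev k) n y)) (bot w, a) =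
  law (fun y => (lev k (iter n S y), name S (lev k) n y)) (bot w', a).
Proof.
pose E (v : 'I_(N k)) : set T :=
  (fun y => (lev k (iter n S y), name S (lev k) n y)) @^-1` [set (bot v, a)].
have mE v : measurable (E v).
  by apply: rvar_pair; [apply: (rvar_iter mS) | apply: (rvar_name mS)]; apply: rvar_lev.
have near i : (n <= ht (i + k))%N ->
    `|pr (E w) - pr (E w')| <= (n + 2)%:R / (ht (i + k) + 2)%:R.
  set j := (i + k)%N => nh.
  have split v : pr (E v) = pr (E v `&` cix j @^-1` [set b | runs n b]) +
      pr (E v `&` cix j @^-1` [set b | ~~ runs n b]).
    rewrite -prU.
    - by rewrite -setIUr -preimage_setU (_ : _ `|` _ = setT) ?preimage_setT ?setIT //;
        apply/seteqP; split => // b _ /=; case: runs; [left | right].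
    - by apply: measurableI => //; apply: (rvar_preimage _ (@rvar_cix j)).
    - by apply: measurableI => //; apply: (rvar_preimage _ (@rvar_cix j)).
    - by apply/seteqP; split => y //= -[[_ ->] [_]].
  have bad v : 0 <= pr (E v `&` cix j @^-1` [set b | ~~ runs n b]) <=
      (n + 2)%:R / (ht j + 2)%:R.
    rewrite pr_ge0 /= -pr_not_runs //; apply: pr_le.
    - by apply: measurableI => //; apply: (rvar_preimage _ (@rvar_cix j)).
    - exact: (rvar_preimage _ (@rvar_cix j)).
    - by move=> y [].
  suff good : pr (E w `&` cix j @^-1` [set b | runs n b]) =
      pr (E w' `&` cix j @^-1` [set b | runs n b]).
    rewrite ler_norml (split w) (split w') good.
    have /andP[? ?] := bad w; have /andP[? ?] := bad w'.
    by apply/andP; split; lra.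
  (* The word [a] prescribes only the [n] levels from [t] on, but the test receives all the levels
     from the bottom of the column, as [code_uniform] requires. *)
  pose Q (t : nat) (p : seq nat) := [forall s : 'I_n, nth 0%N p (t + s)%N == a s].
  have gE v : pr (E v `&` cix j @^-1` [set b | runs n b]) =
      (\sum_(t < ht j) if (t + n < ht j)%N then
        \sum_(u < N j) (Q t [seq code k i u s | s <- iota 0 (t + n)] &&
          (code k i u (t + n) == cell k v 0)) else 0)%N%:R / (ncell j)%:R.
    rewrite -pr_partition; [|exact: rvar_cix|exact: mE].
    pose c u t := (Q t [seq code k i u s | s <- iota 0 (t + n)] &&
          (code k i u (t + n) == cell k v 0) : nat).
    have term b : runs n b -> pr (E v `&` cix j @^-1` [set b]) =
        (c (adr j b).1 (adr j b).2)%:R / (ncell j)%:R.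
      move=> /andP[bl br]; rewrite -(pr_cix b).
      have lv y s : idx j y = b -> (s <= n)%N -> lev k (iter s S y) =
          code k i (adr j b).1 ((adr j b).2 + s) :> nat.
        move=> yb sn; have tb : ((adr j b).2 + s < ht j)%N by lia.
        have [uN tL _] := adrK N0 m0 NS bl.
        have e := @idx_iter j y s; rewrite yb in e; have {}e := e bl tb.
        by rewrite (lev_code (i := i)) -/j e ?cell_lt // cellK.
      have [cb|cb] := boolP (Q (adr j b).2 [seq code k i (adr j b).1 s
            | s <- iota 0 ((adr j b).2 + n)] &&
          (code k i (adr j b).1 ((adr j b).2 + n) == cell k v 0)).
        rewrite /c cb mul1r; congr pr; rewrite cix_preimage.
        apply/seteqP; split => [y []//|y /= yb]; split => //.
        move/andP: cb => [/forallP cQ /eqP cw]; congr (_, _).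
          by apply: val_inj; rewrite /= (lv y n) // cw val_bot.
        apply/ffunP => s; rewrite ffunE; apply: val_inj; rewrite /= (lv y s) //.
          by move/eqP: (cQ s) => <-; rewrite (nth_map 0%N) ?size_iota ?nth_iota ?add0n //;
             have := ltn_ord s; lia.
        exact/ltnW.
      rewrite /c (negbTE cb) mul0r; rewrite (_ : _ `&` _ = set0) ?pr0 //.
      apply/seteqP; split => y //=; rewrite /E /= => -[[yw ya] yb].
      have {}yb : idx j y = b by rewrite -yb.
      move/negP: cb; apply; apply/andP; split; last first.
        by rewrite -(lv y n) // yw val_bot.
      apply/forallP => s; rewrite (nth_map 0%N) ?size_iota ?nth_iota ?add0n;
        try by have := ltn_ord s; lia.
      rewrite -(lv y s) //; last exact/ltnW.
      by rewrite -ya ffunE.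
    rewrite (eq_bigr _ term) -mulr_suml -natr_sum; congr (_%:R / _).
    rewrite big_mkcond /= -(big_mkord xpredT (fun b => if (b < nlev j)%N &&
      ((adr j b).2 + n < ht j)%N then c (adr j b).1 (adr j b).2 else 0%N)).
    rewrite (@big_cat_nat _ _ _ (nlev j)) ?leq0n //=; last first.
      by rewrite -nlev_ncell leq_addr.
    rewrite [X in (_ + X)%N]big_nat_cond [X in (_ + X)%N]big1 ?addn0; last first.
      by move=> b /andP[/andP[h _] _]; rewrite ltnNge h.
    rewrite big_mkord (eq_bigr (fun b : 'I_(nlev j) =>
      (fun u t => if (t + n < ht j)%N then c u t else 0%N) (adr j b).1 (adr j b).2)); last first.
      by move=> b _; rewrite ltn_ord.
    rewrite (sum_levels N0 m0 NS j (fun u t => if (t + n < ht j)%N then c u t else 0%N)).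
    rewrite exchange_big /=; apply: eq_bigr => t _.
    by case: ifP => // _; rewrite big1.
  rewrite !gE; congr (_%:R / _); apply: eq_bigr => t _; case: ifP => // tn.
  exact: (code_uniform N0 m0 NS (Q t) tn).
rewrite /law -/(E w) -/(E w'); apply/eqP; rewrite -subr_eq0 -normr_le0.
have c : (fun j => (n + 2)%:R / (ht j + 2)%:R : R) @ \oo --> 0.
  rewrite -(mulr0 ((n + 2)%:R / 2 : R)).
  rewrite (_ : (fun j => _) = (fun j => (n + 2)%:R / 2 * (2 / (ht j + 2)%:R))).
    by apply: cvgM; [exact: cvg_cst | exact: cvg_ht].
  by apply/funext => j; rewrite mulrA mulfVK.
apply: (cvg_ge_near (k := n + k) c) => j jn.
rewrite -(subnK (leq_trans (leq_addl _ _) jn)); apply: near.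
have H i : (i <= ht i)%N by elim: i => //= i; lia.
by apply: leq_trans (H _); lia.
Qed.

(** [cent_ge_uniform] applied to the set of bottoms, whose mass is [1 / (ht k + 2)]. *)
Lemma cent_lev_past k n :
  ln (N k)%:R / (ht k + 2)%:R <= cent (fun y => lev k (iter n S y)) (name S (lev k) n).
Proof.
have mk := @rvar_lev k.
have H := @cent_ge_uniform _ _ _ P _ _ _ _ (bots k) (rvar_iter mS n mk) (rvar_name mS (n := n) mk).
apply: le_trans (H _).
  rewrite card_bots mulrC ler_wpM2r ?ln_ge0 ?ler1n // law_iter // law_bots //.
by move=> _ _ a /imsetP[w _ ->] /imsetP[w' _ ->]; apply: law_bottom_uniform.
Qed.

Lemma ent_lev_ge k n : n%:R * (ln (N k)%:R / (ht k + 2)%:R) <= ent (name S (lev k) n).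
Proof.
have mk := @rvar_lev k; elim: n => [|n IH].
  by rewrite mul0r ent_ge0 //; apply: (rvar_name mS).
by rewrite ent_nameS // -natr1 mulrDl mul1r addrC lerD // cent_lev_past.
Qed.

Lemma prU_le A B : measurable A -> measurable B -> pr (A `|` B) <= pr A + pr B.
Proof.
move=> mA mB; rewrite -lee_fin EFinD !prE //; last exact: measurableU.
exact: measureU2.
Qed.

Lemma pr_bigU_le (I : finType) (F : I -> set T) : (forall i, measurable (F i)) ->
  pr (\bigcup_i F i) <= \sum_i pr (F i).
Proof.
move=> mF; have H (s : seq I) : measurable (\bigcup_(i in [set` s]) F i) /\
    pr (\bigcup_(i in [set` s]) F i) <= \sum_(i <- s) pr (F i).
  elim: s => [|i s [ms IH]]; first by rewrite set_nil bigcup_set0 big_nil pr0.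
  have -> : [set` i :: s] = [set i] `|` [set` s].
    apply/seteqP; split => x /=; rewrite inE.
      by move=> /orP[/eqP|]; [left|right].
    by case=> [->|->]; rewrite ?eqxx ?orbT.
  rewrite bigcup_setU bigcup_set1 big_cons; split; first exact: measurableU.
  by apply: (le_trans (prU_le _ _)) => //; rewrite lerD2l.
have [_] := H (index_enum I); rewrite (_ : [set` _] = setT) //.
by apply/seteqP; split => // i _; rewrite /= mem_index_enum.
Qed.

Definition levset k (B : {set 'I_(nlev k).+1}) : set T := lev k @^-1` [set` B].

Lemma levset_measurable k (B : {set 'I_(nlev k).+1}) : measurable (levset B).
Proof. exact: (rvar_preimage _ (@rvar_lev k)). Qed.

(** Approximation by unions of levels, measured by the symmetric difference. It is required for all
    large [k] so that two sets can be approximated at a common stage. *)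
Definition approx (A : set T) := measurable A /\ forall e, 0 < e ->
  exists k0, forall k, (k0 <= k)%N -> exists B : {set 'I_(nlev k).+1},
    pr (A `\` levset B) + pr (levset B `\` A) <= e.

Lemma idx_mono_eq j k y z : (j <= k)%N -> idx k y = idx k z -> idx j y = idx j z.
Proof.
move=> /subnK <-; elim: (k - j)%N => // i IH; rewrite addSn => e; apply: IH.
by rewrite (idxS (i + j) y) (idxS (i + j) z) e.
Qed.

(** For [k >= j] the cell consists of levels of stage [k] and of a part of the complement of the
    columns, whose mass tends to [0]. *)
Lemma approx_idx j b : approx (idx j @^-1` [set b]).
Proof.
split=> // e e0; have [k1 _ hk1] := (cvgrPdist_lt _ _).1 (@cvg_ht R) _ e0.
exists (maxn k1 j) => k; rewrite geq_max => /andP[k1k jk].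
pose B := [set c : 'I_(nlev k).+1 | (c < nlev k)%N &&
  `[< exists2 z, idx k z = c & idx j z = b >]]%SET.
exists B; rewrite (_ : levset B `\` _ = set0) ?pr0 ?addr0; last first.
  apply/seteqP; split => y //= -[]; rewrite /levset /= inE => /andP[cl /asboolP[z zk zj]].
  apply; rewrite -zj; apply: (idx_mono_eq jk); rewrite zk.
  by move: cl; rewrite val_lev; lia.
apply: (le_trans (y := law (lev k) ord_max)).
  apply: pr_le; [|exact: rvar_lev|].
    by apply: measurableD => //; apply: levset_measurable.
  move=> y [/= yb]; rewrite /levset /= inE => /negP h.
  apply: val_inj; rewrite /= val_lev; apply/minn_idPr; rewrite leqNgt.
  move: h; apply: contra => yl; apply/andP; split; first by rewrite val_lev; lia.
  by apply/asboolP; exists y => //; rewrite val_lev; lia.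
have := hk1 k k1k; rewrite /= sub0r normrN law_rest ger0_norm ?divr_ge0 //.
exact: ltW.
Qed.

Lemma approxC A : approx A -> approx (~` A).
Proof.
move=> [mA hA]; split; first exact: measurableC.
move=> e /hA[k0 hk]; exists k0 => k /hk[B hB]; exists (~: B)%SET.
rewrite (_ : levset (~: B)%SET = ~` levset B); last first.
  by apply/seteqP; split => y /=; rewrite /levset /= inE => /negP.
by rewrite !setDE !setCK addrC [_ `&` A]setIC [~` A `&` _]setIC.
Qed.

Lemma approxU A B : approx A -> approx B -> approx (A `|` B).
Proof.
move=> [mA hA] [mB hB]; split; first exact: measurableU.
move=> e e0; have e20 : 0 < e / 2 by rewrite divr_gt0.
have [k1 h1] := hA _ e20; have [k2 h2] := hB _ e20.
exists (maxn k1 k2) => k; rewrite geq_max => /andP[/h1[C hC] /h2[D hD]].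
exists (C :|: D)%SET.
have mC := levset_measurable C; have mD := levset_measurable D.
have mCD := levset_measurable (C :|: D)%SET.
have le1 : pr ((A `|` B) `\` levset (C :|: D)%SET) <=
    pr (A `\` levset C) + pr (B `\` levset D).
  apply: le_trans (prU_le _ _); try exact: measurableD.
  apply: pr_le; try (apply: measurableD => //; exact: measurableU).
    by apply: measurableU; apply: measurableD.
  move=> y [AB]; rewrite /levset /= inE => /negP; rewrite negb_or => /andP[/negP ? /negP ?].
  by case: AB; [left | right].
have le2 : pr (levset (C :|: D)%SET `\` (A `|` B)) <=
    pr (levset C `\` A) + pr (levset D `\` B).
  apply: le_trans (prU_le _ _); try exact: measurableD.
  apply: pr_le; try (apply: measurableD => //; exact: measurableU).
    by apply: measurableU; apply: measurableD.
  move=> y []; rewrite /levset /= inE => /orP[h|h] /not_orP[? ?]; by [left|right].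
lra.
Qed.

(** By continuity from below, a finite union already carries all the mass but [e / 2]. *)
Lemma approx_bigcup (A : nat -> set T) : (forall n, approx (A n)) ->
  approx (\bigcup_n A n).
Proof.
move=> hA; have mA n : measurable (A n) by have [] := hA n.
have mU : measurable (\bigcup_n A n) by apply: bigcupT_measurable.
split=> // e e0; have e20 : 0 < e / 2 by rewrite divr_gt0.
pose F n := \big[setU/set0]_(i < n) A i.
have mF n : measurable (F n) by apply: bigsetU_measurable.
have aF n : approx (F n).
  elim: n => [|n IH]; last by rewrite /F big_ord_recr; apply: approxU.
  rewrite /F big_ord0; split=> // e' e'0; exists 0%N => k _; exists (finset.set0).
  rewrite set0D pr0 add0r (_ : _ `\` _ = set0) ?pr0 ?ltW //.
  by apply/seteqP; split => y //= []; rewrite /levset /= inE.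
have FU n : F n `<=` \bigcup_n A n.
  by move=> y; rewrite /F -bigcup_mkord => -[i _ Ai]; exists i.
have [n hn] : exists n, pr (\bigcup_n A n `\` F n) <= e / 2.
  have c : P \o F @ \oo --> P (\bigcup_n F n).
    apply: nondecreasing_cvg_mu => //; first exact: bigcupT_measurable.
    move=> a b ab; apply/subsetPset => y; rewrite /F -!bigcup_mkord => -[i ia Ai].
    by exists i => //; apply: leq_trans ia ab.
  have UE : \bigcup_n F n = \bigcup_n A n.
    apply/seteqP; split => [y [n _ /FU]//|y [n _ Any]]; exists n.+1 => //.
    by rewrite /F -bigcup_mkord; exists n => /=.
  rewrite UE -prE // in c.
  have {}c : pr (F x) @[x --> \oo] --> pr (\bigcup_n A n) by exact: fine_cvg c.
  have [n _ /(_ n (leqnn n)) /= h] := (cvgrPdist_le _ _).1 c _ e20.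
  exists n; move: h; rewrite -/(pr (F n)) => h.
  have e1 : pr (\bigcup_n A n) = pr (\bigcup_n A n `\` F n) + pr (F n).
    rewrite -prU //; last by rewrite setDE -setIA setICl setI0.
      by rewrite setUC setDUK //; exact: FU.
    exact: measurableD.
  by apply: le_trans h; rewrite e1 addrK ler_norm.
have [k0 hk] := (aF n).2 _ e20; exists k0 => k /hk[B hB]; exists B.
have mB := levset_measurable B.
have le1 : pr (\bigcup_n A n `\` levset B) <=
    pr (\bigcup_n A n `\` F n) + pr (F n `\` levset B).
  apply: le_trans (prU_le _ _); try exact: measurableD.
  apply: pr_le; first exact: measurableD.
    by apply: measurableU; apply: measurableD.
  by move=> y [Uy By]; have [Fy|Fy] := pselect (F n y); [right | left].
have le2 : pr (levset B `\` \bigcup_n A n) <= pr (levset B `\` F n).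
  apply: pr_le; try exact: measurableD.
  by move=> y [By Uy]; split=> // /FU.
lra.
Qed.

Lemma approx_measurable A : measurable A -> approx A.
Proof.
move=> /idx_gen; apply: smallest_sub; last first.
  by move=> _ [j [b ->]]; apply: approx_idx.
split.
- by rewrite -setCT; apply: approxC; split=> // e e0; exists 0%N => k _;
    exists (finset.setTfor _); rewrite (_ : levset _ = setT) ?setDT ?pr0 ?addr0 ?ltW //;
    apply/seteqP; split => y // _; rewrite /levset /= inE.
- by move=> B; rewrite setTD; apply: approxC.
- exact: approx_bigcup.
Qed.

(** Gibbs' inequality with the kernel that bets [1 - th] on the value guessed from the level and
    spreads [th] evenly over all values. A correct guess costs at most [e / 2] by the choice of
    [th], a wrong one at most [L], and [dl] is chosen so that wrong guesses have probability at most
    [e / 2 / (L + 1)]. *)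
Lemma cent_lev_small (I : finType) (xi : T -> I) e : rvar xi -> 0 < e ->
  exists k0, forall k, (k0 <= k)%N -> cent xi (lev k) <= e.
Proof.
move=> mxi e0.
have I0 : (0 < #|I|)%N by apply/card_gt0P; exists (xi point).
pose th : R := 1 - expR (- (e / 2)).
have th1 : th < 1 by rewrite /th gtrBl expR_gt0.
have th0 : 0 < th.
  by rewrite /th subr_gt0 expR_lt1 oppr_lt0 divr_gt0.
pose L := ln (#|I|%:R / th).
have L0 : 0 <= L.
  rewrite /L ln_ge0 // ler_pdivlMr // mul1r; apply: (le_trans (ltW th1)).
  by rewrite ler1n.
pose dl := e / 2 / (L + 1) / #|I|%:R.
have dl0 : 0 < dl.
  by rewrite /dl !divr_gt0 ?ltr0n // ltr_wpDl.
have /choice[K hK] : forall i : I, exists k0, forall k, (k0 <= k)%N ->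
    exists B : {set 'I_(nlev k).+1},
    pr (xi @^-1` [set i] `\` levset B) + pr (levset B `\` xi @^-1` [set i]) <= dl.
  by move=> i; apply: (approx_measurable (mxi i)).2.
exists (\max_i K i)%N => k hk.
have /choice[B hB] : forall i : I, exists B : {set 'I_(nlev k).+1},
    pr (xi @^-1` [set i] `\` levset B) + pr (levset B `\` xi @^-1` [set i]) <= dl.
  by move=> i; apply: hK; apply: leq_trans hk; apply: leq_bigmax.
have mk := @rvar_lev k.
pose guess (q : 'I_(nlev k).+1) : option I := [pick i | q \in B i].
pose kap (q : 'I_(nlev k).+1) (i : I) : R :=
  (1 - th) * (guess q == Some i)%:R + th / #|I|%:R.
have thI : 0 < th / #|I|%:R by rewrite divr_gt0 ?ltr0n.
have kapp q i : 0 < kap q i.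
  by rewrite ltr_wpDl // mulr_ge0 // subr_ge0 ltW.
apply: (le_trans (cent_le_kernel mxi mk (k := kap) _ _ _)).
- by move=> q i; apply: ltW.
- move=> q; rewrite big_split /= -mulr_sumr sumr_const -[(_ / _) *+ _]mulr_natr mulfVK; last first.
    by rewrite pnatr_eq0 -lt0n.
  rewrite -lerBrDr; apply: ler_piMr; first by rewrite subr_ge0 ltW.
  case: (guess q) => [i|]; last by rewrite big1.
  rewrite (bigD1 i) //= eqxx big1 ?addr0 // => i' /negbTE ii'.
  by rewrite (inj_eq Some_inj) eq_sym ii'.
- by move=> i q _.
pose bad : set T := [set y | guess (lev k y) != Some (xi y)].
have badE : bad = (fun y => (xi y, lev k y)) @^-1` [set p | guess p.2 != Some p.1] by [].
have mbad : measurable bad by rewrite badE; apply: rvar_preimage; apply: rvar_pair.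
have bad_le : pr bad <= #|I|%:R * dl.
  rewrite mulr_natl -sumr_const.
  apply: (le_trans (y := pr (\bigcup_i ((xi @^-1` [set i] `\` levset (B i)) `|`
      (levset (B i) `\` xi @^-1` [set i]))))).
    apply: pr_le => //.
      apply: fin_bigcup_measurable => [|i _]; first exact: finite_finset.
      by apply: measurableU; apply: measurableD => //; apply: levset_measurable.
    move=> y; rewrite /bad /= /guess; case: pickP => [i yi|no _].
      move=> /eqP ne; exists i => //; right; split => //= xiy.
      by apply: ne; rewrite xiy.
    by exists (xi y) => //; left; split => //; rewrite /levset /= no.
  apply: (le_trans (pr_bigU_le _)).
    by move=> i; apply: measurableU; apply: measurableD => //; apply: levset_measurable.
  apply: ler_sum => i _; apply: le_trans (hB i); apply: prU_le;
    by apply: measurableD => //; apply: levset_measurable.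
have key : - \sum_i \sum_j law (fun x => (xi x, lev k x)) (i, j) * ln (kap j i) <=
    e / 2 + L * pr bad.
  have -> : e / 2 + L * pr bad = \sum_i \sum_j law (fun x => (xi x, lev k x)) (i, j) *
     (e / 2 + L * (guess j != Some i)%:R).
    under eq_bigr do under eq_bigr do rewrite mulrDr [X in _ + X]mulrCA.
    under eq_bigr do rewrite big_split /= -mulr_suml -mulr_sumr.
    rewrite big_split /= -mulr_suml -mulr_sumr; congr (_ + L * _).
      under eq_bigr do rewrite law_pair_sumr //.
      by rewrite law_sum1 // mul1r.
    have mp := rvar_pair mxi mk.
    have := pr_partition P (fun p => guess p.2 != Some p.1) mp measurableT.
    rewrite setTI badE => <-; rewrite big_mkcond /= sum_pair.
    apply: eq_bigr => i _; apply: eq_bigr => j _ /=.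
    by case: ifP => _; rewrite ?mulr1 ?mulr0 // setTI.
  rewrite -sumrN; apply: ler_sum => i _; rewrite -sumrN; apply: ler_sum => j _.
  rewrite -mulrN ler_wpM2l ?law_ge0 //.
  case: eqP => [gi|gi] /=.
    rewrite mulr0 addr0 lerNl -ler_expR lnK ?posrE // /kap gi eqxx mulr1.
    by rewrite /th opprB addrCA subrr addr0 lerDl ltW.
  rewrite mulr1; apply: (le_trans (y := L)); last by rewrite lerDr divr_ge0 // ltW.
  rewrite /L lerNl -lnV ?posrE ?divr_gt0 ?ltr0n // invf_div ler_ln ?posrE //.
  by rewrite /kap lerDr mulr_ge0 // subr_ge0 ltW.
apply: (le_trans key); rewrite [leRHS]splitr lerD2l; apply: (le_trans (y := L * (#|I|%:R * dl))).
  by rewrite ler_wpM2l.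
rewrite /dl mulrCA mulrC mulrA mulfVK; last by rewrite pnatr_eq0 -lt0n.
rewrite mulrA ler_pdivrMr ?ltr_wpDl // mulrC mulrDr mulr1 lerDl.
by rewrite divr_ge0 ?ltW.
Qed.

Lemma rate_cvg (I : finType) (xi : T -> I) : rvar xi ->
  exists2 l, rate P S xi @ \oo --> l & forall n, l <= rate P S xi n.+1.
Proof.
move=> mxi; have mn n : rvar (name S xi n) by apply: (rvar_name mS).
pose u n := ent (name S xi n).
have u0 n : 0 <= u n by apply: ent_ge0.
have uD n k : u (n + k)%N <= u n + u k by apply: ent_nameD.
exists (inf [set u n.+1 / n.+1%:R | n in setT]); first exact: fekete_cvg.
move=> n; apply: ge_inf; last by exists n.
by exists 0 => _ [k _ <-]; rewrite divr_ge0.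
Qed.

(** Passing from [xi] to the levels costs [e / 3] per symbol by [cent_lev_small]; each level after
    the first costs at most [C + e / 3] by [cent_lev]; and [n] is so large that the first one, [c0],
    amounts to at most [e / 3] per symbol. *)
Lemma rate_le (I : finType) (xi : T -> I) (C l : R) : rvar xi ->
  (forall i, ln (N i)%:R / (ht i + 2)%:R <= C) ->
  (forall n, l <= rate P S xi n.+1) -> l <= C.
Proof.
move=> mxi hC hl; apply/ler_addgt0Pr => e e0.
have e30 : 0 < e / 3 by rewrite divr_gt0.
have [k1 h1] := cent_lev_small mxi e30.
(* With [2 / (ht k + 2) < e / 9], the term [3 / (ht k + 2) * ln 2] of [cent_lev] is below
   [e / 3]. *)
have e40 : 0 < e / 9 by rewrite divr_gt0.
have [k2 _ h2] := (cvgrPdist_lt _ _).1 (@cvg_ht R) _ e40.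
pose k := maxn k1 k2; have {}h1 := h1 k (leq_maxl _ _).
have {h2} := h2 k (leq_maxr _ _); rewrite /= sub0r normrN ger0_norm ?divr_ge0 // => h2.
have mk := @rvar_lev k; pose c0 := ent (name S (lev k) 1).
have c00 : 0 <= c0 by apply: ent_ge0; apply: (rvar_name mS).
pose n := Num.truncn (c0 / (e / 3)).
have hn : c0 <= n.+1%:R * (e / 3).
  rewrite -ler_pdivrMr //; apply/ltW/truncnS_gt.
apply: (le_trans (hl n)); rewrite /rate ler_pdivrMr ?ltr0n //.
have le1 : ent (name S xi n.+1) <= ent (name S (lev k) n.+1) + n.+1%:R * (e / 3).
  apply: (le_trans (y := ent (fun x => (name S xi n.+1 x, name S (lev k) n.+1 x)))).
    apply: ent_determined; first exact: (rvar_name mS).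
      by apply: rvar_pair; apply: (rvar_name mS).
    by move=> x y [].
  have := cent_name mS PS n.+1 mxi mk; rewrite {1}/cent lerBlDl => h.
  by apply: (le_trans h); rewrite lerD2l ler_wpM2l.
have le2 := ent_name_le mS PS n mk.
have le3 : cent (lev k \o S) (lev k) <= C + e / 3.
  apply: (le_trans (cent_lev k)); rewrite addrC; apply: lerD.
    by rewrite mulrC.
  have ln21 : ln 2 <= 1 :> R by have := @ln_sublinear R 2; have := @le_ln1Dx R 1; lra.
  have ln20 : 0 <= ln 2 :> R by rewrite ln_ge0 ?ler1n.
  have -> : 3 / (ht k + 2)%:R = 3 / 2 * (2 / (ht k + 2)%:R) :> R by lra.
  by nra.
have le4 : n%:R * cent (lev k \o S) (lev k) <= n.+1%:R * (C + e / 3).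
  have Ce : 0 <= C + e / 3.
    apply: addr_ge0; last exact: ltW.
    by apply: (le_trans _ (hC 0%N)); rewrite divr_ge0 ?ln_ge0 ?ler1n.
  apply: (le_trans (y := n%:R * (C + e / 3))); first by rewrite ler_wpM2l.
  by rewrite ler_wpM2r // ler_nat.
have -> : (C + e) * n.+1%:R = n.+1%:R * (e / 3) + n.+1%:R * (C + e / 3) + n.+1%:R * (e / 3) by lra.
rewrite -/c0 in le2; lra.
Qed.

Lemma rate_lev_ge k l : rate P S (lev k) @ \oo --> l ->
  ln (N k)%:R / (ht k + 2)%:R <= l.
Proof.
move=> c; apply: (cvg_ge_near (k := 1) c) => n n0.
by rewrite /rate ler_pdivlMr ?ltr0n // mulrC ent_lev_ge.
Qed.

End SystemEntropy.

(** * Smooth functions *)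

Section FlatFunctions.
Local Open Scope classical_set_scope.
Local Open Scope ring_scope.
Context {R : realType}.
Implicit Types (f g : R -> R) (x : R).

Definition smooth1 f := forall k x, derivable (derive1n k f) x 1.

(** A coinduction principle: a class of derivable functions that is stable under derivation consists
    of smooth functions. *)
Lemma smooth1_coind (C : (R -> R) -> Prop) :
  (forall f, C f -> (forall x, derivable f x 1) /\ C (derive1 f)) ->
  forall f, C f -> smooth1 f.
Proof.
move=> h f Cf k; suff [] : (forall x, derivable (derive1n k f) x 1) /\ C (derive1n k f) by [].
suff Ck : C (derive1n k f) by split=> //; have [] := h _ Ck.
by elim: k => // k IH; have [] := h _ IH.
Qed.

Lemma smooth1_derivable f x : smooth1 f -> derivable f x 1.
Proof. exact: (fun h => h 0%N x). Qed.

Lemma smooth1_derive f : smooth1 f -> smooth1 (derive1 f).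
Proof. by move=> h k x; rewrite -derive1Sn; apply: h. Qed.

Lemma smooth1_local f :
  (forall x, exists2 g, smooth1 g & \forall y \near x, f y = g y) -> smooth1 f.
Proof.
move: f; apply: smooth1_coind => f h; split=> x; have [g sg fg] := h x.
  have gf : {near x, g =1 f} by near do apply/esym.
  exact: (near_eq_derivable gf (smooth1_derivable sg)).
exists (derive1 g); first exact: smooth1_derive.
have {}fg := near_join fg; near=> y.
rewrite !derive1E; apply: near_eq_derive; near: y.
exact: fg.
Unshelve. all: by end_near. Qed.

(* The derivatives of [exp (- 1 / x)], extended by [0] on [x <= 0], are linear
   combinations of these functions. *)
Definition flat n (x : R) : R :=
  if 0 < x then x^-1 ^+ n * expR (- x^-1) else 0.

Lemma flat_ge0 n x : 0 <= flat n x.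
Proof.
rewrite /flat; case: ifP => // x0.
by rewrite mulr_ge0 ?expR_ge0 // exprn_ge0 // invr_ge0 ltW.
Qed.

(** At [x^-1], the exponential dominates the term of degree [n + 1] of its series. Applied to
    [n.+1], this controls the difference quotient of [flat n] at [0]. *)
Lemma flat_le n x : 0 < x -> flat n x <= n.+1`!%:R * x.
Proof.
move=> x0; rewrite /flat x0 expRN -[x in leRHS]invrK.
have y0 : 0 < x^-1 by rewrite invr_gt0.
move: (x^-1) y0 => y y0; rewrite ler_pdivrMr ?expR_gt0 // mulrAC ler_pdivlMr //.
rewrite -exprSr mulrC -ler_pdivrMr ?ltr0n ?fact_gt0 //.
by apply: (le_trans _ (expR_ge1Dxn n (ltW y0))); rewrite lerDr.
Qed.

Lemma is_derive_flat n x :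
  is_derive x 1 (flat n) (flat n.+2 x - n%:R * flat n.+1 x).
Proof.
have [x0|x0|->] := ltgtP x 0.
- rewrite /flat ltNge (ltW x0) /= mulr0 subrr.
  have := is_derive_cst (0 : R) x (1 : R); apply: near_eq_is_derive.
  near=> y; rewrite ifF //; apply/negbTE; rewrite -leNgt ltW //.
  by near: y; apply: lt_nbhsl.
- apply: (@near_eq_is_derive R R R (fun z => z^-1 ^+ n * expR (- z^-1))).
    near=> y; rewrite /flat ifT //; near: y; exact: lt_nbhsr.
  have xN0 : x != 0 by rewrite gt_eqF.
  have d1 : is_derive x 1 (fun z : R => z^-1) (- x^-1 ^+ 2).
    apply: is_derive_eq (is_deriveV xN0 (is_derive_id x 1)) _.
    by rewrite exprVn [_ *: _]mulr1.
  have d2 : is_derive x 1 (fun z : R => expR (- z^-1)) (x^-1 ^+ 2 * expR (- x^-1)).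
    have := @is_derive1_comp R expR (fun z => - z^-1) x _ _ (is_derive_expR _) (is_deriveN d1).
    by move=> h; apply: is_derive_eq h _; rewrite opprK mulrC.
  have d3 := @is_deriveX _ _ _ n x 1 _ d1.
  have fE : (fun z : R => z^-1 ^+ n * expR (- z^-1)) =
      (fun z : R => z^-1) ^+ n * (fun z : R => expR (- z^-1)).
    by rewrite exprfctE.
  rewrite fE; apply: is_derive_eq (is_deriveM d3 d2) _; rewrite exprfctE.
  rewrite /flat x0 /= /GRing.scale /=.
  move: (expR _) => E; rewrite !exprS; case: n {d3 fE} => [|n] /=; first by ring.
  by rewrite !exprS; ring.
- have -> : flat n.+2 0 - n%:R * flat n.+1 0 = 0.
    by rewrite /flat ltxx mulr0 subrr.
  have f0 : flat n 0 = 0 by rewrite /flat ltxx.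
  (* The difference quotient at [0] is [flat n.+1] on the right and [0] on the left. *)
  have c : h^-1 *: ((flat n \o shift 0) (h *: 1) - flat n 0) @[h --> 0^'] --> (0 : R).
    apply/cvgrPdist_le => e e0.
    have d0 : 0 < e / n.+2`!%:R by rewrite divr_gt0 // ltr0n fact_gt0.
    near=> h; rewrite sub0r normrN f0 subr0 /= addr0 /GRing.scale /= mulr1.
    have [h0|h0] := ltP 0 h; last first.
      by rewrite /flat ltNge h0 /= mulr0 normr0 ltW.
    have -> : h^-1 * flat n h = flat n.+1 h by rewrite /flat h0 exprS mulrA.
    rewrite ger0_norm ?flat_ge0 //; apply: (le_trans (flat_le _ h0)).
    rewrite mulrC -ler_pdivlMr ?ltr0n ?fact_gt0 //.
    apply: (le_trans (ler_norm _)); near: h; apply: dnbhs0_le => //.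
  apply: DeriveDef; first by apply/cvg_ex; exists 0.
  exact: cvg_lim c.
Unshelve. all: by end_near.
Qed.


Inductive flat_span : (R -> R) -> Prop :=
| flat_span1 n : flat_span (flat n)
| flat_spanD f g : flat_span f -> flat_span g -> flat_span (fun x => f x + g x)
| flat_spanZ c f : flat_span f -> flat_span (fun x => c * f x).

Lemma smooth1_flat n : smooth1 (flat n).
Proof.
apply: (smooth1_coind (C := flat_span)); last exact: flat_span1.
move=> f Cf; suff : exists2 g, flat_span g & forall x, is_derive x 1 f (g x).
  move=> [g Cg fg]; have -> : derive1 f = g.
    by apply/funext => x; rewrite derive1E; case: (fg x).
  by split=> // x; case: (fg x).
elim: Cf => {f} [k|f g _ [f' sf' df] _ [g' sg' dg]|c f _ [f' sf' df]].
- exists (fun x => flat k.+2 x + - k%:R * flat k.+1 x).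
    by apply: flat_spanD; [exact: flat_span1 | apply: flat_spanZ; exact: flat_span1].
  by move=> x; rewrite mulNr; apply: is_derive_flat.
- by exists (fun x => f' x + g' x); [exact: flat_spanD | move=> x; apply: is_deriveD].
- by exists (fun x => c * f' x); [exact: flat_spanZ | move=> x; apply: is_deriveZ].
Qed.

End FlatFunctions.


(** * Smooth functions on a normed space, as expressions *)

Section SmoothMaps.
Local Open Scope classical_set_scope.
Local Open Scope ring_scope.
Context {R : realType} {V : normedModType R}.

(** The derivative of such an expression in a fixed direction is again such an expression, so that
    [Ck_on] follows for all of them at once by induction on the order. *)
Inductive smoothf : (V -> R) -> Prop :=
| smoothf_cst c : smoothf (fun=> c)
| smoothf_lin (l : {linear V -> R}) : continuous l -> smoothf l
| smoothf_add f g : smoothf f -> smoothf g -> smoothf (fun x => f x + g x)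
| smoothf_mul f g : smoothf f -> smoothf g -> smoothf (fun x => f x * g x)
| smoothf_comp g u : smooth1 g -> smoothf u -> smoothf (fun x => g (u x)).

Lemma smoothf_sum n (F : nat -> V -> R) : (forall i, smoothf (F i)) ->
  smoothf (fun x => \sum_(i < n) F i x).
Proof.
move=> sF; elim: n => [|n IH].
  by under eq_fun do rewrite big_ord0; exact: smoothf_cst.
by under eq_fun do rewrite big_ord_recr; exact: smoothf_add.
Qed.

Lemma smoothf_diff f : smoothf f -> exists2 D : V -> V -> R,
  forall v, smoothf (D v) & forall x, is_diff x f (fun v => D v x).
Proof.
elim=> {f} [c|l cl|f g _ [D sD dD] _ [E sE dE]|f g sf [D sD dD] sg [E sE dE]|g u sg su [D sD dD]].
- exists (fun _ _ => 0) => [v|x]; first exact: smoothf_cst.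
  exact: is_diff_cst.
- exists (fun v _ => l v) => [v|x]; first exact: smoothf_cst.
  apply: DiffDef; first exact: linear_differentiable.
  by rewrite diff_lin.
- exists (fun v x => D v x + E v x) => [v|x]; first exact: smoothf_add.
  exact: is_diffD.
- exists (fun v x => f x * E v x + g x * D v x) => [v|x].
    by apply: smoothf_add; apply: smoothf_mul.
  exact: is_diffM.
- exists (fun v x => D v x * derive1 g (u x)) => [v|x].
    by apply: smoothf_mul => //; apply: smoothf_comp => //; apply: smooth1_derive.
  have dg : is_diff (u x) g (fun h => h * derive1 g (u x)).
    have h : derivable g (u x) 1 := smooth1_derivable sg.
    by apply: DiffDef; [exact/derivable1_diffP | rewrite (deriv1E h)].
  exact: is_diff_comp.
Qed.

Lemma smoothf_smooth_on (A : set V) f : smoothf f -> smooth_on (W := R) A f.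
Proof.
move=> sf k; elim: k f sf => [|k IH] f sf /=; have [D sD dD] := smoothf_diff sf.
  by move=> x _; apply: differentiable_continuous; have [] := dD x.
split=> [x _|v]; first by have [] := dD x.
apply: IH; rewrite (_ : (fun x => _) = D v) //.
by apply/funext => x; rewrite diff_val.
Qed.

End SmoothMaps.

(** * Plateau functions on the line *)

Section SmoothLine.
Local Open Scope classical_set_scope.
Local Open Scope ring_scope.
Context {R : realType}.

Lemma smoothf1 (f : R -> R) : smoothf f -> smooth1 f.
Proof.
move: f; apply: smooth1_coind => f sf; have [D sD dD] := smoothf_diff sf.
have df x : differentiable f x by have [] := dD x.
split=> [x|]; first exact/derivable1_diffP.
rewrite (_ : derive1 f = D 1) //; apply/funext => x.
by rewrite derive1E' // diff_val.
Qed.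

Lemma smoothf_id : smoothf (fun x : R => x).
Proof.
apply: (@smoothf_lin R R (@idfun R)) => x; exact: cvg_id.
Qed.

Lemma smooth1_smoothf (f : R -> R) : smooth1 f -> smoothf f.
Proof. by move=> sf; apply: (@smoothf_comp R R f (fun x => x) sf smoothf_id). Qed.

(** It is [1] on [[a - w / 2, b + w / 2]], where the inner sum vanishes, and [0] outside []a - w, b
    + w[], where the inner sum is at least [flat 0 (w / 2)] and the outer [flat 0] receives a
    nonpositive number. *)
Definition bump (a b w x : R) : R :=
  flat 0 (1 - (flat 0 (x - b - w / 2) + flat 0 (a - w / 2 - x)) / flat 0 (w / 2))
  / flat 0 1.

Lemma smooth1_bump a b w : smooth1 (bump a b w).
Proof.
apply: smoothf1; apply: smoothf_mul; last exact: smoothf_cst.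
have sB f c : smoothf f -> smoothf (fun x : R => f x - c).
  by move=> sf; apply: smoothf_add => //; apply: smoothf_cst.
have sN f : smoothf f -> smoothf (fun x : R => - f x).
  move=> sf; rewrite (_ : (fun x => _) = (fun x => -1 * f x)); last first.
    by apply/funext => x; rewrite mulN1r.
  by apply: smoothf_mul => //; apply: smoothf_cst.
have sF (f : R -> R) : smoothf f -> smoothf (fun x : R => flat 0 (f x)).
  by move=> sf; apply: smoothf_comp => //; apply: smooth1_flat.
apply: (sF (fun x => 1 - _)); apply: smoothf_add; first exact: smoothf_cst.
apply: (sN); apply: smoothf_mul; last exact: smoothf_cst.
apply: smoothf_add.
  by apply: (sF (fun x => x - b - w / 2)); do 2!apply: (sB); exact: smoothf_id.
apply: (sF (fun x => a - w / 2 - x)); apply: smoothf_add; first exact: smoothf_cst.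
by apply: (sN); exact: smoothf_id.
Qed.

Lemma flat_le0 n (x : R) : x <= 0 -> flat n x = 0.
Proof. by move=> x0; rewrite /flat ltNge x0. Qed.

Lemma flat0_gt0 (x : R) : 0 < x -> 0 < flat 0 x.
Proof. by move=> x0; rewrite /flat x0 mul1r expR_gt0. Qed.

Lemma flat0_mono (x y : R) : 0 < x -> x <= y -> flat 0 x <= flat 0 y.
Proof.
move=> x0 xy; have y0 := lt_le_trans x0 xy.
by rewrite /flat x0 y0 !mul1r ler_expR lerN2 lef_pV2.
Qed.

Lemma bump1 a b w x : a - w / 2 <= x <= b + w / 2 -> bump a b w x = 1.
Proof.
move=> /andP[ax xb]; rewrite /bump (@flat_le0 0 (x - b - _)); last by lra.
rewrite (@flat_le0 0 (a - _ - x)); last by lra.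
by rewrite addr0 mul0r subr0 divff // gt_eqF // flat0_gt0.
Qed.

Lemma bump0 a b w x : 0 < w -> (x <= a - w) || (b + w <= x) -> bump a b w x = 0.
Proof.
move=> w0 h; have w20 : 0 < w / 2 by rewrite divr_gt0.
have f0 := flat0_gt0 w20.
rewrite /bump flat_le0 ?mul0r // subr_le0 ler_pdivlMr // mul1r.
case/orP: h => h; [apply: ler_wpDl | apply: ler_wpDr]; rewrite ?flat_ge0 //;
  apply: flat0_mono => //; lra.
Qed.

End SmoothLine.

(** * The forcing term of the standard map *)

Section ForcingTerm.
Local Open Scope classical_set_scope.
Local Open Scope ring_scope.
Context {R : realType}.
Variables N m : nat -> nat.
Hypothesis N0 : forall j, (0 < N j)%N.
Hypothesis m0 : forall j, (0 < m j)%N.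
Hypothesis NS : forall j, (N j.+1 = N j * N j * m j)%N.
Local Notation nlev := (nlev N).
Local Notation ncell := (ncell N).
Local Notation cuts := (cuts N m).
Local Notation width := (@width R N).
Local Notation idx := (@idx R N).
Local Notation gap := (@gap R N).
Local Notation stage := (stage N0).
Local Notation spread := (spread N).
Local Notation place := (place N0).
Local Notation mv := (@mv R N m N0).

Definition corner j b : R := b%:R / width j.

Lemma corner_itv j b : (b < ncell j)%N -> 0 <= corner j b < 1.
Proof.
move=> bn; have w0 := @width_gt0 R N N0 j.
rewrite /corner ltr_pdivrMr // mul1r ltr_nat bn andbT.
by apply: divr_ge0 => //; apply: ltW.
Qed.

Lemma idx_corner j b : (b < ncell j)%N -> idx j (corner j b) = b.
Proof.
move=> bn; have w0 := @width_gt0 R N N0 j.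
apply: idx_def; rewrite clip_id ?corner_itv // /corner mulrC divfK ?gt_eqF //.
by rewrite lexx ltr_nat ltnSn.
Qed.

Lemma spread_mono (y z : R) : clip y <= clip z -> spread y <= spread z.
Proof.
move=> yz; rewrite -subr_ge0.
apply: (cvg_ge_near (k := 0) (cvgB (@cvg_spread R N N0 z) (@cvg_spread R N N0 y))) => n _.
rewrite !fctE subr_ge0; apply: ler_sum => i _.
by rewrite ler_wpM2l ?gap_ge0 // ler_nat le_truncn // ler_wpM2l // ltW ?width_gt0.
Qed.

(** The value required of [phi] at [place y], written as two increments so that [place_mv] applies
    to each. *)
Definition kick (y : R) : R := (place (mv true y) - place y) + (place (mv false y) - place y).

Lemma kick_const y z : idx (stage y).+1 y = idx (stage y).+1 z -> kick y = kick z.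
Proof.
move=> e; rewrite /kick; congr (_ + _); by apply: (place_mv N0 m0 NS (free_stage N0 m0 NS _ _) e).
Qed.

(** [[low j b, high j b]] contains the places of the points of stage [j] lying in the cell [b] of
    stage [j.+1]; the jump of [spread] separates it from the next such interval by [gap j.+1]. *)
Definition low j b : R := j%:R + 4^-1 + spread (corner j.+1 b).
Definition high j b : R := low j b.+1 - gap j.+1.

(** Each bump is [1] up to a distance [gap j.+1 / 4] of its interval and vanishes from
    [gap j.+1 / 2] on. As the intervals are [gap j.+1] apart, no bump reaches the plateau of
    another. *)
Definition layer j (x : R) : R := \sum_(b < nlev j * cuts j)
  kick (corner j.+1 b) * bump (low j b) (high j b) (gap j.+1 / 2) x.

Lemma sub_ncell j b : (b <= nlev j * cuts j)%N -> (b < ncell j.+1)%N.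
Proof.
move=> h; rewrite -nlev_ncell (nlevS NS); have := N0 j.+1; lia.
Qed.

Lemma gap_le j : gap j.+1 <= 16^-1.
Proof.
have w1 : 1 <= width j.+1 by rewrite ler1n ncell_gt0.
rewrite /gap lef_pV2 ?posrE ?mulr_gt0 ?exprn_gt0 ?width_gt0 //.
apply: (le_trans (y := 2 ^+ (j.+1 + 3))); last by rewrite ler_peMl ?exprn_ge0.
have -> : 16 = 2 ^+ 4 :> R by ring.
by rewrite ler_weXn2l ?ler1n //; lia.
Qed.

Lemma low_itv j b : j%:R + 4^-1 <= low j b <= j%:R + 2^-1.
Proof.
rewrite /low; have := spread_ge0 N0 (corner j.+1 b).
by have := spread_le N0 (corner j.+1 b); lra.
Qed.

Lemma high_low j b c : (b < c)%N -> (c <= nlev j * cuts j)%N ->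
  high j b + gap j.+1 <= low j c.
Proof.
move=> bc cn; rewrite /high subrK /low lerD2l; apply: spread_mono.
rewrite !clip_id ?corner_itv ?sub_ncell //; last exact: leq_trans cn.
by rewrite ler_pM2r ?invr_gt0 ?width_gt0 // ler_nat.
Qed.

Lemma layer0 j x : (x <= j%:R) || (j%:R + 1 <= x) -> layer j x = 0.
Proof.
move=> h; apply: big1 => b _; have g0 := @gap_gt0 R N N0 j.+1.
have := low_itv j b; have := low_itv j b.+1; have := gap_le j.
by move=> ? ? ?; rewrite bump0 ?mulr0 ?divr_gt0 // /high; case/orP: h => ?;
  apply/orP; [left | right]; lra.
Qed.

Lemma layer_const j b x : (b < nlev j * cuts j)%N ->
  low j b - gap j.+1 / 4 <= x <= high j b + gap j.+1 / 4 ->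
  layer j x = kick (corner j.+1 b).
Proof.
move=> bn xb; have g0 := @gap_gt0 R N N0 j.+1.
rewrite /layer (bigD1 (Ordinal bn)) //= bump1 ?mulr1; last by lra.
rewrite big1 ?addr0 // => c; rewrite -val_eqE /= neq_ltn => /orP[cb|bc].
  rewrite bump0 ?mulr0 ?divr_gt0 //; apply/orP; right.
  by have := high_low cb (ltnW bn); lra.
rewrite bump0 ?mulr0 ?divr_gt0 //; apply/orP; left.
by have := high_low bc (ltnW (ltn_ord c)); lra.
Qed.

Lemma smooth1_layer j : smooth1 (layer j).
Proof.
apply: smoothf1; rewrite /layer.
apply: (smoothf_sum _ (F := fun b x => kick (corner j.+1 b) *
  bump (low j b) (high j b) (gap j.+1 / 2) x)) => b.
apply: smoothf_mul; first exact: smoothf_cst.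
exact/smooth1_smoothf/smooth1_bump.
Qed.

Definition forcing (x : R) : R := \sum_(j < (Num.truncn x).+1) layer j x.

(** The additional layers live on unit intervals to the right of [z] and vanish there. With a fixed
    number of terms near [x], smoothness passes from the layers to [forcing]. *)
Lemma forcing_near (x z : R) n : (Num.truncn x < n)%N -> z < n%:R ->
  forcing z = \sum_(j < n) layer j z.
Proof.
move=> xn zn; rewrite /forcing.
have zn' : ((Num.truncn z).+1 <= n)%N.
  have [z0|z0] := leP 0 z; first by rewrite truncn_lt_nat.
  rewrite (_ : Num.truncn z = 0%N) ?(leq_ltn_trans _ xn) //.
  by rewrite truncn_floor leNgt z0.
rewrite -(subnKC zn') big_split_ord /= [X in _ = _ + X]big1 ?addr0 // => i _.
rewrite layer0 //; apply/orP; left; apply/ltW; apply: (lt_le_trans (truncnS_gt z)).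
by rewrite ler_nat leq_addr.
Qed.

Lemma smooth1_forcing : smooth1 forcing.
Proof.
apply: smooth1_local => x; pose n := (Num.truncn x).+1.
exists (fun z => \sum_(j < n) layer j z).
  apply: smoothf1; apply: (smoothf_sum n (F := layer)) => j.
  exact/smooth1_smoothf/smooth1_layer.
near=> z; apply: forcing_near; first exact: ltnSn.
by near: z; apply: lt_nbhsl; apply: truncnS_gt.
Unshelve. all: by end_near. Qed.

(** The place of [y] lies between [low j b] and [high j b], and the plateau of the corresponding
    bump extends beyond both ends; the earlier layers vanish there. *)
Lemma forcing_place y : \forall x \near place y, forcing x = kick y.
Proof.
set j := stage y; set b := idx j.+1 y.
have bn : (b < nlev j * cuts j)%N by apply: lvlS => //; apply: stageP.
have g0 := @gap_gt0 R N N0 j.+1; have gl := gap_le j.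
have ib : idx j.+1 (corner j.+1 b) = b by rewrite idx_corner // sub_ncell // ltnW.
have lo : low j b <= place y.
  rewrite /low /place lerD2l; apply: spread_mono.
  rewrite clip_id ?corner_itv ?sub_ncell 1?ltnW // /corner ler_pdivrMr ?width_gt0 //.
  by rewrite mulrC; case/andP: (idx_itv N j.+1 y).
have hi : place y <= high j b.
  rewrite /high /low /place -/j lerBrDr -addrA lerD2l.
  by apply: (spread_sep N0 (j := j.+1)); rewrite idx_corner // sub_ncell.
have := low_itv j b; have := low_itv j b.+1 => hb1 hb.
have -> : kick y = kick (corner j.+1 b) by apply: kick_const; rewrite -/j ib.
near=> x; have xl : low j b - gap j.+1 / 4 < x.
  by near: x; apply: lt_nbhsr; lra.
have xh : x < high j b + gap j.+1 / 4.
  by near: x; apply: lt_nbhsl; lra.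
have xj : j%:R < x < j.+1%:R by move: xh; rewrite -(natr1 j) /high => ?; lra.
rewrite (@forcing_near x x j.+1) //; last 2 first.
- have j0 : 0 <= j%:R :> R by exact: ler0n.
  by rewrite truncn_lt_nat; lra.
- by case/andP: xj.
rewrite big_ord_recr /= big1 ?add0r => [|i _].
  by apply: layer_const => //; rewrite !ltW.
rewrite layer0 //; apply/orP; right; apply: (le_trans (y := j%:R)); last by lra.
by rewrite natr1 ler_nat.
Unshelve. all: by end_near. Qed.

Lemma forcing_placeE y : forcing (place y) = kick y.
Proof. exact: nbhs_singleton (forcing_place y). Qed.

Lemma derive1_forcing y : derive1 forcing (place y) = 0.
Proof.
rewrite derive1E (near_eq_derive _ (g := fun=> kick y)); last exact: forcing_place.
exact: derive_cst.
Qed.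

End ForcingTerm.

(** * The standard map on the plane *)

Section Plane.
Local Open Scope classical_set_scope.
Local Open Scope ring_scope.
Context {R : realType}.
Local Notation V := 'rV[R]_2.

Definition vec (a b : R) : V := \row_i (if i == 0 then a else b).

Lemma vec0 a b : vec a b 0 0 = a. Proof. by rewrite mxE. Qed.
Lemma vec1 a b : vec a b 0 1 = b. Proof. by rewrite mxE. Qed.

Lemma vec_eta (p : V) : p = vec (p 0 0) (p 0 1).
Proof.
apply/rowP => i; rewrite mxE; have [->//|i0] := eqVneq i 0.
by congr (p 0 _); apply: val_inj; case: i i0 => -[|[|]].
Qed.

Lemma vecE a b : vec a b = a *: vec 1 0 + b *: vec 0 1.
Proof.
by apply/rowP => i; rewrite !mxE; case: eqP => _; rewrite ?mulr1 ?mulr0 ?addr0 ?add0r.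
Qed.

Lemma smoothf_coord i : smoothf (fun p : V => p 0 i).
Proof.
have @f : {linear V -> R}.
  by exists (fun p : V => p 0 i); do 2![eexists]; do ?[constructor];
     rewrite ?mxE// => ? *; rewrite ?mxE//; move=> ?; rewrite !mxE.
have : smoothf f by apply: smoothf_lin; exact: coord_continuous.
by [].
Qed.

Lemma is_diff_vec (x : V) (a b da db : V -> R) :
  is_diff x a da -> is_diff x b db ->
  is_diff x (fun p => vec (a p) (b p)) (fun v => vec (da v) (db v)).
Proof.
move=> ha hb; have hz (k dk : V -> R) (e : V) : is_diff x k dk ->
    is_diff x (fun p => k p *: e) (fun v => dk v *: e).
  move=> hk; have dk' : differentiable k x by [].
  apply: DiffDef; first exact: differentiableZl.
  by rewrite diffZl // diff_val.
under eq_fun do rewrite vecE.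
under [X in is_diff _ _ X]eq_fun do rewrite vecE.
by apply: is_diffD; apply: hz.
Qed.

Lemma smooth_on_vec (A : set V) (a b : V -> R) :
  smoothf a -> smoothf b -> smooth_on A (fun p => vec (a p) (b p)).
Proof.
move=> sa sb k; elim: k a b sa sb => [|k IH] a b sa sb /=;
  have [D sD dD] := smoothf_diff sa; have [E sE dE] := smoothf_diff sb;
  have dab x := is_diff_vec (dD x) (dE x).
  by move=> x _; apply: differentiable_continuous; have [] := dab x.
split=> [x _|v]; first by have [] := dab x.
rewrite (_ : (fun x => _) = (fun x => vec (D v x) (E v x))); first exact: IH.
by apply/funext => x; have [_ ->] := dab x.
Qed.

Lemma continuous_vec (a b : V -> R) :
  smoothf a -> smoothf b -> continuous (fun p => vec (a p) (b p)).
Proof. by move=> sa sb x; apply: (smooth_on_vec setT sa sb 0). Qed.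

Lemma plane_second_countable : @second_countable V.
Proof.
pose U (c : 'rV[rat]_2 * nat) : set V := ball (map_mx (@ratr R) c.1 : V) (c.2.+1%:R^-1 : R).
exists (range U); first exact: (card_le_trans (card_image_le _ _) (countableP _)).
split=> [_ [c _ <-]|x A /nbhs_ballP[e /= e0 eA]].
  by apply: ball_open; rewrite invr_gt0.
pose n := Num.truncn (2 / e); pose d : R := n.+1%:R^-1.
have d0 : 0 < d by rewrite invr_gt0.
have de : d + d <= e.
  suff : d <= e / 2 by lra.
  rewrite /d -[leRHS]invrK lef_pV2 ?posrE ?invr_gt0 ?divr_gt0 // invf_div.
  exact/ltW/truncnS_gt.
have /choice[q hq] : forall i : 'I_2, exists q : rat, `|ratr q - x 0 i| < d.
  move=> i; have /rat_in_itvoo[q] : x 0 i - d < x 0 i + d by lra.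
  by rewrite in_itv /= => h; exists q; rewrite ltr_norml; lra.
have xq : U (\row_i q i, n) x.
  by split=> // i j; rewrite !mxE ord1; apply: hq.
exists (U (\row_i q i, n)); first by split => //; exists (\row_i q i, n).
move=> y qy; apply: eA; apply: (le_ball de); apply: (ball_triangle _ qy).
exact: ball_sym.
Qed.

(** A single global chart, the identity. The structures on the plane are transparent, so that
    [tdiff] and [of_coord] reduce to differentials in the plane. *)
Definition plane_chart : chart R 2 V.
Proof.
refine (@Chart R 2 V setT id id openT _ _ _ _) => //.
- by rewrite image_id; exact: openT.
- by move=> x _; exact: cvg_id.
- by move=> x _; exact: cvg_id.
Defined.

Definition plane : smooth_manifold R 2.
Proof.
refine (@SmoothManifold R 2 V [set plane_chart] (fun=> plane_chart) _ _ _ _ _) => //.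
- exact: plane_second_countable.
- move=> c d -> -> /=.
  rewrite (_ : id \o id = (fun p : V => vec (p 0 0) (p 0 1))).
    by apply: smooth_on_vec; apply: smoothf_coord.
  by apply/funext => p; apply: vec_eta.
Defined.

Lemma plane_noncompact : ~ compact [set: plane].
Proof.
move=> c; have cc : compact ((fun p : V => p 0 0) @` [set: V]).
  by apply: continuous_compact c; apply: continuous_subspaceT; exact: coord_continuous.
have [M [_ hM]] := @compact_bounded R R _ cc.
have : `| (`|M| + 2) | <= `|M| + 1.
  apply: (hM (`|M| + 1)); first by apply: (le_lt_trans (ler_norm M)); rewrite ltrDl.
  by exists (vec (`|M| + 2) 0) => //; rewrite vec0.
by rewrite ger0_norm ?addr_ge0 //; lra.
Qed.

Definition flat_inner (x : plane) (u v : tangent x) : R :=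
  u 0 0 * v 0 0 + u 0 1 * v 0 1.

Definition flat_metric : riemannian_metric plane.
Proof.
refine (@RiemannianMetric R 2 plane flat_inner _ _ _ _).
- by move=> x a u v w; rewrite /flat_inner !mxE; ring.
- by move=> x v w; rewrite /flat_inner; ring.
- move=> x v v0; rewrite /flat_inner -!expr2 lt_neqAle addr_ge0 ?sqr_ge0 // andbT.
  rewrite eq_sym; apply: contra v0; rewrite paddr_eq0 ?sqr_ge0 // !sqrf_eq0.
  move=> /andP[/eqP v00 /eqP v01]; apply/eqP.
  by rewrite [v]vec_eta v00 v01; apply/rowP => i; rewrite !mxE; case: ifP.
- move=> c -> v w.
  rewrite (_ : (fun y => _) = (fun=> v 0 0 * w 0 0 + v 0 1 * w 0 1)).
    exact: (smoothf_smooth_on _ (smoothf_cst _)).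
  apply/funext => y; rewrite /flat_inner /of_coord /=.
  have dE u : 'd (id \o id) y u = u :> V.
    by have [_ ->] := is_diff_id y.
  by rewrite !dE.
Defined.

End Plane.

(** * Standard maps: differentials and Lyapunov exponents *)

Section StandardMap.
Local Open Scope classical_set_scope.
Local Open Scope ring_scope.
Context {R : realType}.
Local Notation V := 'rV[R]_2.
Variable phi : R -> R.
Hypothesis sphi : smooth1 phi.

Definition smap (p : V) : V :=
  vec (p 0 0 + p 0 1) (p 0 1 + phi (p 0 0 + p 0 1)).
Definition smapV (p : V) : V :=
  vec (p 0 0 - (p 0 1 - phi (p 0 0))) (p 0 1 - phi (p 0 0)).

Lemma smapK : cancel smap smapV.
Proof.
move=> p; rewrite {1}[p in RHS]vec_eta /smapV /smap !vec0 !vec1.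
by congr vec; ring.
Qed.

Lemma smapVK : cancel smapV smap.
Proof.
move=> p; rewrite {1}[p in RHS]vec_eta /smapV /smap !vec0 !vec1 subrK.
by congr vec; ring.
Qed.

Lemma smoothfN (u : V -> R) : smoothf u -> smoothf (fun x => - u x).
Proof.
move=> su; under eq_fun do rewrite -mulN1r.
by apply: smoothf_mul => //; apply: smoothf_cst.
Qed.

Lemma smoothf_shear1 : smoothf (fun p : V => p 0 0 + p 0 1).
Proof. by apply: smoothf_add; apply: smoothf_coord. Qed.

Lemma smoothf_shear2 : smoothf (fun p : V => p 0 1 + phi (p 0 0 + p 0 1)).
Proof.
apply: smoothf_add; first exact: smoothf_coord.
exact: (smoothf_comp sphi smoothf_shear1).
Qed.

Lemma smoothf_shearV2 : smoothf (fun p : V => p 0 1 - phi (p 0 0)).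
Proof.
apply: smoothf_add; first exact: smoothf_coord.
apply: smoothfN; exact: (smoothf_comp sphi (smoothf_coord 0)).
Qed.

Lemma smoothf_shearV1 : smoothf (fun p : V => p 0 0 - (p 0 1 - phi (p 0 0))).
Proof.
apply: smoothf_add; first exact: smoothf_coord.
exact: (smoothfN smoothf_shearV2).
Qed.

Definition standard_map : diffeomorphism (@plane R).
Proof.
refine (@Diffeomorphism R 2 plane smap smapV smapK smapVK _ _).
- split; first exact: (continuous_vec smoothf_shear1 smoothf_shear2).
  by move=> c d -> ->; exact: (smooth_on_vec _ smoothf_shear1 smoothf_shear2).
- split; first exact: (continuous_vec smoothf_shearV1 smoothf_shearV2).
  by move=> c d -> ->; exact: (smooth_on_vec _ smoothf_shearV1 smoothf_shearV2).
Defined.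

Lemma is_diff_coord (x : V) i : is_diff x (fun p : V => p 0 i : R) (fun p => p 0 i).
Proof.
have @f : {linear V -> R}.
  by exists (fun p : V => p 0 i); do 2![eexists]; do ?[constructor];
     rewrite ?mxE// => ? *; rewrite ?mxE//; move=> ?; rewrite !mxE.
have cf : continuous f by exact: coord_continuous.
have h : is_diff x f f.
  by apply: DiffDef; [exact: linear_differentiable | rewrite diff_lin].
exact: h.
Qed.

Lemma is_diff_phi (x : V) (u du : V -> R) : is_diff x u du ->
  derive1 phi (u x) = 0 -> is_diff x (fun p => phi (u p)) (fun=> 0).
Proof.
move=> hu h0; have d0 : derivable phi (u x) 1 := smooth1_derivable sphi.
have dp : is_diff (u x) phi (fun=> 0).
  apply: DiffDef; first exact/derivable1_diffP.
  by rewrite (deriv1E d0) h0; apply/funext => h; rewrite /= scaler0.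
exact: (is_diff_comp hu dp).
Qed.

Definition unip (v : V) : V := vec (v 0 0 + v 0 1) (v 0 1).
Definition unipV (v : V) : V := vec (v 0 0 - v 0 1) (v 0 1).

Lemma is_diff_smap (x : V) : derive1 phi (x 0 0 + x 0 1) = 0 -> is_diff x smap unip.
Proof.
move=> h; have d1 := is_diffD (is_diff_coord x 0) (is_diff_coord x 1).
have d2 := is_diff_phi d1 h.
apply: (is_diff_eq (is_diff_vec d1 (is_diffD (is_diff_coord x 1) d2))).
by apply/funext => v; rewrite /unip !fctE addr0.
Qed.

Lemma is_diff_smapV (x : V) : derive1 phi (x 0 0) = 0 -> is_diff x smapV unipV.
Proof.
move=> h; have d2 := is_diffB (is_diff_coord x 1) (is_diff_phi (is_diff_coord x 0) h).
apply: (is_diff_eq (is_diff_vec (is_diffB (is_diff_coord x 0) d2) d2)).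
by apply/funext => v; rewrite /unipV !fctE subr0.
Qed.

Lemma iter_unip k v : iter k unip v = vec (v 0 0 + k%:R * v 0 1) (v 0 1).
Proof.
elim: k => [|k IH]; first by rewrite mul0r addr0 -vec_eta.
by rewrite iterS IH /unip !vec0 !vec1 -natr1; congr vec; ring.
Qed.

Lemma iter_unipV k v : iter k unipV v = vec (v 0 0 - k%:R * v 0 1) (v 0 1).
Proof.
elim: k => [|k IH]; first by rewrite mul0r subr0 -vec_eta.
by rewrite iterS IH /unipV !vec0 !vec1 -natr1; congr vec; ring.
Qed.

(** The orbit, in both directions, only evaluates [phi] at its critical points: [smap] evaluates it
    at the new first coordinate, [smapV] at the old one. *)
Definition tame (p : V) := forall k,
  derive1 phi (iter k smap p 0 0 + iter k smap p 0 1) = 0 /\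
  derive1 phi (iter k smapV p 0 0) = 0.

Lemma is_diff_iter (F : V -> V) (L : V -> V) p : (forall k, is_diff (iter k F p) F L) ->
  forall k, is_diff p (iter k F) (iter k L).
Proof.
move=> h; elim=> [|k IH]; first exact: is_diff_id.
exact: (is_diff_comp IH (h k)).
Qed.

(** Applying [ln z <= z] to [z = dl * s k] gives [ln (s k) <= dl * s k - ln dl]; the choice
    [dl = e / (4 * C)] makes the linear term at most [e / 2 * k]. *)
Lemma ln_growth_cvg (s : nat -> R) c C : 0 < c ->
  (forall k, c <= s k <= C * (k.+1)%:R) ->
  (fun k => ln (s k) / k%:R) @ \oo --> (0 : R).
Proof.
move=> c0 hs; have s0 k : 0 < s k by apply: (lt_le_trans c0); case/andP: (hs k).
have C0 : 0 < C.
  have /andP[_ h] := hs 0%N; rewrite mulr1 in h; exact: lt_le_trans h.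
apply/cvgrPdist_le => e e0; pose dl := e / (4 * C).
have dl0 : 0 < dl by rewrite divr_gt0 ?mulr_gt0.
pose B := `|ln c| + `|ln dl|.
near=> k; have k0 : 0 < k%:R :> R by rewrite ltr0n; near: k; exists 1%N.
have k1 : 1 <= k%:R :> R by rewrite ler1n -(ltr0n R).
rewrite sub0r normrN normrM normfV [`|k%:R|]ger0_norm // ler_pdivrMr //.
have hB : B <= e / 2 * k%:R.
  rewrite mulrC -ler_pdivrMr ?divr_gt0 //; near: k; exact: nbhs_infty_ger.
have lo : ln c <= ln (s k) by rewrite ler_ln ?posrE //; case/andP: (hs k).
have hi : ln (s k) <= dl * s k - ln dl.
  rewrite lerBrDr -lnM ?posrE // mulrC; apply/ltW/ln_sublinear.
  by rewrite mulr_gt0.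
have sk : dl * s k <= e / 2 * k%:R.
  apply: (le_trans (y := dl * (C * k.+1%:R))).
    by rewrite ler_pM2l //; case/andP: (hs k).
  rewrite /dl -(natr1 k).
  have -> : e / (4 * C) * (C * (k%:R + 1)) = e / 4 * (k%:R + 1).
    by field; rewrite gt_eqF.
  nra.
rewrite ler_norml; have := ler_norm (ln dl); have := ler_norm (- ln dl).
have := ler_norm (- ln c); have := normr_ge0 (ln dl); have := normr_ge0 (ln c).
rewrite !normrN => h1 h2 h3 h4 h5; rewrite /B in hB.
have ek : e * k%:R = e / 2 * k%:R + e / 2 * k%:R by rewrite -mulrDl -splitr.
by apply/andP; split; lra.
Unshelve. all: by end_near. Qed.

(** These are the norms of the images of [v] by the powers of the unipotent matrix, or of its
    inverse when [s] holds. The lower bound is the second coordinate, which is preserved, unless it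
    is zero and [v] is fixed. *)
Lemma sqrt_growth (v : V) (s : bool) : v != 0 -> exists c C : R, 0 < c /\
  forall k, c <= Num.sqrt ((v 0 0 + (-1) ^+ s * k%:R * v 0 1) ^+ 2 + v 0 1 ^+ 2) <= C * k.+1%:R.
Proof.
move=> v0; pose c := if v 0 1 == 0 then `|v 0 0| else `|v 0 1|.
exists c, (`|v 0 0| + 2 * `|v 0 1|); split.
  rewrite /c; case: eqP => [v1|/eqP v1]; last by rewrite normr_gt0.
  rewrite normr_gt0; apply: contra v0 => /eqP v00.
  by rewrite [v]vec_eta v1 v00; apply/eqP/rowP => i; rewrite !mxE; case: ifP.
move=> k; apply/andP; split.
  rewrite /c; case: eqP => [->|_].
    by rewrite mulr0 addr0 expr0n addr0 sqrtr_sqr.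
  by rewrite -sqrtr_sqr ler_wsqrtr // lerDr sqr_ge0.
have C0 : 0 <= (`|v 0 0| + 2 * `|v 0 1|) * k.+1%:R.
  by rewrite mulr_ge0 // addr_ge0 // mulr_ge0.
rewrite -[leRHS]ger0_norm // -sqrtr_sqr ler_wsqrtr //.
have k0 : 0 <= k%:R :> R by [].
set x := v 0 0; set y := v 0 1 in C0 *.
have nx : `|x + (-1) ^+ s * k%:R * y| <= `|x| + k%:R * `|y|.
  apply: (le_trans (ler_normD _ _)); rewrite lerD2l !normrM normrX normrN1 expr1n mul1r.
  by rewrite ger0_norm.
have := normr_ge0 x; have := normr_ge0 y => y0 x0.
rewrite -[(x + _) ^+ 2]real_normK ?num_real // -[y ^+ 2]real_normK ?num_real //.
have n0 := normr_ge0 (x + (-1) ^+ s * k%:R * y).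
apply: (le_trans (y := (`|x| + k%:R * `|y| + `|y|) ^+ 2)); last first.
  rewrite ler_pXn2r ?nnegrE ?addr_ge0 ?mulr_ge0 //.
  rewrite -(natr1 k); nra.
have : `|x + (-1) ^+ s * k%:R * y| ^+ 2 <= (`|x| + k%:R * `|y|) ^+ 2.
  by rewrite ler_pXn2r ?nnegrE ?addr_ge0 ?mulr_ge0.
have := mulr_ge0 k0 y0; nra.
Qed.

Lemma tame_growth (p : V) (v : V) : tame p -> v != 0 ->
  ((fun k : nat => ln (rm_norm flat_metric (tdiff (iter k standard_map)
      (v : tangent (p : @plane R)))) / k%:R) @ \oo --> (0 : R)) /\
  ((fun k : nat => ln (rm_norm flat_metric (tdiff (iter k (diffeo_inv standard_map))
      (v : tangent (p : @plane R)))) / (- k%:R)) @ \oo --> (0 : R)).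
Proof.
move=> tp v0; split.
  have [c [C [c0 hk]]] := sqrt_growth false v0.
  apply: (ln_growth_cvg c0) => k.
  have -> : rm_norm flat_metric (tdiff (iter k standard_map) (v : tangent (p : @plane R))) =
      Num.sqrt ((v 0 0 + (-1) ^+ false * k%:R * v 0 1) ^+ 2 + v 0 1 ^+ 2).
    have dk := is_diff_iter (fun k => is_diff_smap (tp k).1) k.
    rewrite /rm_norm /tdiff /=.
    rewrite (_ : 'd _ p v = iter k unip v); last by have [_ ->] := dk.
    by rewrite iter_unip /flat_inner vec0 vec1 expr0 mul1r !expr2.
  exact: hk.
have [c [C [c0 hk]]] := sqrt_growth true v0.
rewrite (_ : (fun k => _) = (fun k : nat => - (ln (Num.sqrt ((v 0 0 + (-1) ^+ true * k%:R * v 0 1)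
   ^+ 2 + v 0 1 ^+ 2)) / k%:R))).
  by have h := cvgN (ln_growth_cvg c0 hk); rewrite oppr0 in h; exact: h.
apply/funext => k; rewrite invrN mulrN; congr (- (ln _ / _)).
have dk := is_diff_iter (fun k => is_diff_smapV (tp k).2) k.
rewrite /rm_norm /tdiff /=.
rewrite (_ : 'd _ p v = iter k unipV v); last by have [_ ->] := dk.
by rewrite iter_unipV /flat_inner vec0 vec1 expr1 mulN1r mulNr !expr2.
Qed.

(** A nonzero vector of [E i] grows at the rate [lam i] by definition and at the rate [0] by
    [tame_growth]. *)
Lemma splitting_exponent0 (p : @plane R) s (lam : 'I_s -> R)
    (E : 'I_s -> {vspace tangent p}) i : tame p ->
  lyapunov_splitting flat_metric standard_map lam E -> lam i = 0.
Proof.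
move=> tp [_ E0 _ _ hE]; have e0 := E0 i.
have pick0 : vpick (E i) != 0 by rewrite vpick0.
have [h _] := hE i (vpick (E i)) (memv_pick _) pick0.
have [h' _] := tame_growth tp pick0.
exact: (cvg_unique _ h h').
Qed.

Lemma tame_regular (p : @plane R) : tame p -> regular flat_metric standard_map p.
Proof.
move=> tp; exists 1%N, (fun=> 0), (fun=> fullv); split.
- by move=> i j _; rewrite !ord1.
- by move=> i; rewrite -dimv_eq0 dimvf /dim /=.
- by rewrite big_ord1.
- by apply/directvP => /=; rewrite !big_ord1.
- by move=> i v _ v0; apply: tame_growth.
Qed.

Lemma tame_exponent (p : @plane R) l : tame p ->
  lyapunov_exponent flat_metric standard_map p l -> l = 0.
Proof. by move=> tp [s [lam [E [h [i <-]]]]]; apply: splitting_exponent0 h. Qed.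

Lemma tame_chi_plus (p : @plane R) : tame p -> chi_plus flat_metric standard_map p = 0.
Proof.
move=> tp; rewrite /chi_plus; case: xgetP => // _ -> [s [lam [E [h ->]]]].
by apply: big1 => i; rewrite (splitting_exponent0 i tp h) ltxx.
Qed.

Lemma chi_plus_ge0 (p : @plane R) : 0 <= chi_plus flat_metric standard_map p.
Proof.
rewrite /chi_plus; case: xgetP => // _ -> [s [lam [E [h ->]]]].
by apply: sumr_ge0 => i li; rewrite mulrn_wge0 // ltW.
Qed.

End StandardMap.

(** * Null integrals and the exceptional set *)

Section NullIntegral.
Local Open Scope classical_set_scope.
Local Open Scope ring_scope.
Local Open Scope ereal_scope.
Import HBNNSimple.

(* No measurability is asked from [f]: the integral of a nonnegative function
   is the supremum of the integrals of the simple functions below it. *)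
Lemma ge0_integral_eq0 d (T : measurableType d) (R : realType)
    (mu : {measure set T -> \bar R}) (f : T -> \bar R) :
  (forall x, 0 <= f x) -> {ae mu, forall x, f x = 0} -> \int[mu]_x f x = 0.
Proof.
move=> f0 [B [mB B0 fB]]; rewrite ge0_integralTE //.
apply/eqP; rewrite eq_le; apply/andP; split; last first.
  apply: ereal_sup_ubound; exists (cst_nnsfun T (NngNum (lexx 0%R))) => //=.
  by rewrite sintegral0.
apply: ge_ereal_sup => _ [h hf <-]; rewrite -integralT_nnsfun.
rewrite (ae_eq_integral (cst 0)) ?integral0 //.
  exact/measurable_realfun.measurable_EFinP.
exists B; split => // x /= hx; apply: fB => fx; apply: hx => _.
by apply/le_anti/andP; split; [rewrite -fx; exact: hf | rewrite lee_fin fun_ge0].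
Qed.

End NullIntegral.

Section TameMeasurable.
Local Open Scope classical_set_scope.
Local Open Scope ring_scope.
Context {R : realType}.
Variable phi : R -> R.
Hypothesis sphi : smooth1 phi.
Local Notation V := 'rV[R]_2.

Lemma measurable_neq0 (u : V -> R) : continuous u ->
  measurable ([set p | u p != 0] : set (borel (@plane R))).
Proof.
move=> cu; apply: sub_sigma_algebra.
rewrite (_ : [set p | _] = u @^-1` [set x | x != 0]) //.
by apply: (@open_comp V) => [x _|]; [exact: cu | exact: open_neq].
Qed.

(** The complement is a countable union of open sets, since the derivative of [phi] and the iterates
    are continuous. *)
Lemma tame_measurable : measurable (~` tame phi : set (borel (@plane R))).
Proof.
have c1 : continuous (smap phi) := continuous_vec smoothf_shear1 (smoothf_shear2 sphi).
have c2 : continuous (smapV phi) :=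
  continuous_vec (smoothf_shearV1 sphi) (smoothf_shearV2 sphi).
have ci (g : V -> V) k : continuous g -> continuous (iter k g).
  move=> cg; elim: k => [|k IH] x; first exact: cvg_id.
  exact: (@continuous_comp V V V _ g x (IH x) (cg _)).
have cd : continuous (derive1 phi).
  move=> x; apply/differentiable_continuous/derivable1_diffP.
  exact/smooth1_derivable/smooth1_derive.
have cc (g : V -> V) k i : continuous g -> continuous (fun p => iter k g p 0 i).
  move=> cg x; apply: (@continuous_comp V V R _ (fun p : V => p 0 i)); first exact: ci.
  exact: coord_continuous.
rewrite (_ : ~` _ = \bigcup_k
  ([set p | derive1 phi (iter k (smap phi) p 0 0 + iter k (smap phi) p 0 1) != 0] `|`
   [set p | derive1 phi (iter k (smapV phi) p 0 0) != 0])).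
  apply: bigcup_measurable => k _; apply: measurableU; apply: measurable_neq0 => x.
    apply: (@continuous_comp V R R) (cd _).
    by apply: (@continuousD _ R V); apply: cc.
  apply: (@continuous_comp V R R) (cd _).
  exact: cc.
apply/seteqP; split=> p /=.
  move/existsNP => [k /not_andP hk]; exists k => //.
  by case: hk => /eqP ?; [left | right].
by move=> [k _ []] /eqP h /(_ k) [].
Qed.

End TameMeasurable.

(** * Realization of the system by a standard map *)

Section Orbits.
Local Open Scope classical_set_scope.
Local Open Scope ring_scope.
Context {R : realType}.
Variables N m : nat -> nat.
Hypothesis N0 : forall j, (0 < N j)%N.
Hypothesis m0 : forall j, (0 < m j)%N.
Hypothesis NS : forall j, (N j.+1 = N j * N j * m j)%N.
Local Notation nlev := (nlev N).
Local Notation ncell := (ncell N).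
Local Notation adr := (adr N m).
Local Notation idx := (@idx R N).
Local Notation stage := (@stage R N N0).
Local Notation spread := (spread N).
Local Notation place := (place N0).
Local Notation mv := (@mv R N m N0).
Local Notation phi := (@forcing R N m N0).
Local Notation Omega := (g_sigma_algebraType (@good_cells R N m)).
Local Notation gcell := (@gcell R N).

(** A position and the increment to the next one. This map intertwines [mv true] and the standard
    map. *)
Definition site (y : R) : @plane R := vec (place y) (place (mv true y) - place y).

Lemma site_clip y : site (clip y) = site y.
Proof. by rewrite /site mv_clip // !(place_clip N0 m0 NS). Qed.

Lemma smap_site y : smap phi (site y) = site (mv true y).
Proof.
rewrite /smap /site vec0 vec1 addrC subrK forcing_placeE // /kick.
rewrite (mvK N0 m0 NS true) (place_clip N0 m0 NS); congr vec; ring.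
Qed.

Lemma smapV_site y : smapV phi (site y) = site (mv false y).
Proof.
have -> : site y = smap phi (site (mv false y)); last exact: smapK.
by rewrite smap_site (mvK N0 m0 NS false) site_clip.
Qed.

Lemma iter_smap_site k y : iter k (smap phi) (site y) = site (iter k (mv true) y).
Proof. by elim: k => // k IH; rewrite iterS IH smap_site. Qed.

Lemma iter_smapV_site k y : iter k (smapV phi) (site y) = site (iter k (mv false) y).
Proof. by elim: k => // k IH; rewrite iterS IH smapV_site. Qed.

Lemma tame_site y : tame phi (site y).
Proof.
move=> k; rewrite iter_smap_site iter_smapV_site /site !vec0 vec1.
by rewrite addrC subrK !derive1_forcing.
Qed.

Lemma site_near y : \forall j \near \oo, forall z, idx j y = idx j z ->
  site z = vec (place y + (spread z - spread y)) (place (mv true y) - place y).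
Proof.
near=> j => z e; have sj : (stage y < j)%N by near: j; exists (stage y).+1.
have [f _] := free_le N0 m0 NS sj (free_stage N0 m0 NS true y).
rewrite /site (place_mv N0 m0 NS f e); congr vec.
have l : (idx j y < nlev j)%N by case/andP: f.
by rewrite /place (stage_eq N0 m0 NS l e); ring.
Unshelve. all: by end_near. Qed.

(** On the cell of a large stage [j] around a point, [site] varies by at most [2^-1 ^+ j], by
    [site_near] and [spread_close]; hence the preimage of an open set is a countable union of
    cells. *)
Lemma site_measurable : measurable_fun setT (site : Omega -> borel (@plane R)).
Proof.
apply: (@measurability _ _ _ (borel (@plane R)) _ _ open) => //.
move=> _ [B oB <-]; rewrite setTI.
pose D (p : nat * nat) := `[< gcell p.1 p.2 `<=` site @^-1` B >].
have -> : site @^-1` B = \bigcup_p (if D p then gcell p.1 p.2 else set0).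
  apply/seteqP; split=> [y By | y [p _]]; last first.
    by case: ifP => // /asboolP; apply.
  have [e /= e0 eB] := (nbhs_ballP _ _).1 (open_nbhs_nbhs (conj oB By)).
  have [j [hj ej]] : exists j, (forall z, idx j y = idx j z ->
      site z = vec (place y + (spread z - spread y)) (place (mv true y) - place y))
      /\ 2^-1 ^+ j < e.
    near \oo => j; exists j; split; first by near: j; apply: site_near.
    near: j; have := near_infty_natSinv_expn_lt (PosNum e0).
    by apply: filterS => j; rewrite div1r exprVn.
  exists (j, idx j y) => //=; rewrite ifT //; apply/asboolP => z /= yz.
  apply: eB; rewrite (hj z) -?yz //.
  split=> [//|a b]; rewrite ord1; have [->|b0] := eqVneq b 0.
    rewrite !vec0 /ball /= opprD addrA subrr add0r normrN.
    by apply: le_lt_trans ej; apply: (spread_close N0 m0 NS yz).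
  have -> : b = 1 by apply: val_inj; case: b b0 => -[|[|]].
  by rewrite !vec1; apply: ballxx.
apply: countable_bigcupT_measurable; first exact: countableP.
by move=> p; case: ifP => // _; apply: gcell_measurable.
Unshelve. all: by end_near. Qed.

Lemma stage_mono (y z : R) : clip y <= clip z -> (stage y <= stage z)%N.
Proof.
move=> yz; apply: stage_min; apply: leq_ltn_trans (stageP N0 z).
by rewrite le_truncn // ler_wpM2l // ltW ?width_gt0.
Qed.

Lemma place_corner_le k c y : (c < nlev k)%N ->
  (place (corner N k c.+1) <= place y) = (c < idx k y)%N.
Proof.
move=> cn; have cn' : (c.+1 < ncell k)%N.
  by rewrite -nlev_ncell; have := N0 k; lia.
have [h|h] := leqP c.+1 (idx k y).
  have cy : clip (corner N k c.+1) <= clip y.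
    rewrite clip_id ?corner_itv // /corner ler_pdivrMr ?width_gt0 // mulrC.
    by case/andP: (idx_itv N k y) => + _; apply: le_trans; rewrite ler_nat.
  by rewrite /place !lerD ?spread_mono // ler_nat stage_mono.
apply/negbTE; rewrite -ltNge.
have h' : (idx k y < idx k (corner N k c.+1))%N by rewrite idx_corner.
have := spread_sep N0 h'; have := @gap_gt0 R N N0 k.
have : (stage y)%:R <= (stage (corner N k c.+1))%:R :> R.
  rewrite ler_nat; apply: stage_mono; apply/ltW.
  rewrite [clip (corner _ _ _)]clip_id ?corner_itv // /corner ltr_pdivlMr ?width_gt0 // mulrC.
  case/andP: (idx_itv N k y) => _ /lt_le_trans; apply; rewrite ler_nat; exact: h.
rewrite /place; lra.
Qed.

(** The partition into levels has to be realized by Borel sets of the plane. As [place] increases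
    from cell to cell, counting the thresholds below the first coordinate recovers the level. *)
Definition slabs k (p : @plane R) : {ffun 'I_(nlev k) -> bool} :=
  [ffun c : 'I_(nlev k) => `[< place (corner N k c.+1) <= (p : 'rV[R]_2) 0 0 >]].

Definition slab k (p : @plane R) : 'I_(nlev k).+1 := inord (\sum_c slabs k p c)%N.

Lemma rvar_slab k : rvar (slab k : borel (@plane R) -> _).
Proof.
pose g (w : {ffun 'I_(nlev k) -> bool}) : 'I_(nlev k).+1 := inord (\sum_c w c)%N.
have -> : slab k = g \o slabs k by [].
apply: (@rvar_comp _ (borel (@plane R)) _ _ (slabs k) g) => w.
rewrite (_ : _ @^-1` _ = \bigcap_(c in [set: 'I_(nlev k)])
   [set p | slabs k p c = w c]); last first.
  apply/seteqP; split=> p /=; first by move=> <-.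
  by move=> h; apply/ffunP => c; apply: h.
apply: fin_bigcap_measurable => [|c _]; first exact: finite_finset.
have mH : measurable ([set p | place (corner N k c.+1) <= (p : 'rV[R]_2) 0 0] :
    set (borel (@plane R))).
  rewrite -[X in measurable X]setCK; apply: measurableC.
  apply: sub_sigma_algebra.
  rewrite (_ : ~` _ = (fun p : 'rV[R]_2 => p 0 0) @^-1` [set x | x < place (corner N k c.+1)]).
    apply: (@open_comp 'rV[R]_2); last exact: open_lt.
    by move=> x _; exact: coord_continuous.
  by apply/seteqP; split=> p /=; [move/negP; rewrite ltNge | rewrite ltNge => /negP].
case: (w c).
  rewrite (_ : [set p | _] = [set p | place (corner N k c.+1) <= (p : 'rV[R]_2) 0 0]) //.
  by apply/seteqP; split=> p /=; rewrite ffunE => /asboolP.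
rewrite (_ : [set p | _] = ~` [set p | place (corner N k c.+1) <= (p : 'rV[R]_2) 0 0]).
  exact: measurableC.
by apply/seteqP; split=> p /=; rewrite ffunE; [move/negbT/asboolPn | move/asboolPn/negbTE].
Qed.

Lemma slab_site k y : slab k (site y) = lev N idx k y.
Proof.
apply: val_inj; rewrite /= val_lev /slab.
have -> : (\sum_c slabs k (site y) c = minn (idx k y) (nlev k))%N.
  under eq_bigr => c _ do rewrite ffunE vec0 asboolb place_corner_le //.
  rewrite -(big_mkord xpredT (fun c => (c < idx k y)%N : nat)).
  elim: (nlev k) => [|n IH]; first by rewrite big_nil minn0.
  by rewrite big_nat_recr //= IH; case: leqP; lia.
by rewrite inordK // ltnS geq_minr.
Qed.

Lemma slab_partition k : classical_sets.partition [set: 'I_(nlev k).+1]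
  (fun b => slab k @^-1` [set b]) [set: borel (@plane R)].
Proof.
split.
- by apply/seteqP; split=> // p _; exists (slab k p).
- by move=> i j _ _ [p [/= <- <-]].
move=> b _; have bn : (b < ncell k)%N.
  by apply: (leq_trans (ltn_ord b)); rewrite -nlev_ncell; have := N0 k; lia.
exists (site (corner N k b)); rewrite /= slab_site; apply: val_inj.
by rewrite /= val_lev idx_corner //; apply/minn_idPl; rewrite -ltnS.
Qed.

Lemma idx_mv_fwd j y : (idx j y < nlev j)%N ->
  inner true j (adr j (idx j y)).2 -> idx j (mv true y) = next N m true j (idx j y).
Proof. by move=> l i; apply: (idx_mv N0 m0 NS); rewrite /free l. Qed.

Lemma idx_mv_bwd j y : (idx j (mv true y) < nlev j)%N ->
  inner false j (adr j (idx j (mv true y))).2 ->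
  idx j y = next N m false j (idx j (mv true y)).
Proof.
move=> l i; rewrite -(idx_clip N j y) -(mvK N0 m0 NS true y).
by apply: (idx_mv N0 m0 NS); rewrite /free l.
Qed.

Lemma idx_generates : (@measurable _ Omega) `<=`
  <<s [set A | exists j b, A = idx j @^-1` [set b]] >>.
Proof.
apply: smallest_sub; first exact: smallest_sigma_algebra.
move=> A [->|[j [b [_ _ ->]]]]; first exact: sigma_algebra0.
by apply: sub_sigma_algebra; exists j, b.
Qed.

Local Notation F := (@standard_map R phi (@smooth1_forcing R N m N0)).

Section OrbitMeasure.
Variable P : probability Omega R.
Hypothesis PE : forall j b, (b < ncell j)%N -> P (gcell j b) = ((ncell j)%:R^-1)%:E.
Variable mu : probability (borel (@plane R)) R.
Hypothesis muE : forall A, mu A = P (site @^-1` A).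

Lemma orbit_invariant : invariant_measure mu F.
Proof.
move=> A mA; rewrite !muE.
rewrite (_ : site @^-1` _ = mv true @^-1` (site @^-1` A)).
  apply: (mv_invariant N0 m0 NS PE).
  by rewrite -[X in measurable X]setTI; apply: site_measurable.
by apply/seteqP; split=> y /=; rewrite smap_site.
Qed.

(** By [iter_smap_site], the refinement of [Q] pulls back to the level sets of the itinerary of
    [xi]. *)
Lemma refinement_rate (k : nat) (Q : 'I_k -> set (borel (@plane R))) (xi : Omega -> 'I_k) :
  (forall i, xi @^-1` [set i] = site @^-1` (Q i)) ->
  (fun n => partition_entropy mu (refinement F (m:=n) Q) / n%:R) = rate P (mv true) xi.
Proof.
move=> xiE; apply/funext => n; rewrite /rate /partition_entropy /ent; congr (- _ / _).
apply: eq_bigr => w _; suff -> : fine (mu (refinement F Q w)) = law P (name (mv true) xi n) w by [].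
rewrite /law /pr muE; congr (fine (P _)); apply/seteqP; split=> y /=.
  move=> h; apply/ffunP => i; rewrite ffunE.
  have : (site @^-1` Q (w i)) (iter i (mv true) y).
    by rewrite /= -iter_smap_site; apply: h.
  by rewrite -xiE.
move=> <- i _ /=; rewrite iter_smap_site ffunE.
by have : (xi @^-1` [set xi (iter i (mv true) y)]) (iter i (mv true) y) by []; rewrite xiE.
Qed.

Let mS : measurable_fun setT (mv true : Omega -> Omega) := mv_measurable N0 m0 NS.
Let PS : forall A : set Omega, measurable A -> P (mv true @^-1` A) = P A :=
  mv_invariant N0 m0 NS PE.

Let midx j b : measurable (idx j @^-1` [set b] : set Omega) :=
  gcell_measurable N0 m0 NS j b.

(** The partition into slabs pulls back to the partition into levels of stage [k]. *)
Lemma orbit_entropy_ge k : ((ln (N k)%:R / (ht k + 2)%:R)%:E <= ks_entropy mu F)%E.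
Proof.
have mlev : rvar (lev N idx k : Omega -> _) by exact: (@rvar_lev N _ Omega idx midx k).
have [l cl _] := rate_cvg mS PS mlev.
apply: (@le_trans _ _ l%:E).
  rewrite lee_fin; exact: (rate_lev_ge N0 m0 NS mS PS (@idx_lt R N N0)
    (@idxS R N m N0 m0 NS) midx PE idx_mv_fwd cl).
apply: ereal_sup_ubound; exists (nlev k).+1, (fun b => slab k @^-1` [set b]); split.
- exact: slab_partition.
- exact: rvar_slab.
- rewrite (refinement_rate (xi := lev N idx k)) ?(cvg_lim _ cl) // => i.
  by apply/seteqP; split=> y /=; rewrite slab_site.
Qed.

(** A partition of the plane gives the finite-valued variable [xi], the index of the set that
    contains [site y], and [rate_le] holds for every such variable. *)
Lemma orbit_entropy_le C : (forall i, ln (N i)%:R / (ht i + 2)%:R <= C) ->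
  (ks_entropy mu F <= C%:E)%E.
Proof.
move=> hC; apply: ge_ereal_sup => _ [k [Q [[cQ tQ _] mQ ->]]].
have /choice[xi xiQ] y : exists i, Q i (site y).
  by have : (cover setT Q) (site y) by [rewrite cQ]; case=> i _ Qi; exists i.
have xiE i : xi @^-1` [set i] = site @^-1` (Q i).
  apply/seteqP; split=> y /=; first by move=> <-.
  by move=> Qi; apply: tQ => //; exists (site y).
have mxi : rvar (xi : Omega -> _).
  by move=> i; rewrite xiE -[X in measurable X]setTI; apply: site_measurable.
have [l cl hl] := rate_cvg mS PS mxi.
rewrite (refinement_rate xiE) (cvg_lim _ cl) // lee_fin.
exact: (rate_le N0 m0 NS mS PS (@idxS R N m N0 m0 NS) midx PE idx_mv_fwd
  idx_mv_bwd idx_generates mxi hC hl).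
Qed.

Lemma orbit_tame : {ae mu, forall p, tame phi p}.
Proof.
have tm := tame_measurable (@smooth1_forcing R N m N0).
exists (~` tame phi); split => //; rewrite muE (_ : site @^-1` _ = set0) ?measure0 //.
by apply/seteqP; split=> y //=; apply; apply: tame_site.
Qed.

End OrbitMeasure.

Lemma orbit_system : exists mu : probability (borel (@plane R)) R,
  [/\ invariant_measure mu F, {ae mu, forall p, tame phi p},
      forall k, ((ln (N k)%:R / (ht k + 2)%:R)%:E <= ks_entropy mu F)%E &
      forall C, (forall i, ln (N i)%:R / (ht i + 2)%:R <= C) ->
        (ks_entropy mu F <= C%:E)%E].
Proof.
have [P PE] := @line_probability R N m N0.
have [mu muE] := pushforward_probability P site_measurable.
exists mu; split.
- exact: orbit_invariant muE.
- exact: orbit_tame muE.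
- exact: orbit_entropy_ge muE.
- exact: orbit_entropy_le muE.
Qed.

End Orbits.

(** * Choice of the numbers of columns *)

Section Realization.
Local Open Scope classical_set_scope.
Local Open Scope ring_scope.
Context {R : realType}.

Lemma growth_system (a : nat -> nat) : (forall j, (2 * a j <= a j.+1)%N) ->
  exists (phi : R -> R) (sphi : smooth1 phi) (mu : probability (borel (@plane R)) R),
  let e j : R := (a j)%:R * (ln 2 / 3) / 2 ^+ j in
  [/\ invariant_measure mu (standard_map sphi), {ae mu, forall p, tame phi p},
      forall k, ((e k)%:E <= ks_entropy mu (standard_map sphi))%E &
      forall C, (forall k, e k <= C) -> (ks_entropy mu (standard_map sphi) <= C%:E)%E].
Proof.
move=> ha; pose N j := (2 ^ a j)%N; pose m j := (2 ^ (a j.+1 - 2 * a j))%N.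
have N0 j : (0 < N j)%N by rewrite expn_gt0.
have m0 j : (0 < m j)%N by rewrite expn_gt0.
have NS j : N j.+1 = (N j * N j * m j)%N.
  by rewrite /N /m -!expnD addnn -mul2n subnKC.
have [mu [inv tm ge le]] := @orbit_system R N m N0 m0 NS.
exists (@forcing R N m N0), (@smooth1_forcing R N m N0), mu => e.
have eE k : ln (N k)%:R / (ht k + 2)%:R = e k.
  rewrite ht2 /N natrX lnXn // natrM natrX -(mulr_natr (ln 2)) /e.
  by field; rewrite expf_neq0.
split=> // [k|C hC]; first by rewrite -eE.
by apply: le => k; rewrite eE.
Qed.

Lemma entropy_realization (h : \bar R) : (0 < h)%E ->
  exists (phi : R -> R) (sphi : smooth1 phi) (mu : probability (borel (@plane R)) R),
  [/\ invariant_measure mu (standard_map sphi), {ae mu, forall p, tame phi p} &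
      ks_entropy mu (standard_map sphi) = h].
Proof.
have l2 : 0 < ln 2 :> R by rewrite ln_gt0 // ltr1n.
have p2 k : 0 < 2 ^+ k :> R by rewrite exprn_gt0.
case: h => [r||] // r0.
  (* The exponents [2 ^+ j * c] would give exactly [r] at each stage. Truncation keeps
     [2 * a j <= a j.+1] and loses at most [ln 2 / 3 / 2 ^+ j]. *)
  pose c : R := 3 * r / ln 2; have c0 : 0 < c by rewrite divr_gt0 ?mulr_gt0.
  pose a j := Num.truncn (2 ^+ j * c).
  have aI j : (a j)%:R <= 2 ^+ j * c < (a j).+1%:R.
    by apply: truncn_itv; rewrite mulr_ge0 ?ltW.
  have [j|phi [sphi [mu [inv tm ge le]]]] := @growth_system a.
    rewrite /a truncn_ge_nat; last by rewrite mulr_ge0 // ltW.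
    rewrite natrM exprS -mulrA ler_pM2l //.
    by case/andP: (aI j).
  have rE k : 2 ^+ k * c * (ln 2 / 3 / 2 ^+ k) = r.
    by rewrite /c; field; rewrite !gt_eqF.
  have w0 k : 0 < ln 2 / 3 / 2 ^+ k :> R by rewrite !divr_gt0.
  exists phi, sphi, mu; split=> //; apply/le_anti/andP; split.
    apply: le => k; rewrite -[leRHS](rE k) -(mulrA (a k)%:R) ler_pM2r //.
    by case/andP: (aI k).
  apply/lee_addgt0Pr => e e0.
  have d0 : 0 < e / (ln 2 / 3) by rewrite !divr_gt0.
  have [k _ /(_ k (leqnn k)) /= hk] := near_infty_natSinv_expn_lt (PosNum d0).
  apply: (le_trans _ (leeD2r e%:E (ge k))); rewrite -EFinD lee_fin -[leLHS](rE k).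
  have we : ln 2 / 3 / 2 ^+ k <= e.
    by move: hk; rewrite div1r ltr_pdivlMr ?divr_gt0 // mulrC => /ltW.
  apply: (le_trans _ (lerD (lexx _) we)).
  rewrite -(mulrA (a k)%:R) -[X in _ <= _ + X]mul1r -mulrDl ler_pM2r // natr1.
  by case/andP: (aI k) => _ /ltW.
(* With this choice the lower bound at stage [j] is [j * (ln 2 / 3)], which is unbounded. *)
have [j|phi [sphi [mu [inv tm ge _]]]] := @growth_system (fun j => (j * 2 ^ j)%N).
  by rewrite expnS; lia.
exists phi, sphi, mu; split=> //; apply/eqyP => A A0.
pose k := (Num.truncn (A / (ln 2 / 3))).+1.
apply: le_trans (ge k); rewrite lee_fin natrM natrX mulrAC mulfK ?gt_eqF //.
rewrite -ler_pdivrMr ?divr_gt0 //; exact/ltW/truncnS_gt.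
Qed.

End Realization.

Local Open Scope classical_set_scope.
Local Open Scope ereal_scope.

Theorem theorem1p1 (R : realType) (h : \bar R) (hpos : 0 < h) :
  exists (n : nat) (M : smooth_manifold R n) (g : riemannian_metric M)
         (f : diffeomorphism M) (mu : probability (borel M) R),
    [/\ ~ compact [set: M],
        invariant_measure mu f,
        ks_entropy mu f = h,
        {ae mu, forall x, regular g f x /\
                          forall l : R, lyapunov_exponent g f x l -> l = 0%R}
      & \int[mu]_x (chi_plus g f x)%:E = 0 /\ 0 < ks_entropy mu f <= +oo].
Proof.
have [phi [sphi [mu [inv tm ksE]]]] := entropy_realization hpos.
exists 2%N, plane, flat_metric, (standard_map sphi), mu; split=> //.
- exact: plane_noncompact.
- case: tm => B [mB B0 tB]; exists B; split=> // p np; apply: tB => tp; apply: np.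
  by split=> [|l]; [exact: tame_regular | exact: tame_exponent].
- rewrite ksE hpos leey; split=> //; apply: ge0_integral_eq0 => [p|].
    by rewrite lee_fin chi_plus_ge0.
  case: tm => B [mB B0 tB]; exists B; split=> // p np; apply: tB => tp; apply: np.
  by rewrite /= tame_chi_plus.
Qed.
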